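(* The central cocharacter sequence of the pair $(M_3(K),so_3(K))$ is \[\chi_n^{c}(M_3(K),so_3(K))=\sum_{\lambda}\chi_\lambda,\] where $\lambda=(\lambda_1,\lambda_2,\lambda_3)\vdash n$ runs over the partitions with $\lambda_2>0$ and $\lambda_1-\lambda_2\equiv\lambda_2-\lambda_3\equiv0\pmod2$. Moreover, writing such $\lambda$ as $\lambda=(2(\mu_1+\mu_2)+\lambda_3,\,2\mu_2+\lambda_3,\,\lambda_3)$ with $\mu_2+\lambda_3>0$, the highest weight vector corresponding to $\chi_\lambda$ is the following element of $K\langle x_1,x_2,x_3\rangle$ (where $v:=[x_1,x_2]^2-\frac13(x_1^2x_2^2-x_1x_2^2x_1-x_2x_1^2x_2+x_2^2x_1^2)$): \begin{itemize} \item if $\mu_1,\mu_2>0$: $s_3^{\lambda_3}\,v^{\mu_2-1}\,w'_{\mu_1}$, where $w'_{\mu_1}=[x_1,x_2]^2x_1^{2\mu_1}-[x_1,x_2](x_1^{2\mu_1+1}x_2-x_2x_1^{2\mu_1+1})+(x_1^3x_2^2-x_1x_2x_1x_2x_1-x_2x_1^3x_2+x_2^2x_1^3)x_1^{2\mu_1-1}$; \item if $\mu_1>0,\mu_2=0$: $s_3^{\lambda_3-1}\,w''_{\mu_1}$, where $w''_{\mu_1}=s_3(x_1,x_2,x_3)x_1^{2\mu_1}+2\sum_{\sigma\in S_3}\mathrm{sign}(\sigma)x_{\sigma(1)}x_{\sigma(2)}x_1^{2\mu_1}x_{\sigma(3)}$; \item if $\mu_1=0$: $s_3^{\lambda_3}\,v^{\mu_2}$.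 \end{itemize} Here $s_3=s_3(x_1,x_2,x_3)=\sum_{\sigma\in S_3}\mathrm{sign}(\sigma)x_{\sigma(1)}x_{\sigma(2)}x_{\sigma(3)}$; in particular each of these elements is a weak central polynomial for $(M_3(K),so_3(K))$ and a highest weight vector of weight $\lambda$.
   Context: $K$ is a field of characteristic $0$, $so_3(K)$ the Lie algebra of $3\times3$ skew-symmetric matrices, $K\langle X\rangle=K\langle x_1,x_2,\dots\rangle$ the free associative algebra, $[a,b]=ab-ba$. A weak polynomial identity for $(M_3(K),so_3(K))$ is $f\in K\langle X\rangle$ with $f(a_1,\dots,a_n)=0$ for all $a_i\in so_3(K)$; they form an ideal $I(M_3(K),so_3(K))$. A weak central polynomial for the pair is $f\in K\langle X\rangle$ such that $f(a_1,\dots,a_n)$ is a central (i.e. scalar) matrix for all $a_i\in so_3(K)$. Let $P_n$ be the multilinear polynomials in $x_1,\dots,x_n$ with the $S_n$-action permuting variables, and $P_n^{c}\subseteq P_n$ the subspace of multilinear weak central polynomials; the central cocharacter $\chi^c_n(M_3(K),so_3(K))$ is the $S_n$-character of $P_n^c/(P_n^c\cap I(M_3(K),so_3(K)))$, and $\chi_\lambda$ denotes the irreducible $S_n$-character indexed by $\lambda$. $\mathrm{GL}_3(K)$ acts on $Kx_1\oplus Kx_2\oplus Kx_3$ by $g(x_j)=\sum_i g_{ij}x_i$, extended diagonally to $K\langle x_1,x_2,x_3\rangle$; a highest weight vector of weight $\lambda$ is a nonzero element that is multihomogeneous of multidegree $\lambda$ in $(x_1,x_2,x_3)$ and fixed by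 all unipotent upper triangular matrices. *)

(* Defs.v *)
From HB Require Import structures.
From mathcomp Require Import all_boot all_order all_fingroup all_algebra.
From Stdlib Require Import ClassicalEpsilon.
Set Implicit Arguments. Unset Strict Implicit. Unset Printing Implicit Defensive.
Import Order.TTheory GRing.Theory.
Local Open Scope ring_scope.

Section FreeAlg.
Variable K : fieldType.

(* Free associative algebra K<x_0, x_1, x_2, ...>.  A word is a [seq nat]  *)
(* (the letter i stands for the variable x_i; the paper's x_1, x_2, x_3    *)
(* are the letters 1, 2, 3).  An element is a formal finite sum, given as  *)
(* a list of (coefficient, word) pairs; two lists denote the same element  *)
(* iff they have the same coefficient function [fcoef].                    *)
Definition fpoly := seq (K * seq nat).

Definition fcoef (p : fpoly) (w : seq nat) : K := \sum_(t <- p | t.2 == w) t.1.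

Definition fvar (i : nat) : fpoly := [:: (1, [:: i])].
Definition fmono (w : seq nat) : fpoly := [:: (1, w)].
Definition fone : fpoly := [:: (1, [::])].
Definition fadd (p q : fpoly) : fpoly := p ++ q.
Definition fscale (c : K) (p : fpoly) : fpoly := [seq (c * t.1, t.2) | t <- p].
Definition fsub (p q : fpoly) : fpoly := fadd p (fscale (-1) q).
Definition fmul (p q : fpoly) : fpoly :=
  [seq (a.1 * b.1, a.2 ++ b.2) | a <- p, b <- q].
Definition fexp (p : fpoly) (n : nat) : fpoly := iter n (fmul p) fone.
Definition fcomm (p q : fpoly) : fpoly := fsub (fmul p q) (fmul q p).
Definition fprod (ps : seq fpoly) : fpoly := foldr fmul fone ps.
Definition fsum (ps : seq fpoly) : fpoly := flatten ps.

Definition fsubst (s : nat -> fpoly) (p : fpoly) : fpoly :=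
  flatten [seq fscale t.1 (fprod [seq s i | i <- t.2]) | t <- p].

Definition feval (a : nat -> 'M[K]_3) (p : fpoly) : 'M[K]_3 :=
  \sum_(t <- p) t.1 *: \prod_(i <- t.2) a i.

Definition skew3 (A : 'M[K]_3) : Prop := A^T = - A.

Definition weak_identity (f : fpoly) : Prop :=
  forall a : nat -> 'M[K]_3, (forall i, skew3 (a i)) -> feval a f = 0.

Definition weak_central (f : fpoly) : Prop :=
  forall a : nat -> 'M[K]_3, (forall i, skew3 (a i)) -> is_scalar_mx (feval a f).

(* GL_3(K) action on K<x_1,x_2,x_3>:  g(x_j) = sum_i g_ij x_i              *)
(* (letters other than 1,2,3 are left fixed; irrelevant on K<x1,x2,x3>).   *)
Definition gl3_var (g : 'M[K]_3) (j : nat) : fpoly :=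
  if (0 < j <= 3)%N then
    [seq (g (inord i) (inord j.-1), [:: i.+1]) | i <- iota 0 3]
  else fvar j.

Definition gl3_act (g : 'M[K]_3) (f : fpoly) : fpoly := fsubst (gl3_var g) f.

Definition unipotent_upper (g : 'M[K]_3) : Prop :=
  forall i j : 'I_3, ((j < i)%N -> g i j = 0) /\ (i = j -> g i j = 1).

Definition hw_vector (l1 l2 l3 : nat) (f : fpoly) : Prop :=
  [/\ exists w, fcoef f w != 0,
      (forall w, fcoef f w != 0 ->
         [/\ all (fun i => i \in [:: 1; 2; 3]%N) w,
             count_mem 1%N w = l1, count_mem 2%N w = l2 & count_mem 3%N w = l3])
    & forall g, unipotent_upper g -> forall w, fcoef (gl3_act g f) w = fcoef f w].

(* Multilinear polynomials P_n, identified with K^{S_n} via the basis of   *)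
(* monomials x_{s(1)} ... x_{s(n)}, s in S_n.                               *)
Definition Nn (n : nat) := #|{perm 'I_n}|.

Definition perm_of n (i : 'I_(Nn n)) : {perm 'I_n} := enum_val i.

Definition pword n (s : {perm 'I_n}) : seq nat := [seq (val (s i)).+1 | i <- enum 'I_n].

Definition poly_of_vec n (v : 'rV[K]_(Nn n)) : fpoly :=
  [seq (v 0 i, pword (perm_of i)) | i <- enum 'I_(Nn n)].

Definition permvar n (t : {perm 'I_n}) (j : nat) : nat :=
  if j is j'.+1 then
    (if @insub _ (fun k => k < n)%N _ j' is Some k then (val (t k)).+1 else j)
  else j.

Definition perm_act n (t : {perm 'I_n}) (f : fpoly) : fpoly :=
  fsubst (fun j => fvar (permvar t j)) f.

(* matrix of the action of t on P_n (row-vector convention) *)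
Definition Pact n (t : {perm 'I_n}) : 'M[K]_(Nn n) :=
  \matrix_(i, j) fcoef (perm_act t (fmono (pword (perm_of i)))) (pword (perm_of j)).

(* a matrix whose row space is the subspace {v | P v} (when it is one) *)
Definition spanmx m (P : 'rV[K]_m -> Prop) : 'M[K]_m :=
  epsilon (inhabits 0) (fun U : 'M[K]_m => forall v, (v <= U)%MS <-> P v).

Definition Pc n : 'M[K]_(Nn n) := spanmx (fun v => weak_central (poly_of_vec v)).
Definition PI n : 'M[K]_(Nn n) := spanmx (fun v => weak_identity (poly_of_vec v)).

(* trace of A restricted to the (A-invariant) row space of U *)
Definition tr_restr m (U A : 'M[K]_m) : K :=
  \tr (row_base U *m A *m pinvmx (row_base U)).

(* central cocharacter: character of P_n^c / (P_n^c \cap I) *)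
Definition central_cochar n (t : {perm 'I_n}) : K :=
  tr_restr (Pc n) (Pact t) - tr_restr (Pc n :&: PI n)%MS (Pact t).

(* Irreducible character chi_lambda, lambda = (l1,l2,l3): character of the *)
(* Specht module K S_n a_T b_T (left ideal), T the row-reading tableau.    *)
(* Entries of T are 0..n-1.                                                 *)
Definition yrow (l1 l2 i : nat) : nat :=
  if (i < l1)%N then 0 else if (i < l1 + l2)%N then 1 else 2.
Definition ycol (l1 l2 i : nat) : nat :=
  if (i < l1)%N then i else if (i < l1 + l2)%N then (i - l1)%N else (i - (l1 + l2))%N.

Definition row_stab n l1 l2 : {set {perm 'I_n}} :=
  [set p : {perm 'I_n} | [forall i, yrow l1 l2 (p i) == yrow l1 l2 i]].
Definition col_stab n l1 l2 : {set {perm 'I_n}} :=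
  [set q : {perm 'I_n} | [forall i, ycol l1 l2 (q i) == ycol l1 l2 i]].

(* the group algebra element t o a_T o b_T, as a vector over S_n
   (mathcomp: (q * p * t) x = t (p (q x))) *)
Definition specht_row n l1 l2 (t : {perm 'I_n}) : 'rV[K]_(Nn n) :=
  \row_j \sum_(p in row_stab n l1 l2) \sum_(q in col_stab n l1 l2)
          (((q * p * t)%g == perm_of j)%:R * (-1) ^+ odd_perm q).

Definition spechtmx n l1 l2 : 'M[K]_(Nn n) :=
  \matrix_(i < Nn n) specht_row l1 l2 (perm_of i).

(* left regular action of t on K S_n: s |-> t o s *)
Definition Rreg n (t : {perm 'I_n}) : 'M[K]_(Nn n) :=
  \matrix_(i, j) (perm_of j == (perm_of i * t)%g)%:R.

Definition irr_char n (l1 l2 : nat) (t : {perm 'I_n}) : K :=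
  tr_restr (spechtmx n l1 l2) (Rreg t).

Definition x1 := fvar 1. Definition x2 := fvar 2. Definition x3 := fvar 3.

Definition sgnK (s : {perm 'I_3}) : K := (-1) ^+ odd_perm s.
Definition xo (i : 'I_3) : fpoly := fvar (val i).+1.

Definition s3 : fpoly :=
  fsum [seq fscale (sgnK s) (fprod [:: xo (s 0); xo (s 1); xo (s 2)])
       | s <- enum {perm 'I_3}].

Definition c12 := fcomm x1 x2.

Definition vv : fpoly :=
  fsub (fexp c12 2)
    (fscale (3%:R)^-1
      (fsum [:: fprod [:: x1; x1; x2; x2]; fscale (-1) (fprod [:: x1; x2; x2; x1]);
                fscale (-1) (fprod [:: x2; x1; x1; x2]); fprod [:: x2; x2; x1; x1]])).

Definition w1 (m1 : nat) : fpoly :=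
  fsum [:: fmul (fexp c12 2) (fexp x1 (2 * m1));
           fscale (-1) (fmul c12 (fsub (fmul (fexp x1 (2 * m1).+1) x2)
                                       (fmul x2 (fexp x1 (2 * m1).+1))));
           fmul (fsum [:: fprod [:: x1; x1; x1; x2; x2];
                          fscale (-1) (fprod [:: x1; x2; x1; x2; x1]);
                          fscale (-1) (fprod [:: x2; x1; x1; x1; x2]);
                          fprod [:: x2; x2; x1; x1; x1]])
                (fexp x1 (2 * m1).-1)].

Definition w2 (m1 : nat) : fpoly :=
  fadd (fmul s3 (fexp x1 (2 * m1)))
    (fscale 2%:R
      (fsum [seq fscale (sgnK s) (fprod [:: xo (s 0); xo (s 1); fexp x1 (2 * m1); xo (s 2)])
            | s <- enum {perm 'I_3}])).

(* lambda = (2(m1+m2)+l3, 2 m2 + l3, l3) *)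
Definition hwv (m1 m2 l3 : nat) : fpoly :=
  if (0 < m1)%N && (0 < m2)%N then fmul (fexp s3 l3) (fmul (fexp vv m2.-1) (w1 m1))
  else if (0 < m1)%N then fmul (fexp s3 l3.-1) (w2 m1)
  else fmul (fexp s3 l3) (fexp vv m2).

End FreeAlg.

Definition good_lambda (n l1 l2 l3 : nat) : bool :=
  [&& l1 + l2 + l3 == n, l3 <= l2, l2 <= l1, 0 < l2,
      ~~ odd (l1 - l2) & ~~ odd (l2 - l3)]%N.

(* Main.v *)
Require Import Defs.
From HB Require Import structures.
From mathcomp Require Import all_boot all_order all_fingroup all_algebra.
From mathcomp Require Import pgroup mxrepresentation.
From mathcomp Require Import zify ring.
From Stdlib Require Import Classical ClassicalEpsilon.
Set Implicit Arguments.
Unset Strict Implicit.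
Unset Printing Implicit Defensive.
Import GRing.Theory.
Local Open Scope ring_scope.

(** On [so_3 = K^3] a multilinear weak central polynomial takes scalar values that are
    invariant under rotations, so modulo weak identities the space [P_n^c] embeds, as an
    [S_n]-module, into the rotation-invariant multilinear functions on [(K^3)^n].

    Multiplicities.  Antisymmetrising the columns of a tableau of shape [lambda] and then
    identifying the variables in each row gives a polynomial function on 3x3 matrices that
    is invariant under rotations on the left and is a weight vector of weight [lambda] for
    upper triangular matrices on the right.  Almost every matrix is a product of a rotation
    and an upper triangular matrix, so such a function is determined by its value at the
    identity, and the half-turns commuting with the torus force the parity conditions.
    Hence every multiplicity is at most one, and it is zero unless [lambda] is good.

    Existence.  The explicit polynomials are nonzero at the identity.  Their linearisations
    satisfy Garnir relations, hence are eigenvectors of the sum of all transpositions; the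
    eigenvalue (the sum of the contents of [lambda]) shows that they generate a copy of the
    Specht module.  The same argument shows that every nonzero submodule contains a Specht
    module of a shape with at most three rows, which gives the whole decomposition. *)

(** * The group algebra of the symmetric group *)

(** [K] may lack square roots, so a generic matrix cannot be rotated to upper triangular form over
    [K] itself. The remedy is to let one entry vary along a line. The values for which the relevant
    sum of squares is a square have a rational parametrisation and are infinite in number; there a
    half-turn, whose matrix is rational in its axis, does the rotating, and a polynomial in that
    entry with infinitely many zeros vanishes.

    The sum of transpositions alone cannot identify a shape: [(4,1,1)] and [(3,3)] have the same sum
    of contents. Contents do increase strictly along the dominance order, so a shape known to
    dominate the given one is required. On the column side, and for arbitrary submodules, Garnir
    relations come from an extremal choice: among the colourings of the variables whose symmetriser
    does not kill the module, one with the largest sum of squares of class sizes is taken, and every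
    move of a point into a class at least as large then gives zero.

    The condition [l2 > 0] comes from one-row shapes, where only powers of one skew matrix occur;
    their value at the identity has top left entry 0. *)

Section GroupAlgebra.
Variables (K : fieldType) (n : nat).
Implicit Types (s t x p q : {perm 'I_n}).

(* A row vector is an element of the group algebra, and [v *m rho t] is the product [v t] in
   the order of [perm], which is the left action of [t] on multilinear polynomials:
   submodules are right ideals here. *)
Notation rho := (Rreg K).
Definition rk t : 'I_(Nn n) := enum_rank t.
Definition ds t : 'rV[K]_(Nn n) := delta_mx 0 (rk t).

Lemma perm_of_rank t : Defs.perm_of (rk t) = t.
Proof. exact: enum_rankK. Qed.

Lemma rank_perm_of (i : 'I_(Nn n)) : rk (Defs.perm_of i) = i.
Proof. exact: enum_valK. Qed.

Lemma sum_perm_of (V : nmodType) (F : {perm 'I_n} -> V) :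
  \sum_(i < Nn n) F (Defs.perm_of i) = \sum_t F t.
Proof.
rewrite (reindex rk) /=; last first.
  by exists (@Defs.perm_of n) => ? _; [exact: perm_of_rank | exact: rank_perm_of].
by apply: eq_bigr => t _; rewrite perm_of_rank.
Qed.

Lemma ds_span (v : 'rV[K]_(Nn n)) : v = \sum_t v 0 (rk t) *: ds t.
Proof.
rewrite [LHS]row_sum_delta -(sum_perm_of (fun t => v 0 (rk t) *: ds t)).
by apply: eq_bigr => i _; rewrite /ds rank_perm_of.
Qed.

Lemma mul_rho (v : 'rV[K]_(Nn n)) t s :
  (v *m rho t) 0 (rk s) = v 0 (rk (s * t^-1)%g).
Proof.
rewrite mxE (bigD1 (rk (s * t^-1)%g)) //= big1 ?addr0.
  by rewrite mxE !perm_of_rank mulgKV eqxx mulr1.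
move=> i ne; rewrite mxE perm_of_rank; case: eqP => [e|]; last by rewrite mulr0.
by case/eqP: ne; rewrite e mulgK rank_perm_of.
Qed.

Lemma ds_rho s t : ds s *m rho t = ds (s * t)%g.
Proof.
apply/rowP => i; rewrite -[i]rank_perm_of mul_rho /ds !mxE /=.
rewrite !(inj_eq (can_inj perm_of_rank)); congr (_%:R); congr nat_of_bool.
by apply/eqP/eqP => [<-|->]; rewrite ?mulgKV ?mulgK.
Qed.

Lemma eq_ds_mul (A B : 'M[K]_(Nn n)) :
  (forall t, ds t *m A = ds t *m B) -> A = B.
Proof.
move=> e; apply/row_matrixP => i; rewrite -[i]rank_perm_of !rowE; exact: e.
Qed.

Lemma rhoM s t : rho s *m rho t = rho (s * t)%g.
Proof. by apply: eq_ds_mul => x; rewrite mulmxA !ds_rho mulgA. Qed.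

Lemma rho1 : rho 1%g = 1%:M :> 'M[K]_(Nn n).
Proof. by apply: eq_ds_mul => x; rewrite ds_rho mulg1 mulmx1. Qed.

Lemma rhoK s : rho s *m rho s^-1%g = 1%:M :> 'M[K]_(Nn n).
Proof. by rewrite rhoM mulgV rho1. Qed.

Lemma tr_rho t : \tr (rho t) = ((Nn n) * (t == 1%g))%:R :> K.
Proof.
rewrite /mxtrace.
under eq_bigr => i _ do rewrite mxE -{1}[Defs.perm_of i]mulg1 (inj_eq (mulgI _)) eq_sym.
by rewrite sumr_const card_ord -mulrnA mulnC.
Qed.

(** The image of the group algebra under [rho]. Operators are matrices of this kind while module
    elements stay row vectors, which keeps the two roles of the group algebra apart. *)
Definition env (U : 'M[K]_(Nn n)) := exists c, U = \sum_t c t *: rho t.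

Lemma env_rho t : env (rho t).
Proof.
exists (fun s => (s == t)%:R); rewrite (bigD1 t) //= eqxx scale1r big1 ?addr0 //.
by move=> s /negPf ->; rewrite scale0r.
Qed.

Lemma env0 : env 0.
Proof. by exists (fun=> 0); rewrite big1 // => t _; rewrite scale0r. Qed.

Lemma envD U V : env U -> env V -> env (U + V).
Proof.
move=> [c ->] [d ->]; exists (fun t => c t + d t); rewrite -big_split.
by apply: eq_bigr => t _; rewrite scalerDl.
Qed.

Lemma envZ a U : env U -> env (a *: U).
Proof.
move=> [c ->]; exists (fun t => a * c t); rewrite scaler_sumr.
by apply: eq_bigr => t _; rewrite scalerA.
Qed.

Lemma env_sum (I : Type) (r : seq I) (P : pred I) F :
  (forall i, P i -> env (F i)) -> env (\sum_(i <- r | P i) F i).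
Proof. by move=> h; elim/big_ind: _ => //; [exact: env0 | exact: envD]. Qed.

Lemma envM U V : env U -> env V -> env (U *m V).
Proof.
move=> [c ->] [d ->]; rewrite mulmx_suml; apply: env_sum => s _.
rewrite mulmx_sumr; apply: env_sum => t _.
by rewrite -scalemxAl -scalemxAr rhoM; do 2!apply: envZ; apply: env_rho.
Qed.

(* The trace of left multiplication detects the coefficient of the identity, so a
   nonzero element cannot generate a nilpotent one-sided ideal. *)
Lemma env_semiprime U : [pchar K] =i pred0 -> env U ->
  (forall x, U *m rho x *m U = 0) -> U = 0.
Proof.
move=> /pcharf0P ch [c eU] h.
have tr_nil (M : 'M[K]_(Nn n)) : M *m M = 0 -> \tr M = 0.
  suff h2 r (C : 'M[K]_(Nn n, r)) (R : 'M[K]_(r, Nn n)) : row_full C -> row_free R ->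
      C *m R *m (C *m R) = 0 -> \tr (C *m R) = 0.
    by rewrite -(mulmx_base M); apply: h2; rewrite ?row_base_free ?col_base_full.
  move=> /row_fullP[C' eC] /row_freeP[R' eR] e.
  have: C' *m (C *m R *m (C *m R)) *m R' = 0 by rewrite e mulmx0 mul0mx.
  rewrite !mulmxA eC mul1mx -(mulmxA _ R) eR mulmx1 => e2.
  by rewrite mxtrace_mulC e2 mxtrace0.
suff c0 t : c t = 0 by rewrite eU big1 // => t _; rewrite c0 scale0r.
have: \tr (U *m rho t^-1%g) = 0 by apply: tr_nil; rewrite mulmxA h mul0mx.
rewrite eU mulmx_suml raddf_sum (bigD1 t) //= big1 => [|s ne]; last first.
  rewrite -scalemxAl rhoM mxtraceZ tr_rho.
  by rewrite -eq_mulgV1 (negPf ne) muln0 mulr0.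
rewrite addr0 -scalemxAl rhoM mxtraceZ tr_rho mulgV eqxx muln1 => /eqP.
rewrite mulf_eq0 ch => /orP[/eqP //|/eqP].
by move=> e; have := cardD1 1%g [set: {perm 'I_n}]; rewrite !inE cardsT; move: e; rewrite /Nn => ->.
Qed.

Definition stab (T : eqType) (f : 'I_n -> T) : pred {perm 'I_n} :=
  fun p => [forall i, f (p i) == f i].

Lemma stabP (T : eqType) (f : 'I_n -> T) p : reflect (forall i, f (p i) = f i) (stab f p).
Proof. exact: 'forall_eqP. Qed.

Lemma stab1 (T : eqType) (f : 'I_n -> T) : stab f 1%g.
Proof. by apply/stabP => i; rewrite perm1. Qed.

Lemma stabM (T : eqType) (f : 'I_n -> T) p q : stab f p -> stab f q -> stab f (p * q)%g.
Proof. by move=> /stabP hp /stabP hq; apply/stabP => i; rewrite permM hq hp. Qed.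

Lemma stabV (T : eqType) (f : 'I_n -> T) p : stab f p -> stab f p^-1%g.
Proof. by move=> /stabP h; apply/stabP => i; rewrite -{2}(permKV p i) h. Qed.

Lemma stab_tperm (T : eqType) (f : 'I_n -> T) i j : f i = f j -> stab f (tperm i j).
Proof. by move=> e; apply/stabP => k; case: tpermP => // ->. Qed.

Lemma card_stab_gt0 (T : eqType) (f : 'I_n -> T) : (0 < #|stab f|)%N.
Proof. by rewrite (cardD1 1%g) [_ \in _]stab1. Qed.

Definition sg (e : bool) p : K := (-1) ^+ (e && odd_perm p).

Lemma sgM e p q : sg e (p * q)%g = sg e p * sg e q.
Proof. by case: e; rewrite /sg /= ?mulr1 // odd_permM signr_addb. Qed.

Lemma sgV e p : sg e p^-1%g = sg e p.
Proof. by rewrite /sg odd_permV. Qed.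

Lemma sgK e p : sg e p * sg e p = 1.
Proof. by rewrite /sg -signr_addb addbb. Qed.

Lemma sg1 e : sg e 1%g = 1.
Proof. by rewrite /sg odd_perm1 andbF. Qed.

Lemma sg_false p : sg false p = 1. Proof. by []. Qed.

(* Row symmetrisers ([e = false]) and column antisymmetrisers ([e = true]); locked so that
   distributivity does not open them. *)
Definition rsym (T : eqType) e (f : 'I_n -> T) : 'M[K]_(Nn n) :=
  locked (\sum_(p | stab f p) sg e p *: rho p).

Lemma rsymE (T : eqType) e (f : 'I_n -> T) :
  rsym e f = \sum_(p | stab f p) sg e p *: rho p.
Proof. by rewrite /rsym -lock. Qed.

Lemma rsym_env (T : eqType) e (f : 'I_n -> T) : env (rsym e f).
Proof. by rewrite rsymE; apply: env_sum => p _; apply: envZ; apply: env_rho. Qed.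

Lemma rho_rsym (T : eqType) e (f : 'I_n -> T) q : stab f q ->
  rho q *m rsym e f = sg e q *: rsym e f.
Proof.
move=> hq; rewrite !rsymE mulmx_sumr scaler_sumr [RHS](reindex_inj (mulgI q)) /=.
apply: eq_big => [p|p _].
  by apply/idP/idP => h; [exact: stabM | rewrite -(mulKg q p); apply: stabM => //; apply: stabV].
by rewrite -scalemxAr rhoM scalerA sgM mulrA sgK mul1r.
Qed.

Lemma rsym_rho (T : eqType) e (f : 'I_n -> T) q : stab f q ->
  rsym e f *m rho q = sg e q *: rsym e f.
Proof.
move=> hq; rewrite !rsymE mulmx_suml scaler_sumr [RHS](reindex_inj (mulIg q)) /=.
apply: eq_big => [p|p _].
  by apply/idP/idP => h; [exact: stabM | rewrite -(mulgK q p); apply: stabM => //; apply: stabV].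
by rewrite -scalemxAl rhoM scalerA sgM mulrCA sgK mulr1.
Qed.

Lemma rsym_fix (T : eqType) e (f : 'I_n -> T) (v : 'rV[K]_(Nn n)) :
  (forall p, stab f p -> v *m rho p = sg e p *: v) ->
  v *m rsym e f = #|stab f|%:R *: v.
Proof.
move=> h; rewrite rsymE mulmx_sumr scaler_nat -sumr_const.
by apply: eq_bigr => p hp; rewrite -scalemxAr h // scalerA sgK scale1r.
Qed.

Lemma rsym_conj (T : eqType) e (f : 'I_n -> T) s :
  rsym e (f \o s) = rho s *m rsym e f *m rho s^-1%g.
Proof.
rewrite !rsymE mulmx_sumr mulmx_suml (reindex_inj (conjg_inj s^-1%g)) /=.
apply: eq_big => [p|p _].
  apply/stabP/stabP => h i; last by rewrite /= !(conjgE, permM) !invgK permKV h.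
  by have := h (s^-1%g i); rewrite /= !(conjgE, permM) !invgK !permKV.
rewrite -scalemxAr -scalemxAl !rhoM conjgE invgK mulgA; congr (_ *: _).
by rewrite !sgM sgV mulrAC sgK mul1r.
Qed.

Lemma rsym_eq (T T' : eqType) e (f : 'I_n -> T) (g : 'I_n -> T') :
  (forall i j, (f i == f j) = (g i == g j)) -> rsym e f = rsym e g.
Proof.
move=> h; rewrite !rsymE; apply: eq_bigl => p; apply/stabP/stabP => h' i; apply/eqP.
  by rewrite -h h'.
by rewrite h h'.
Qed.

(** Since [tperm i j * x = x * tperm (x i) (x j)], one transposition can be absorbed on the left or
    on the right. The two signs are opposite, so the product equals its own negative. *)
Lemma rsym_tperm_kill (T T' : eqType) (f : 'I_n -> T) (g : 'I_n -> T') x i j :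
  [pchar K] =i pred0 -> i != j -> f i = f j -> g (x i) = g (x j) ->
  rsym false f *m rho x *m rsym true g = 0 /\ rsym true f *m rho x *m rsym false g = 0.
Proof.
move=> /pcharf0P ch ne ef eg.
have kill (M : 'M[K]_(Nn n)) : M = - M -> M = 0.
  move/eqP; rewrite -subr_eq0 opprK -mulr2n -scaler_nat scaler_eq0 ch /=.
  by move/eqP.
have e1 : (tperm i j * x = x * tperm (x i) (x j))%g by rewrite -tpermJ -conjgC.
have s1 : stab f (tperm i j) := stab_tperm ef.
have s2 : stab g (tperm (x i) (x j)) := stab_tperm eg.
have sgt a b e : a != b -> sg e (tperm a b) = (-1) ^+ e by rewrite /sg odd_tperm => ->; rewrite andbT.
have nex : x i != x j by rewrite (inj_eq perm_inj).
have red e : rsym e f *m rho x *m rsym (~~ e) g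
  = - (rsym e f *m rho x *m rsym (~~ e) g).
  have := erefl (rsym e f *m rho (tperm i j * x)%g *m rsym (~~ e) g).
  rewrite {1}e1 -!rhoM !mulmxA (rsym_rho _ s1) -(mulmxA _ (rho (tperm (x i) (x j)))) (rho_rsym _ s2).
  rewrite !sgt // -scalemxAr -!scalemxAl.
  by case: e; rewrite /= expr1 expr0 !scale1r scaleN1r => // e'; rewrite -{1}e' ?opprK.
by split; apply: kill; [exact: (red false) | exact: (red true)].
Qed.

End GroupAlgebra.

(** * Garnir relations and the sum of all transpositions *)

Section Casimir.
Variables (K : fieldType) (n : nat).
Hypothesis charK : [pchar K] =i pred0.
Implicit Types (s t x p q : {perm 'I_n}) (h : 'rV[K]_(Nn n)).
Notation rho := (Rreg K).

Definition fsz (T : finType) (f : 'I_n -> T) c := #|[pred i | f i == c]|.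

(** Ordered pairs count each transposition twice, so eigenvalues are twice sums of contents. *)
Definition casimir : 'M[K]_(Nn n) := \sum_i \sum_(j | j != i) rho (tperm i j).

Lemma casimirC x : rho x *m casimir = casimir *m rho x.
Proof.
rewrite /casimir mulmx_sumr mulmx_suml (reindex_inj (@perm_inj _ x)) /=.
apply: eq_bigr => i _; rewrite mulmx_sumr mulmx_suml (reindex_inj (@perm_inj _ x)) /=.
apply: eq_big => [j|j _]; first by rewrite (inj_eq perm_inj).
by rewrite !rhoM -tpermJ -conjgC.
Qed.

Lemma casimir_env (U : 'M[K]_(Nn n)) : env U -> U *m casimir = casimir *m U.
Proof.
move=> [c ->]; rewrite mulmx_suml mulmx_sumr; apply: eq_bigr => t _.
by rewrite -scalemxAl -scalemxAr casimirC.
Qed.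

Definition recolor (T : eqType) (f : 'I_n -> T) k c i := if i == k then c else f i.

(** For rows ([e = false]) this is the Garnir relation moving a single box [k] from class [d] into
    class [c]; [e = true] is its mirror image for columns. *)
Definition garnir (T : finType) e (f : 'I_n -> T) h c d :=
  forall k, f k = d ->
    \sum_(i | f i == c) h *m rho (tperm i k) = - ((-1) ^+ nat_of_bool e *: h).

Lemma natr_neq0 m : (0 < m)%N -> m%:R != 0 :> K.
Proof. by move/pcharf0P: charK => ->; rewrite lt0n. Qed.

Lemma natr_inj_char0 m k : m%:R = k%:R :> K -> m = k.
Proof.
have le a b : (a <= b)%N -> a%:R = b%:R :> K -> a = b.
  move=> ab /eqP; rewrite eq_sym -subr_eq0 -natrB //; move/pcharf0P: charK => -> e.
  by apply/eqP; rewrite eqn_leq ab -subn_eq0.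
by case/orP: (leq_total m k) => h e; [exact: le | apply/esym/le].
Qed.

Lemma sg_tperm e (i j : 'I_n) : i != j -> sg K e (tperm i j) = (-1) ^+ nat_of_bool e.
Proof. by rewrite /sg odd_tperm => ->; rewrite andbT. Qed.

(* Antisymmetrising [h] over a class enlarged by one point [k] amounts, up to a positive
   integer, to summing over the transpositions exchanging [k] with that class. *)
Lemma garnir_recolor (T : finType) e (f : 'I_n -> T) h k c :
  f k != c ->
  (forall p, stab f p -> h *m rho p = sg K e p *: h) ->
  h *m rsym K e (recolor f k c) = 0 ->
  \sum_(i | f i == c) h *m rho (tperm i k) = - ((-1) ^+ nat_of_bool e *: h).
Proof.
move=> nk inv; set f' := recolor f k c.
have f'k : f' k = c by rewrite /f' /recolor eqxx.
rewrite rsymE mulmx_sumr (partition_big (fun p => p k) (fun i => f' i == c)) /=; last first.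
  by move=> p /stabP ->; rewrite f'k.
(* [H] is the order of the subgroup fixing [k]; its cosets are represented by the [tperm i k]. That
   subgroup preserves the original classes as well, so [h] is semi-invariant under it. *)
pose H := #|[pred p | stab f' p && (p k == k)]|.
have Hgt : (0 < H)%N by apply/card_gt0P; exists 1%g; rewrite inE stab1 perm1 eqxx.
have inner i : f' i == c ->
    \sum_(p | stab f' p && (p k == i)) h *m (sg K e p *: rho p)
    = H%:R *: (sg K e (tperm i k) *: (h *m rho (tperm i k))).
  move=> /eqP fi; rewrite (reindex_inj (mulIg (tperm i k))) /=.
  rewrite scaler_nat -sumr_const; apply: eq_big => [p|p /andP[sp /eqP pk]].
    rewrite inE permM; congr (_ && _);
      last by rewrite -[X in _ == X](tpermR i k) (inj_eq perm_inj).
    have st : stab f' (tperm i k) by apply: stab_tperm; rewrite fi f'k.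
    by apply/idP/idP => sp; [rewrite -(mulgK (tperm i k) p) tpermV|]; apply: stabM.
  have {}pk : p k = k.
    by apply: (@perm_inj _ (tperm i k)); rewrite -permM pk tpermR.
  have st : stab f' (tperm i k) by apply: stab_tperm; rewrite fi f'k.
  have {}sp : stab f' p.
    by rewrite -(mulgK (tperm i k) p) tpermV; apply: stabM.
  have sfp : stab f p.
    apply/stabP => j; have [->|ne] := eqVneq j k; first by rewrite pk.
    have := stabP _ _ sp j; rewrite /f' /recolor (negPf ne) ifN //.
    by apply: contra ne => /eqP e'; apply/eqP/(@perm_inj _ p); rewrite e' pk.
  rewrite -scalemxAr sgM -rhoM mulmxA (inv _ sfp) -scalemxAl scalerA mulrAC sgK mul1r.
  by [].
rewrite (eq_bigr _ inner) -scaler_sumr => /eqP.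
rewrite scaler_eq0 (negPf (natr_neq0 Hgt)) /= (bigD1 k) ?f'k //=.
rewrite tperm1 sg1 scale1r rho1 mulmx1 => /eqP e0.
have e1 : \sum_(i | (f' i == c) && (i != k)) sg K e (tperm i k) *: (h *m rho (tperm i k))
   = (-1) ^+ nat_of_bool e *: \sum_(i | f i == c) h *m rho (tperm i k).
  rewrite scaler_sumr; apply: eq_big => [i|i /andP[_ ne]]; last by rewrite sg_tperm.
  rewrite /f' /recolor; case: (eqVneq i k) => [->|]; last by rewrite andbT.
  by rewrite andbF (negPf nk).
move: e0; rewrite e1 => /eqP; rewrite addrC addr_eq0 => /eqP e0.
by rewrite -scalerN -e0 scalerA -signr_addb addbb scale1r.
Qed.

Definition samepairs (T : finType) (f : 'I_n -> T) :=
  (\sum_c fsz f c * (fsz f c).-1)%N.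
Definition minpairs (T : finType) (f : 'I_n -> T) :=
  (\sum_c \sum_(d | d != c) minn (fsz f c) (fsz f d))%N.

Lemma casimir_eig (T : finType) e (f : 'I_n -> T) h :
  (forall p, stab f p -> h *m rho p = sg K e p *: h) ->
  (forall c d, c != d -> (garnir e f h c d /\ (fsz f d <= fsz f c)%N) \/
                         (garnir e f h d c /\ (fsz f c <= fsz f d)%N)) ->
  h *m casimir = (-1) ^+ nat_of_bool e *: (((samepairs f)%:R - (minpairs f)%:R) *: h).
Proof.
move=> inv gar.
have e1 : h *m casimir =
  \sum_c \sum_d \sum_(i | f i == c) \sum_(j | (j != i) && (f j == d)) h *m rho (tperm i j).
  rewrite mulmx_sumr (partition_big f xpredT) //=; apply: eq_bigr => c _.
  rewrite exchange_big /=; apply: eq_bigr => i _.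
  by rewrite mulmx_sumr (partition_big f xpredT).
have card_c c : #|[pred i | f i == c]| = fsz f c by [].
have ediag c : \sum_(i | f i == c) \sum_(j | (j != i) && (f j == c)) h *m rho (tperm i j)
   = (-1) ^+ nat_of_bool e *: ((fsz f c * (fsz f c).-1)%:R *: h).
  rewrite scaler_nat -scalerMnr mulrnA mulrnAC.
  transitivity (\sum_(i | f i == c) ((-1) ^+ nat_of_bool e *: h) *+ (fsz f c).-1).
    apply: eq_bigr => i /eqP fi.
    rewrite (eq_bigr (fun=> (-1) ^+ nat_of_bool e *: h)) => [|j /andP[ne /eqP fj]].
      rewrite sumr_const; congr (_ *+ _).
      rewrite /fsz (cardD1 i [pred i | f i == c]) inE fi eqxx add1n /=.
      by apply: eq_card => j; rewrite !inE.
    by rewrite inv ?sg_tperm 1?eq_sym //; apply: stab_tperm; rewrite fi fj.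
  by rewrite sumr_const card_c -!mulrnA mulnC.
have eoff c d : c != d ->
   \sum_(i | f i == c) \sum_(j | (j != i) && (f j == d)) h *m rho (tperm i j)
   = - ((-1) ^+ nat_of_bool e *: ((minn (fsz f c) (fsz f d))%:R *: h)).
  move=> ncd.
  have -> : \sum_(i | f i == c) \sum_(j | (j != i) && (f j == d)) h *m rho (tperm i j)
    = \sum_(i | f i == c) \sum_(j | f j == d) h *m rho (tperm i j).
    apply: eq_bigr => i /eqP fi; apply: eq_bigl => j.
    by case: eqVneq => // ->; rewrite fi (negPf ncd).
  case: (gar _ _ ncd) => -[g le].
    rewrite (minn_idPr le) exchange_big /=.
    rewrite (eq_bigr (fun=> - ((-1) ^+ nat_of_bool e *: h))) => [|j /eqP fj]; last exact: g.
    by rewrite sumr_const card_c mulNrn scaler_nat -scalerMnr.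
  rewrite (minn_idPl le).
  rewrite (eq_bigr (fun=> - ((-1) ^+ nat_of_bool e *: h))) => [|j /eqP fj].
    by rewrite sumr_const card_c mulNrn scaler_nat -scalerMnr.
  by rewrite -(g j fj); apply: eq_bigr => i _; rewrite tpermC.
rewrite e1 scalerBl scalerBr; transitivity
  (\sum_c ((-1) ^+ nat_of_bool e *: ((fsz f c * (fsz f c).-1)%:R *: h)
    - \sum_(d | d != c) ((-1) ^+ nat_of_bool e *: ((minn (fsz f c) (fsz f d))%:R *: h)))).
  apply: eq_bigr => c _; rewrite (bigD1 c) //= ediag -sumrN; congr (_ + _).
  by apply: eq_bigr => d ne; apply: eoff; rewrite eq_sym.
rewrite sumrB; congr (_ - _).
  by rewrite /samepairs natr_sum scaler_suml scaler_sumr.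
rewrite /minpairs natr_sum scaler_suml scaler_sumr; apply: eq_bigr => c _.
by rewrite natr_sum scaler_suml scaler_sumr.
Qed.

End Casimir.

(** * Colourings with equal class sizes differ by a permutation *)

Section Matching.
Variables (n m : nat).
Implicit Types f g : 'I_n -> 'I_m.

Lemma match_sizes f g : (forall c, fsz f c = fsz g c) ->
  exists s : {perm 'I_n}, forall i, f (s i) = g i.
Proof.
move=> h; have szE k : forall c, count_mem c [seq k i | i <- enum 'I_n] = fsz k c.
  move=> c; rewrite count_map /fsz cardE [in RHS]/enum_mem -enumT size_filter.
  by apply: eq_count => i /=; rewrite inE.
have: perm_eq [seq g i | i <- enum 'I_n] [tuple f i | i < n].
  rewrite -[X in perm_eq _ X]/(val [tuple f i | i < n]) /=.
  by apply/allP => c _ /=; rewrite !szE h.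
case/tuple_permP => s es; exists s => i.
have := congr1 (fun z => nth (g i) z i) es.
rewrite (nth_map i) ?size_enum_ord // nth_ord_enum => ->.
by rewrite -tnth_nth !tnth_mktuple.
Qed.

Lemma match_shape f g :
  perm_eq [seq fsz f c | c <- enum 'I_m] [seq fsz g c | c <- enum 'I_m] ->
  exists (s : {perm 'I_n}) (r : {perm 'I_m}), forall i, f (s i) = r (g i).
Proof.
move=> h; have: perm_eq [seq fsz g c | c <- enum 'I_m] [tuple fsz f c | c < m].
  by rewrite perm_sym.
case/tuple_permP => r er.
have {}er c : fsz g c = fsz f (r c).
  have := congr1 (fun z => nth 0 z c) er.
  rewrite (nth_map c) ?size_enum_ord // nth_ord_enum => ->.
  by rewrite -tnth_nth !tnth_mktuple.
have [|s hs] := @match_sizes f (r \o g); last by exists s, r.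
move=> c; rewrite -(permKV r c) -er.
by apply: eq_card => i; rewrite !inE /= (inj_eq perm_inj).
Qed.

End Matching.

(** * Tableaux with three rows *)

Section Shape.
Variables (n : nat).
Implicit Types (s t x p q : {perm 'I_n}).

Definition shape3 l1 l2 l3 := [&& l1 + l2 + l3 == n, l3 <= l2 & l2 <= l1]%N.

(** The parts of the conjugate of the partition formed by the class sizes. *)
Definition nrow (T : finType) (f : 'I_n -> T) r := #|[pred c | (r <= fsz f c)%N]|.

Lemma yrow_lt3 l1 l2 i : (yrow l1 l2 i < 3)%N.
Proof. by rewrite /yrow; do 2?case: ifP. Qed.

Lemma card_yrow_lt l1 l2 l3 k : shape3 l1 l2 l3 -> (k <= 2)%N ->
  #|[pred i : 'I_n | (yrow l1 l2 i < k)%N]| = (if k is k'.+1 then if k' is _.+1 then l1 + l2 else l1 else 0)%N.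
Proof.
move=> /and3P[/eqP e le1 le2]; have cl m : (m <= n)%N -> #|[pred i : 'I_n | (i < m)%N]| = m.
  move=> lem; have inj : injective (widen_ord lem).
    by move=> i j /(congr1 val) /= eij; apply: val_inj.
  rewrite -[RHS]card_ord -(card_image inj).
  apply: eq_card => i; rewrite inE; apply/idP/imageP => [h|[j _ ->]]; last exact: (ltn_ord j).
  by exists (Ordinal h) => //; apply: val_inj.
case: k => [|[|[|//]]] _; first by apply: eq_card0 => i; rewrite inE.
- rewrite -[RHS]cl; last lia.
  by apply: eq_card => i; rewrite !inE /yrow; do 2?case: ifP.
rewrite -[RHS]cl; last lia.
by apply: eq_card => i; rewrite !inE /yrow; do 2?case: ifP; lia.
Qed.

Lemma sum_fsz (T : finType) (f : 'I_n -> T) : (\sum_c fsz f c)%N = n.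
Proof.
rewrite -[RHS]card_ord -sum1_card (partition_big f xpredT) //=.
by apply: eq_bigr => c _; rewrite /fsz -sum1_card; apply: eq_bigl => i; rewrite inE.
Qed.

Lemma sum_min_fsz (T : finType) (f : 'I_n -> T) k :
  (\sum_c minn (fsz f c) k = \sum_(1 <= r < k.+1) nrow f r)%N.
Proof.
elim: k => [|k IH]; first by rewrite big_geq // big1 // => c _; rewrite minn0.
rewrite big_nat_recr //= -IH /nrow -sum1_card [X in (_ + X)%N]big_mkcond -big_split /=.
by apply: eq_bigr => c _; rewrite inE; case: leqP; lia.
Qed.

(* If the rows of the tableau meet every class of [f] at most once, the shape of the
   tableau is dominated by the conjugate of the partition into the classes of [f]. *)
Lemma transversal_dominance (T : finType) (f : 'I_n -> T) l1 l2 l3 k :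
  shape3 l1 l2 l3 ->
  (forall i j : 'I_n, i != j -> yrow l1 l2 i = yrow l1 l2 j -> f i <> f j) ->
  (k <= 2)%N ->
  ((if k is k'.+1 then if k' is _.+1 then l1 + l2 else l1 else 0)
     <= \sum_(1 <= r < k.+1) nrow f r)%N.
Proof.
move=> sh tr k2; rewrite -(card_yrow_lt sh k2) -sum_min_fsz -sum1_card.
rewrite (partition_big f xpredT) //=; apply: leq_sum => c _.
rewrite leq_min; apply/andP; split.
  by rewrite sum1_card; apply: subset_leq_card; apply/subsetP => i; rewrite !inE => /andP[].
rewrite sum1_card -[X in (_ <= X)%N]card_ord; set P := (X in #|X|).
have lt (i : 'I_n) : (minn (yrow l1 l2 i) k.-1 < k.-1.+1)%N by rewrite ltnS geq_minr.
case: k => [|k] in k2 P lt *.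
  by rewrite eq_card0 // => i; rewrite inE.
rewrite -(@card_in_image _ _ (fun i => Ordinal (lt i)) P) ?max_card //.
move=> i j /andP[hi /eqP fi] /andP[hj /eqP fj] /(congr1 val) /= e.
apply/eqP; apply: contraT => ne; case: (tr i j ne); last by rewrite fi fj.
by rewrite !inE in hi hj; move: hi hj e; lia.
Qed.

Section Tableau.
Variables l1 l2 l3 : nat.
Hypothesis sh : shape3 l1 l2 l3.
Notation yr := (fun i : 'I_n => yrow l1 l2 i).
Notation yc := (fun i : 'I_n => ycol l1 l2 i).
Notation L r := (nth 0 [:: l1; l2; l3] r)%N.
Notation off r := (nth 0 [:: 0; l1; l1 + l2] r)%N.

Lemma ycol_lt i : (i < n)%N -> (ycol l1 l2 i < L (yrow l1 l2 i))%N.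
Proof. by move: sh => /and3P[/eqP]; rewrite /yrow /ycol; do 2?case: ifP => /=; lia. Qed.

Lemma cellK i : (i < n)%N -> (off (yrow l1 l2 i) + ycol l1 l2 i)%N = i.
Proof. by move: sh => /and3P[/eqP]; rewrite /yrow /ycol; do 2?case: ifP => /=; lia. Qed.

Lemma cellP r c : (r < 3)%N -> (c < L r)%N ->
  [/\ off r + c < n, yrow l1 l2 (off r + c) = r & ycol l1 l2 (off r + c) = c]%N.
Proof.
move: sh => /and3P[/eqP]; rewrite /yrow /ycol.
by case: r => [|[|[|//]]] /= ? ? ? _ ?; split; (do 2?case: ifP => /=); lia.
Qed.

Lemma cell_inj (i j : 'I_n) : yr i = yr j -> yc i = yc j -> i = j.
Proof.
by move=> er ec; apply: val_inj; rewrite /= -(cellK (ltn_ord i)) -(cellK (ltn_ord j)) er ec.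
Qed.

(** Injectivity and counting: the images of row 0 meet every column. A column beyond [l2] has one
    box, already used by row 0, so row 1 stays within [l2] columns and meets all of them. A column
    beyond [l3] has at most two boxes, already used by rows 0 and 1. *)
Lemma transversal_fits x :
  (forall i j, i != j -> yr i = yr j -> yc (x i) <> yc (x j)) ->
  forall i, (yc (x i) < L (yr i))%N.
Proof.
move=> tr; have inL r : (r < 3)%N -> (forall i, yr i = r -> (yc (x i) < L r)%N) ->
    forall c, (c < L r)%N -> exists2 i, yr i = r & yc (x i) = c.
  move=> r3 h c cL.
  have cn (d : 'I_(L r)) : (off r + d < n)%N by case: (cellP r3 (ltn_ord d)).
  have yrn d : yr (Ordinal (cn d)) = r by case: (cellP r3 (ltn_ord d)).
  pose F (d : 'I_(L r)) := Ordinal (h (Ordinal (cn d)) (yrn d)).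
  have Finj : injective F.
    move=> d d' /(congr1 val) /= e; apply/eqP; apply: contraT => ne.
    case: (tr (Ordinal (cn d)) (Ordinal (cn d'))) => //; last by rewrite !yrn.
    by apply: contra ne => /eqP /(congr1 val) /= e'; apply/eqP/val_inj => /=; lia.
  have /imageP[d _ ed] : Ordinal cL \in [seq F d | d in 'I_(L r)].
    by apply: (inj_card_onto Finj).
  by exists (Ordinal (cn d)); [exact: yrn | move/(congr1 val): ed].
have colb j : (yc j < L (yr j))%N by apply: ycol_lt.
have [/eqP en le1 le2] := and3P sh.
have sameij i j : yr i <> yr j -> yr (x i) = yr (x j) -> yc (x i) = yc (x j) -> False.
  by move=> ne er ec; apply: ne; rewrite (perm_inj (cell_inj er ec)).
have yr3 j : (yr j < 3)%N by apply: yrow_lt3.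
have h0 i : (yc (x i) < l1)%N.
  by have := colb (x i); have := yr3 (x i); case: (yr (x i)) => [|[|[|//]]] /=; lia.
have f0 := inL 0%N isT (fun i _ => h0 i).
have h1 i : (0 < yr i)%N -> (yc (x i) < l2)%N.
  move=> i1; rewrite ltnNge; apply/negP => ge.
  have [i0 r0 c0] := f0 _ (h0 i).
  have row0 j : (l2 <= yc (x j))%N -> yr (x j) = 0%N.
    have := colb (x j); have := yr3 (x j); case: (yr (x j)) => [|[|[|//]]] /=; lia.
  by apply: (@sameij i i0) => //; [rewrite r0; lia | rewrite !row0 // c0].
have f1 := inL 1%N isT (fun i e => h1 i (eq_leq (esym e))).
have h2 i : (1 < yr i)%N -> (yc (x i) < l3)%N.
  move=> i2; rewrite ltnNge; apply/negP => ge.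
  have i1 : (0 < yr i)%N by lia.
  have [i0 r0 c0] := f0 _ (h0 i); have [i' r1 c1] := f1 _ (h1 _ i1).
  have row01 j : (l3 <= yc (x j))%N -> (yr (x j) < 2)%N.
    have := colb (x j); have := yr3 (x j); case: (yr (x j)) => [|[|[|//]]] /=; lia.
  have a := row01 i ge; have b := row01 i0; have c := row01 i'.
  rewrite c0 in b; rewrite c1 in c; have {}b := b ge; have {}c := c ge.
  have n1 : yr (x i) <> yr (x i0) by move=> e; apply: (@sameij i i0) => //; rewrite r0; lia.
  have n2 : yr (x i) <> yr (x i') by move=> e; apply: (@sameij i i') => //; rewrite r1; lia.
  have n3 : yr (x i0) <> yr (x i').
    by move=> e; apply: (@sameij i0 i') => //; rewrite ?r0 ?r1 ?c0 ?c1.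
  by move: a b c n1 n2 n3; lia.
move=> i; have := yr3 i; case e: (yr i) => [|[|[|//]]] _ /=.
- exact: h0.
- by apply: h1; rewrite e.
- by apply: h2; rewrite e.
Qed.

(** [p] moves [i] within its row to the column of [x i]; the box exists by [transversal_fits]. What
    remains of [x] preserves columns. *)
Lemma row_col_factor x :
  (forall i j, i != j -> yr i = yr j -> yc (x i) <> yc (x j)) ->
  exists p, stab yr p /\ stab yc (p^-1 * x)%g.
Proof.
move=> tr; have fit := transversal_fits tr.
have cn i : (off (yr i) + yc (x i) < n)%N by case: (cellP (yrow_lt3 l1 l2 i) (fit i)).
have rowp i : yr (Ordinal (cn i)) = yr i by case: (cellP (yrow_lt3 l1 l2 i) (fit i)).
have colp i : yc (Ordinal (cn i)) = yc (x i) by case: (cellP (yrow_lt3 l1 l2 i) (fit i)).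
have inj : injective (fun i => Ordinal (cn i)).
  move=> i j e; apply/eqP; apply: contraT => ne.
  case: (tr i j ne); first by rewrite -[LHS](rowp i) -[RHS](rowp j) e.
  by rewrite -[LHS](colp i) -[RHS](colp j) e.
exists (perm inj); split; apply/stabP => i; first by rewrite permE rowp.
by rewrite permM -{2}(permKV (perm inj) i) [in RHS]permE colp.
Qed.

Lemma fsz_yc (Q : 'I_n -> 'I_n) : (forall i, val (Q i) = yc i) ->
  forall c : 'I_n, fsz Q c = ((c < l1) + (c < l2) + (c < l3))%N.
Proof.
move=> hQ c; have [/eqP en le1 le2] := and3P sh.
rewrite /fsz -sum1_card.
rewrite (partition_big (fun i : 'I_n => inord (yr i) : 'I_3) xpredT) //= !big_ord_recr big_ord0 /=.
have one (r : 'I_3) : (\sum_(i in [pred i | Q i == c] | inord (yr i) == r) 1 = (c < L r))%N.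
  have [lt|ge] := ltnP c (L r); last first.
    rewrite big_pred0 // => i; apply/negP => /andP[]; rewrite inE => /eqP e /eqP e2.
    have := ycol_lt (ltn_ord i); have := congr1 val e; rewrite hQ => ->.
    by rewrite -e2 inordK ?yrow_lt3 // in ge; rewrite ltnNge ge.
  case: (cellP (ltn_ord r) lt) => an ar ac.
  rewrite (big_pred1 (Ordinal an)) // => i; rewrite inE; apply/andP/eqP => [[/eqP e1 /eqP e2]|->].
    apply: cell_inj; rewrite ?ar ?ac /=; first by rewrite -e2 inordK ?yrow_lt3.
    by rewrite -hQ e1.
  split; apply/eqP/val_inj; first by rewrite hQ.
  by rewrite /= ar inordK.
by rewrite !one add0n.
Qed.

End Tableau.
End Shape.

(** * Specht modules *)

(* Moving boxes up strictly increases the sum of contents, here written as a difference of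
   squares: [u] and [w] boxes are moved into the first row and the first two rows. *)
Lemma content_eq_shape (c w g1 g2 u b : nat) :
  let l3 := (c + w)%N in let l2 := (l3 + g2)%N in let l1 := (l2 + g1)%N in
  (b + u = l2 + w)%N ->
  ((l1 + u) * (l1 + u) + b * b + c * c + 2 * l2 + 4 * l3
    = l1 * l1 + l2 * l2 + l3 * l3 + 2 * b + 4 * c)%N -> u = 0%N /\ w = 0%N.
Proof.
move=> l3 l2 l1; rewrite /l1 /l2 /l3 {l1 l2 l3} => e1 e2.
suff: (u + w = 0)%N by lia.
have [le|lt] := leqP u w.
  have [d ed] : exists d, w = (u + d)%N by exists (w - u)%N; lia.
  have eb : b = (c + w + g2 + d)%N by lia.
  subst b w; nia.
have [d ed] : exists d, u = (w + d)%N by exists (u - w)%N; lia.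
have eb : (c + w + g2 = b + d)%N by lia.
nia.
Qed.

Section Specht.
Variables (K : fieldType) (n : nat).
Hypothesis charK : [pchar K] =i pred0.
Implicit Types (s t x p q : {perm 'I_n}) (h v : 'rV[K]_(Nn n)).
Notation rho := (Rreg K).

Lemma ycol_le l1 l2 i : (ycol l1 l2 i <= i)%N.
Proof. by rewrite /ycol; do 2?case: ifP; lia. Qed.

Definition rowf l1 l2 (i : 'I_n) : 'I_3 := Ordinal (yrow_lt3 l1 l2 i).
Definition colf l1 l2 (i : 'I_n) : 'I_n :=
  Ordinal (leq_ltn_trans (ycol_le l1 l2 i) (ltn_ord i)).

Definition Asym l1 l2 : 'M[K]_(Nn n) := rsym K false (rowf l1 l2).
Definition Bsym l1 l2 : 'M[K]_(Nn n) := rsym K true (colf l1 l2).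

Lemma nrow_colf l1 l2 l3 r : shape3 n l1 l2 l3 -> (0 < r)%N ->
  nrow (colf l1 l2) r = nth 0%N [:: l1; l2; l3] r.-1.
Proof.
move=> sh r0; have [/eqP en le1 le2] := and3P sh.
have cl m : (m <= n)%N -> #|[pred i : 'I_n | (i < m)%N]| = m.
  move=> lem; have inj : injective (widen_ord lem).
    by move=> i j /(congr1 val) /= eij; apply: val_inj.
  rewrite -[RHS]card_ord -(card_image inj).
  apply: eq_card => i; rewrite inE; apply/idP/imageP => [h|[j _ ->]]; last exact: (ltn_ord j).
  by exists (Ordinal h) => //; apply: val_inj.
rewrite /nrow; case: r r0 => [//|r] _.
have e c : fsz (colf l1 l2) c = ((c < l1) + (c < l2) + (c < l3))%N by apply: fsz_yc.
case: r => [|[|[|r]]] /=.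
- by rewrite -[RHS]cl; [apply: eq_card => c; rewrite !inE e; lia | lia].
- by rewrite -[RHS]cl; [apply: eq_card => c; rewrite !inE e; lia | lia].
- by rewrite -[RHS]cl; [apply: eq_card => c; rewrite !inE e; lia | lia].
by rewrite nth_nil; apply: eq_card0 => c; rewrite !inE e; lia.
Qed.

Lemma nrow_comp (T : finType) (f : 'I_n -> T) x r : nrow (f \o x) r = nrow f r.
Proof.
apply: eq_card => c; rewrite !inE; congr (_ <= _)%N.
rewrite /fsz -!sum1_card [RHS](reindex_inj (@perm_inj _ x)) /=.
by apply: eq_bigl => i; rewrite !inE.
Qed.

(** Nonvanishing forces [f \o x] to separate the boxes of each row, since otherwise a transposition
    kills the product. *)
Lemma AxB_dominance (T : finType) (f : 'I_n -> T) l1 l2 l3 x :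
  shape3 n l1 l2 l3 -> Asym l1 l2 *m rho x *m rsym K true f != 0 ->
  (l1 <= nrow f 1)%N /\ (l1 + l2 <= nrow f 1 + nrow f 2)%N.
Proof.
move=> sh ne0; have tr (i j : 'I_n) : i != j -> yrow l1 l2 i = yrow l1 l2 j ->
    (f \o x) i <> (f \o x) j.
  move=> nij e e'; case/eqP: ne0.
  have e2 : rowf l1 l2 i = rowf l1 l2 j by apply: val_inj.
  by case: (rsym_tperm_kill charK nij e2 e').
have := transversal_dominance sh tr (isT : (1 <= 2)%N).
have := transversal_dominance sh tr (isT : (2 <= 2)%N).
by rewrite /index_iota /= !big_cons !big_nil !(nrow_comp f x) !addn0.
Qed.

Lemma sizes_perm_eq (T : finType) (f g : 'I_n -> T) : (forall r, nrow f r = nrow g r) ->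
  perm_eq [seq fsz f c | c <- enum T] [seq fsz g c | c <- enum T].
Proof.
move=> e; have cnt (k : 'I_n -> T) r :
    (count_mem r [seq fsz k c | c <- enum T] + nrow k r.+1 = nrow k r)%N.
  rewrite count_map -size_filter /nrow.
  have -> : size [seq c <- enum T | preim (fsz k) (pred1 r) c] = #|[pred c | fsz k c == r]|.
    by rewrite cardE [in RHS]/enum_mem -enumT.
  rewrite -cardUI [X in (_ + X)%N]eq_card0 ?addn0.
    by apply: eq_card => c; rewrite !inE; lia.
  by move=> c; rewrite !inE; lia.
by apply/allP => r _ /=; apply/eqP; apply: (@addIn (nrow g r.+1)); rewrite cnt -{1}e cnt e.
Qed.

Lemma rsym_matched (f g : 'I_n -> 'I_n) : (forall r, nrow f r = nrow g r) ->
  exists s, rsym K true f = rho s^-1%g *m rsym K true g *m rho s.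
Proof.
move=> /sizes_perm_eq /match_shape [s [r hr]]; exists s.
have <- : rsym K true (f \o s) = rsym K true g.
  by apply: rsym_eq => i j /=; rewrite !hr (inj_eq perm_inj).
by rewrite rsym_conj !mulmxA rhoM mulVg rho1 mul1mx -mulmxA rhoM mulVg rho1 mulmx1.
Qed.

(** * Young symmetrisers of one shape *)

Section OneShape.
Variables l1 l2 l3 : nat.
Hypothesis sh : shape3 n l1 l2 l3.
Notation A := (Asym l1 l2).
Notation B := (Bsym l1 l2).

Lemma A_env : env A. Proof. exact: rsym_env. Qed.
Lemma B_env : env B. Proof. exact: rsym_env. Qed.
Hint Resolve A_env B_env : core.

(** Either [x] sends two boxes of a row into one column and the product vanishes, or [x] is a row
    permutation followed by a column permutation, and both are absorbed. *)
Lemma AxB_scalar x : exists c, A *m rho x *m B = c *: (A *m B).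
Proof.
have [/existsP[i /existsP[j /and3P[ne /eqP e1 /eqP e2]]]|/existsPn tr] :=
  boolP [exists i, exists j, [&& i != j, rowf l1 l2 i == rowf l1 l2 j
                              & colf l1 l2 (x i) == colf l1 l2 (x j)]].
  exists 0; rewrite scale0r.
  by case: (rsym_tperm_kill charK ne e1 e2).
have [|p [sp sq]] := @row_col_factor _ l1 l2 l3 sh x.
  move=> i j ne e1 e2; have /existsPn/(_ j) := tr i.
  rewrite ne /= => /negP[]; apply/andP; split; apply/eqP/val_inj => //.
have sp' : stab (rowf l1 l2) p by apply/stabP => i; apply: val_inj; apply: (stabP _ _ sp).
have sq' : stab (colf l1 l2) (p^-1 * x)%g.
  by apply/stabP => i; apply: val_inj; apply: (stabP _ _ sq).
exists (sg K true (p^-1 * x)%g); rewrite -{1}(mulKVg p x) -rhoM mulmxA rsym_rho //.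
by rewrite sg_false scale1r -mulmxA rho_rsym // scalemxAr.
Qed.

Lemma BxA_scalar x : exists c, B *m rho x *m A = c *: (B *m A).
Proof.
have [/existsP[i /existsP[j /and3P[ne /eqP e1 /eqP e2]]]|/existsPn tr] :=
  boolP [exists i, exists j, [&& i != j, colf l1 l2 i == colf l1 l2 j
                              & rowf l1 l2 (x i) == rowf l1 l2 (x j)]].
  exists 0; rewrite scale0r.
  by case: (rsym_tperm_kill charK ne e1 e2).
(* Factoring the inverse writes [x] as a column permutation followed by a row permutation. *)
have [|p [sp sq]] := @row_col_factor _ l1 l2 l3 sh x^-1%g.
  move=> i j ne e1 e2; have /existsPn/(_ (x^-1 j)%g) := tr (x^-1 i)%g.
  rewrite (inj_eq perm_inj) ne !permKV /= => /negP[].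
  by apply/andP; split; apply/eqP/val_inj.
have sp' : stab (rowf l1 l2) p by apply/stabP => i; apply: val_inj; apply: (stabP _ _ sp).
have sq' : stab (colf l1 l2) (p^-1 * x^-1)%g.
  by apply/stabP => i; apply: val_inj; apply: (stabP _ _ sq).
have -> : x = ((p^-1 * x^-1)^-1 * p^-1)%g by rewrite invMg !invgK mulgK.
exists (sg K true (p^-1 * x^-1)^-1%g); rewrite -rhoM mulmxA rsym_rho ?stabV //.
by rewrite -!scalemxAl -mulmxA rho_rsym ?stabV // sg_false scale1r.
Qed.

Lemma AUB_scalar U : env U -> exists c, A *m U *m B = c *: (A *m B).
Proof.
move=> [u ->]; rewrite mulmx_sumr mulmx_suml.
apply: (big_ind (fun M => exists c, M = c *: (A *m B))).
- by exists 0; rewrite scale0r.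
- by move=> _ _ [a ->] [b ->]; exists (a + b); rewrite scalerDl.
move=> x _; have [c e] := AxB_scalar x.
by exists (u x * c); rewrite -scalemxAr -scalemxAl e scalerA.
Qed.

Lemma BUA_scalar U : env U -> exists c, B *m U *m A = c *: (B *m A).
Proof.
move=> [u ->]; rewrite mulmx_sumr mulmx_suml.
apply: (big_ind (fun M => exists c, M = c *: (B *m A))).
- by exists 0; rewrite scale0r.
- by move=> _ _ [a ->] [b ->]; exists (a + b); rewrite scalerDl.
move=> x _; have [c e] := BxA_scalar x.
by exists (u x * c); rewrite -scalemxAr -scalemxAl e scalerA.
Qed.

(** The coefficient of the identity is 1, because a permutation preserving both rows and columns is
    trivial. *)
Lemma AB_neq0 : A *m B != 0.
Proof.
apply/eqP => e; have := congr1 (fun M : 'M[K]_(Nn n) => (ds K 1%g *m M) 0 (rk 1%g)) e.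
rewrite /Asym mulmx0 [RHS]mxE mulmxA rsymE mulmx_sumr mulmx_suml.
rewrite (bigD1 1%g) ?stab1 //= -scalemxAr ds_rho mulg1 sg1 scale1r.
have term p : ((ds K p) *m rsym K true (colf l1 l2)) 0 (rk 1%g)
    = \sum_(q | stab (colf l1 l2) q) sg K true q * (p * q == 1)%g%:R.
  rewrite rsymE mulmx_sumr summxE; apply: eq_bigr => q _.
  rewrite -scalemxAr ds_rho !mxE eqxx (inj_eq (can_inj (@perm_of_rank n))).
  by rewrite eq_sym.
rewrite mxE term.
rewrite (bigD1 1%g) ?stab1 //= mulg1 eqxx sg1 mulr1 big1 => [|q /andP[_ ne]]; last first.
  by rewrite mul1g (negPf ne) mulr0.
rewrite addr0 summxE big1 ?addr0 => [/eqP|p /andP[sp np]]; first by rewrite oner_eq0.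
rewrite -scalemxAr ds_rho mul1g -scalemxAl mxE term.
rewrite big1 ?mulr0 // => q sq; case: eqP => [/eqP pq|]; last by rewrite mulr0.
case/eqP: np; apply/permP => i; rewrite perm1; apply: (cell_inj sh).
  by have := congr1 val (stabP _ _ sp i).
have sp' : stab (colf l1 l2) p.
  by rewrite -(invgK p) -(_ : q = p^-1%g) ?stabV //; apply/eqP; rewrite eq_sym eq_invg_mul.
by have := congr1 val (stabP _ _ sp' i).
Qed.

(** If the scalar were 0, every [A B x A B] would be a multiple of [A B A B = 0], against
    semiprimeness. *)
Lemma ABAB : exists2 c, c != 0 & A *m B *m A *m B = c *: (A *m B).
Proof.
have eA := A_env; have eB := B_env.
have [c e] := AUB_scalar (envM eB eA); rewrite mulmxA in e.
exists c => //; apply: contraNneq AB_neq0 => c0; rewrite c0 scale0r in e.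
apply/eqP/env_semiprime => //; first exact: envM.
move=> x; have [d ed] := BxA_scalar x.
by rewrite mulmxA -(mulmxA A) -(mulmxA A) ed -scalemxAr -scalemxAl mulmxA e scaler0.
Qed.

Lemma BABA : exists2 c, c != 0 & B *m A *m B *m A = c *: (B *m A).
Proof.
have eA := A_env; have eB := B_env.
have [c e] := BUA_scalar (envM eA eB); rewrite mulmxA in e.
have [d d0 ed] := ABAB; exists c => //; apply: contraNneq AB_neq0 => c0.
have : A *m (B *m A *m B *m A) *m B = 0 by rewrite e c0 scale0r mulmx0 mul0mx.
rewrite !mulmxA ed -!scalemxAl ed scalerA => /eqP.
by rewrite scaler_eq0 mulf_eq0 (negPf d0) /= => /eqP ->.
Qed.

(* Irreducibility of the Specht module: left multiplication by [f] is injective on it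
   unless it kills the generator [B A]. *)
Lemma specht_faithful (f : 'rV[K]_(Nn n)) U : env U -> f *m B *m A != 0 ->
  (forall x, f *m B *m A *m U *m rho x *m B *m A = 0) -> B *m A *m U = 0.
Proof.
move=> eU fn0 h; have eA := A_env; have eB := B_env.
have [d d0 ed] := BABA.
apply: env_semiprime => //; first by apply: envM => //; apply: envM.
move=> x; have eUx : env (U *m rho x) by apply: envM => //; apply: env_rho.
have [c ec] := AUB_scalar eUx.
have c0 : c = 0.
  have := h x; rewrite -(mulmxA _ U) -(mulmxA _ A) -(mulmxA _ (A *m _)) ec.
  rewrite -scalemxAr -scalemxAl => /eqP.
  rewrite scaler_eq0 => /orP[/eqP //|].
  rewrite !mulmxA -(mulmxA f) -(mulmxA f) -(mulmxA f) ed -scalemxAr.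
  by rewrite scaler_eq0 (negPf d0) /= mulmxA (negPf fn0).
rewrite !mulmxA -(mulmxA _ U) -(mulmxA B A) -(mulmxA B _ B) ec c0 scale0r.
by rewrite mulmx0 !mul0mx.
Qed.

End OneShape.

(** If both mixed products [A x B] could be nonzero, each shape would dominate the other. When the
    one occurring inside the product vanishes the claim is immediate; when the other vanishes the
    product squares to zero with any [x] inserted, and semiprimeness applies. *)
Lemma specht_orthogonal l1 l2 l3 m1 m2 m3 U :
  shape3 n l1 l2 l3 -> shape3 n m1 m2 m3 -> (l1, l2) != (m1, m2) -> env U ->
  Bsym l1 l2 *m Asym l1 l2 *m U *m Bsym m1 m2 *m Asym m1 m2 = 0.
Proof.
move=> sl sm ne eU.
have AUB0 a1 a2 b1 b2 V : env V -> (forall x, Asym a1 a2 *m rho x *m Bsym b1 b2 = 0) ->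
    Asym a1 a2 *m V *m Bsym b1 b2 = 0.
  move=> [u ->] h; rewrite mulmx_sumr mulmx_suml big1 // => x _.
  by rewrite -scalemxAr -scalemxAl h scaler0.
have [/existsP[x nx]|/existsPn h1] := boolP [exists x, Asym l1 l2 *m rho x *m Bsym m1 m2 != 0];
  last first.
  rewrite -(mulmxA _ _ U) -(mulmxA (Bsym _ _)) AUB0 ?mulmx0 ?mul0mx // => x.
  by apply/eqP/negPn; apply: h1.
have [/existsP[y ny]|/existsPn h2] := boolP [exists x, Asym m1 m2 *m rho x *m Bsym l1 l2 != 0].
  have := AxB_dominance sl nx; have := AxB_dominance sm ny.
  rewrite !(nrow_colf sl) // !(nrow_colf sm) //= => -[a1 a2] [b1 b2].
  by case/eqP: ne; congr (_, _); lia.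
have eA a b : env (Asym a b) by apply: A_env.
have eB a b : env (Bsym a b) by apply: B_env.
apply: env_semiprime => //; first by do 4?[apply: envM => //].
move=> z; rewrite !mulmxA.
have e0 : Asym m1 m2 *m rho z *m Bsym l1 l2 = 0.
  by apply: AUB0; [exact: env_rho | move=> y; apply/eqP/negPn; apply: h2].
rewrite -(mulmxA _ (Asym m1 m2)) -(mulmxA _ (Asym m1 m2 *m _)) e0.
by rewrite mulmx0 !mul0mx.
Qed.


Lemma fsz_recolor (T : finType) (f : 'I_n -> T) k c d : f k != c ->
  (fsz (recolor f k c) d + (d == f k) = fsz f d + (d == c))%N.
Proof.
move=> nk; rewrite /fsz (cardD1 k) [X in (_ = X + _)%N](cardD1 k) !inE /recolor eqxx.
rewrite (eq_sym c d) (eq_sym (f k) d).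
have -> : #|[predD1 [pred i | (if i == k then c else f i) == d] & k]|
        = #|[predD1 [pred i | f i == d] & k]|.
  by apply: eq_card => i; rewrite !inE; case: eqP.
by rewrite addnC addnA addnAC.
Qed.

(** The quantity to maximise: moving a point into a class at least as large increases it, so at a
    maximum the enlarged symmetriser gives zero, which is a Garnir relation. *)
Definition sumsq (T : finType) (f : 'I_n -> T) := (\sum_c fsz f c ^ 2)%N.

Lemma sumsq_recolor (T : finType) (f : 'I_n -> T) k c :
  f k != c -> (fsz f (f k) <= fsz f c)%N -> (sumsq f < sumsq (recolor f k c))%N.
Proof.
move=> nk le; rewrite /sumsq (bigD1 c) // (bigD1 (f k)) //=.
rewrite [X in (_ < X)%N](bigD1 c) // [X in (_ < _ + X)%N](bigD1 (f k)) //=.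
have := fsz_recolor c nk; have := fsz_recolor (f k) nk.
rewrite !eqxx (negPf nk) eq_sym (negPf nk) /= !addn0 => e1 e2.
rewrite [X in (_ < _ + (_ + X))%N](eq_bigr (fun d => fsz f d ^ 2)%N).
  by rewrite e2 -e1 !addnA ltn_add2r; move: e1 le; rewrite -!mulnn; nia.
move=> d /andP[d1 d2]; have := fsz_recolor d nk.
by rewrite (negPf d1) (negPf d2) !addn0 => ->.
Qed.

Lemma nrowE (T : finType) (f : 'I_n -> T) r : (nrow f r = \sum_c (r <= fsz f c))%N.
Proof. by rewrite /nrow -sum1_card big_mkcond; apply: eq_bigr => c _; rewrite inE; case: leqP. Qed.

Lemma samepairs_le3 (T : finType) (f : 'I_n -> T) : (forall c, fsz f c <= 3)%N ->
  samepairs f = (2 * nrow f 2 + 4 * nrow f 3)%N.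
Proof.
move=> h; rewrite /samepairs !nrowE !big_distrr /=.
rewrite -big_split /=; apply: eq_bigr => c _.
by have := h c; case: (fsz f c) => [|[|[|[|//]]]].
Qed.

Lemma sum_nrow_le3 (T : finType) (f : 'I_n -> T) : (forall c, fsz f c <= 3)%N ->
  (nrow f 1 + nrow f 2 + nrow f 3)%N = n.
Proof.
move=> h; rewrite -[RHS](sum_fsz f) !nrowE -!big_split /=; apply: eq_bigr => c _.
by have := h c; case: (fsz f c) => [|[|[|[|//]]]].
Qed.

(** [minn a b] counts the positive [r] below both [a] and [b]; summing over [r] first gives squares,
    and the diagonal terms add up to [n]. *)
Lemma minpairs_le3 (T : finType) (f : 'I_n -> T) : (forall c, fsz f c <= 3)%N ->
  (minpairs f + n = nrow f 1 ^ 2 + nrow f 2 ^ 2 + nrow f 3 ^ 2)%N.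
Proof.
move=> h; have sq r : (nrow f r ^ 2 = \sum_c \sum_d (r <= fsz f c) * (r <= fsz f d))%N.
  rewrite -mulnn {1}nrowE big_distrl /=; apply: eq_bigr => c _.
  by rewrite nrowE big_distrr.
rewrite !sq -!big_split /= -[X in (_ + X)%N](sum_fsz f) /minpairs -big_split /=.
apply: eq_bigr => c _; rewrite -!big_split /= [RHS](bigD1 c) //= addnC; congr (_ + _)%N.
  by have := h c; case: (fsz f c) => [|[|[|[|//]]]].
apply: eq_bigr => d _; have := h c; have := h d.
by case: (fsz f c) => [|[|[|[|//]]]]; case: (fsz f d) => [|[|[|[|//]]]].
Qed.

Lemma fsz_rowf l1 l2 l3 : shape3 n l1 l2 l3 ->
  forall r : 'I_3, fsz (rowf l1 l2) r = nth 0%N [:: l1; l2; l3] r.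
Proof.
move=> sh; have [/eqP en _ _] := and3P sh.
have e k : (k <= 2)%N -> (\sum_(r < 3 | (r < k)%N) fsz (rowf l1 l2) r =
   if k is k'.+1 then if k' is _.+1 then l1 + l2 else l1 else 0)%N.
  move=> k2; rewrite -(card_yrow_lt sh k2) -sum1_card.
  rewrite (partition_big (rowf l1 l2) (fun r => (r < k)%N)) //=.
  apply: eq_bigr => r rk; rewrite /fsz -sum1_card; apply: eq_bigl => i; rewrite !inE.
  by case: eqP => [er|]; rewrite ?andbF // andbT; move: rk; rewrite -er.
have := sum_fsz (rowf l1 l2); have := e 1%N isT; have := e 2%N isT.
rewrite !(big_mkcond (fun r : 'I_3 => (r < _)%N)) !big_ord_recr !big_ord0 /= !add0n.
move=> e2 e1 e3 r; have {r} [->|->|->] : [\/ r = widen_ord (leqnSn 2) (widen_ord (leqnSn 1) ord_max),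
    r = widen_ord (leqnSn 2) ord_max | r = ord_max].
  case: r => [[|[|[|//]]]] ?; [apply: Or31|apply: Or32|apply: Or33]; exact: val_inj.
all: by move=> /=; lia.
Qed.

(** The difference of the two numbers is twice the sum of the contents of the shape. *)
Lemma rows_eig l1 l2 l3 : shape3 n l1 l2 l3 ->
  (samepairs (rowf l1 l2) + n = l1 ^ 2 + l2 ^ 2 + l3 ^ 2)%N /\
  (minpairs (rowf l1 l2) = 2 * l2 + 4 * l3)%N.
Proof.
move=> sh; have [/eqP en le1 le2] := and3P sh; have e := fsz_rowf sh.
rewrite /samepairs /minpairs; split.
  rewrite !big_ord_recr big_ord0 !e /=; nia.
rewrite !big_ord_recr big_ord0 /= !(big_mkcond (fun d => d != _)) !big_ord_recr !big_ord0 /= !e /=.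
lia.
Qed.

(* Both sides of the pairing of a row-symmetric vector with column antisymmetrisers are
   eigenvectors of the central sum of transpositions.  Antisymmetrising with the largest
   possible columns forces a shape that dominates the row shape; equal eigenvalues then
   force equality of the two shapes. *)
Lemma garnir_specht_neq0 l1 l2 l3 v :
  shape3 n l1 l2 l3 -> v != 0 ->
  (forall (f : 'I_n -> 'I_n) x c, (3 < fsz f c)%N -> v *m rho x *m rsym K true f = 0) ->
  (forall p, stab (rowf l1 l2) p -> v *m rho p = v) ->
  (forall c d : 'I_3, (c < d)%N -> garnir false (rowf l1 l2) v c d) ->
  v *m Bsym l1 l2 *m Asym l1 l2 != 0.
Proof.
move=> sh vn0 small inv gar; have [/eqP en le1 le2] := and3P sh.
pose P (f : {ffun 'I_n -> 'I_n}) := [exists x, v *m rho x *m rsym K true f != 0].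
(* With singleton classes the antisymmetriser is the identity, so the search for a maximum starts
   from [v != 0]. *)
have P1 : P [ffun i => i].
  apply/existsP; exists 1%g; rewrite rho1 mulmx1 rsymE (big_pred1 1%g) ?sg1 ?scale1r ?rho1 ?mulmx1 //.
  move=> p /=; apply/stabP/eqP => [h|-> i]; last by rewrite perm1.
  by apply/permP => i; have := h i; rewrite !ffunE perm1.
have [f /existsP[x hn0] fmax] := arg_maxnP (fun f : {ffun 'I_n -> 'I_n} => sumsq f) P1.
set h := _ *m _ in hn0.
have vA : v *m Asym l1 l2 = #|stab (rowf l1 l2)|%:R *: v.
  by apply: rsym_fix => p /inv ->; rewrite scale1r.
have cA : #|stab (rowf l1 l2)|%:R != 0 :> K by apply: natr_neq0 => //; apply: card_stab_gt0.
have vAV : v = #|stab (rowf l1 l2)|%:R^-1 *: (v *m Asym l1 l2).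
  by rewrite vA scalerA mulVf // scale1r.
have f3 c : (fsz f c <= 3)%N.
  by rewrite leqNgt; apply/negP => /(small f x) e; rewrite /h e eqxx in hn0.
have [d1 d2] : (l1 <= nrow f 1)%N /\ (l1 + l2 <= nrow f 1 + nrow f 2)%N.
  apply: (@AxB_dominance _ _ _ _ l3 x) => //.
  apply: contra_neq hn0 => e; rewrite /h vAV -!scalemxAl -!(mulmxA v).
  by rewrite e mulmx0 scaler0.
have hinv p : stab f p -> h *m rho p = sg K true p *: h.
  by move=> sp; rewrite /h -mulmxA rsym_rho // scalemxAr.
(* By maximality of [f], the antisymmetriser of the enlarged colouring kills every translate of [v],
   hence [h]. *)
have hgar (c d : 'I_n) : c != d -> (fsz f d <= fsz f c)%N -> garnir true f h c d.
  move=> ncd le k fk; apply: garnir_recolor => //; first by rewrite fk eq_sym.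
  apply/eqP; apply: contraT => ne.
  have : P [ffun i => recolor f k c i].
    apply/existsPn => hx; case/eqP: ne; rewrite /h [X in _ *m X *m _]rsymE mulmx_sumr mulmx_suml.
    apply: big1 => q _; rewrite -scalemxAr -scalemxAl -(mulmxA v) rhoM.
    have := hx (x * q)%g; rewrite negbK => /eqP.
    have -> : rsym K true [ffun i => recolor f k c i] = rsym K true (recolor f k c).
      by apply: rsym_eq => i j; rewrite !ffunE.
    by move=> ->; rewrite scaler0.
  move/fmax => /=; have := @sumsq_recolor _ f k c; rewrite fk eq_sym => /(_ ncd le).
  have -> : sumsq [ffun i => recolor f k c i] = sumsq (recolor f k c).
    apply: eq_bigr => e _; congr (_ ^ 2)%N; apply: eq_card => i; rewrite !inE ffunE //.
  by case: ltngtP.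
have heig := casimir_eig hinv (fun c d ncd =>
  match boolP (fsz f d <= fsz f c)%N with
  | AltTrue le => or_introl (conj (hgar c d ncd le) le)
  | AltFalse gt => let le := ltnW (etrans (ltnNge _ _) gt) in
      or_intror (conj (hgar d c (etrans (congr1 negb (eq_sym _ _)) ncd) le) le)
  end).
have veig : v *m casimir K n
    = ((samepairs (rowf l1 l2))%:R - (minpairs (rowf l1 l2))%:R) *: v.
  have := @casimir_eig _ _ _ false (rowf l1 l2) v; rewrite expr0 scale1r; apply.
    by move=> p /inv ->; rewrite scale1r.
  have sz := fsz_rowf sh.
  have le (c d : 'I_3) : (c < d)%N -> (fsz (rowf l1 l2) d <= fsz (rowf l1 l2) c)%N.
    rewrite !sz; case: c d => [[|[|[|//]]] ?] [[|[|[|//]]] ?] //= _; lia.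
  move=> c d; rewrite neq_ltn => /orP[lt|lt]; [left|right]; split; try exact: le.
    exact: gar.
  exact: gar.
(* Pushing the central element through [rho x] and the antisymmetriser equates the row eigenvalue of
   [v] with the column eigenvalue of [h]. *)
have eqK : (samepairs (rowf l1 l2))%:R - (minpairs (rowf l1 l2))%:R
   = - ((samepairs f)%:R - (minpairs f)%:R) :> K.
  have : h *m casimir K n = (v *m casimir K n) *m rho x *m rsym K true f.
    rewrite /h -(mulmxA _ _ (casimir _ _)) casimir_env; last exact: rsym_env.
    by rewrite !mulmxA -(mulmxA v) casimirC mulmxA.
  rewrite heig veig -!scalemxAl -/h expr1 scaleN1r -scaleNr => /eqP.
  by rewrite -subr_eq0 -scalerBl scaler_eq0 (negPf hn0) orbF subr_eq0 => /eqP.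
have eqN : (samepairs (rowf l1 l2) + samepairs f = minpairs (rowf l1 l2) + minpairs f)%N.
  apply: (natr_inj_char0 charK); apply/eqP; rewrite !natrD.
  by move/eqP: eqK; rewrite opprB subr_eq addrAC -subr_eq opprK => /eqP ->; rewrite addrC.
have [r1 r2] := rows_eig sh; have c1 := samepairs_le3 f3; have c2 := minpairs_le3 f3.
have c3 := sum_nrow_le3 f3.
(* Read as column lengths, the classes of [f] give a shape of at most three rows dominating
   [(l1, l2, l3)]; the excesses [u] and [w] vanish because the contents agree. *)
have [n1 n2 n3] : [/\ nrow f 1 = l1, nrow f 2 = l2 & nrow f 3 = l3]%N.
  move: r1 r2 c1 c2 c3 d1 d2 eqN le1 le2 en; rewrite -!mulnn.
  move: (nrow f 1) (nrow f 2) (nrow f 3) (samepairs _) (minpairs _) (samepairs _) (minpairs _).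
  move=> a b c s1 m1 s2 m2 r1 r2 c1 c2 c3 d1 d2 eqN le1 le2 en.
  have [u eu] : exists u, a = (l1 + u)%N by exists (a - l1)%N; lia.
  have [w ew] : exists w, (a + b)%N = (l1 + l2 + w)%N by exists (a + b - (l1 + l2))%N; lia.
  have [g1 eg1] : exists g, l1 = (l2 + g)%N by exists (l1 - l2)%N; lia.
  have [g2 eg2] : exists g, l2 = (l3 + g)%N by exists (l2 - l3)%N; lia.
  have el3 : l3 = (c + w)%N by lia.
  subst l1 l2 l3 a; have [] := @content_eq_shape c w g1 g2 u b; [lia|lia|].
  by move=> u0 w0; split; lia.
have [|s es] := @rsym_matched f (colf l1 l2).
  case=> [|r]; first by apply: eq_card => c; rewrite !inE.
  rewrite (nrow_colf sh) //=; case: r => [|[|[|r]]] //=.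
  rewrite nth_nil; apply: eq_card0 => c; rewrite !inE.
  by apply/negbTE; rewrite -ltnNge ltnS (leq_trans (f3 c)).
have [c ec] := AxB_scalar sh (x * s^-1)%g.
have vAB : v *m Asym l1 l2 *m Bsym l1 l2 != 0.
  apply: contra_neq hn0 => e; rewrite /h es vAV -!scalemxAl !mulmxA.
  rewrite -(mulmxA _ (rho x)) rhoM -(mulmxA v) -(mulmxA v) ec.
  by rewrite -scalemxAr mulmxA e scaler0 mul0mx scaler0.
(* [v A B] is a nonzero multiple of [v A B A B], and [v A] of [v], so [v B A = 0] would kill
   [v A B]. *)
have [d dn0 ed] := ABAB sh.
apply: contraTneq vAB => e; rewrite negbK -(inj_eq (scalerI dn0)) scaler0 -mulmxA scalemxAr -ed.
by rewrite !mulmxA vA -!scalemxAl e mul0mx scaler0.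
Qed.
End Specht.

(** * The free algebra and its evaluations *)

Section FreePoly.
Variable K : fieldType.
Implicit Types (p q : fpoly K) (w : seq nat) (a : nat -> 'M[K]_3).

(* Pairing with a function on words: two lists denote the same polynomial iff all their
   pairings agree, which turns products into iterated pairings. *)
Definition fpair (V : lmodType K) (L : seq nat -> V) p := \sum_(t <- p) t.1 *: L t.2.
Definition feqv p q := forall w, fcoef p w = fcoef q w.

Lemma fpair_coef (V : lmodType K) (L : seq nat -> V) p (W : seq (seq nat)) :
  uniq W -> {subset [seq t.2 | t <- p] <= W} -> fpair L p = \sum_(w <- W) fcoef p w *: L w.
Proof.
move=> uW sub; have e w : fcoef p w *: L w = \sum_(t <- p) (if t.2 == w then t.1 *: L t.2 else 0).
  rewrite /fcoef scaler_suml big_mkcond; apply: eq_bigr => t _.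
  by case: eqP => [->|].
rewrite (eq_bigr _ (fun w _ => e w)) exchange_big /= /fpair.
rewrite big_seq [RHS]big_seq; apply: eq_bigr => t tp.
have tW : t.2 \in W by apply: sub; apply: map_f.
rewrite (bigD1_seq t.2) //= eqxx big1 ?addr0 // => w.
by rewrite eq_sym => /negPf ->.
Qed.

Lemma fpair_eqv (V : lmodType K) (L : seq nat -> V) p q : feqv p q -> fpair L p = fpair L q.
Proof.
move=> e; pose W := undup ([seq t.2 | t <- p] ++ [seq t.2 | t <- q]).
rewrite !(@fpair_coef _ _ _ W) ?undup_uniq //; first by apply: eq_bigr => w _; rewrite e.
  by move=> w; rewrite mem_undup mem_cat orbC => ->.
by move=> w; rewrite mem_undup mem_cat => ->.
Qed.

Lemma fcoefE p w : fcoef p w = fpair (fun u => (u == w)%:R : K^o) p.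
Proof.
rewrite /fcoef big_mkcond; apply: eq_bigr => t _.
by case: eqP => _; rewrite /GRing.scale /= ?mulr1 ?mulr0.
Qed.

Lemma feqvP p q : (forall L : seq nat -> K^o, fpair L p = fpair L q) -> feqv p q.
Proof. by move=> h w; rewrite !fcoefE h. Qed.

Lemma feqv_sym p q : feqv p q -> feqv q p. Proof. by move=> e w; rewrite e. Qed.
Lemma feqv_trans p q r : feqv p q -> feqv q r -> feqv p r.
Proof. by move=> e e' w; rewrite e e'. Qed.

Section Pairing.
Variables (V : lmodType K).
Implicit Types L : seq nat -> V.

Lemma fpair_nil L : fpair L [::] = 0. Proof. exact: big_nil. Qed.
Lemma fpair_cons L t p : fpair L (t :: p) = t.1 *: L t.2 + fpair L p.
Proof. exact: big_cons. Qed.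
Lemma fpair_add L p q : fpair L (fadd p q) = fpair L p + fpair L q.
Proof. exact: big_cat. Qed.
Lemma fpair_scale L c p : fpair L (fscale c p) = c *: fpair L p.
Proof.
by rewrite /fpair /fscale big_map scaler_sumr; apply: eq_bigr => t _; rewrite scalerA.
Qed.
Lemma fpair_sub L p q : fpair L (fsub p q) = fpair L p - fpair L q.
Proof. by rewrite /fsub fpair_add fpair_scale scaleN1r. Qed.
Lemma fpair_mul L p q :
  fpair L (fmul p q) = fpair (fun u => fpair (fun v => L (u ++ v)) q) p.
Proof.
rewrite /fpair /fmul big_allpairs_dep /=; apply: eq_bigr => t _.
by rewrite scaler_sumr; apply: eq_bigr => s _; rewrite scalerA.
Qed.
Lemma fpair_sum L ps : fpair L (fsum ps) = \sum_(p <- ps) fpair L p.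
Proof.
elim: ps => [|p ps IH]; first by rewrite big_nil fpair_nil.
by rewrite big_cons /fsum /= -[p ++ _]/(fadd _ _) fpair_add IH.
Qed.
Lemma fpair_var L i : fpair L (fvar K i) = L [:: i].
Proof. by rewrite /fvar fpair_cons fpair_nil addr0 scale1r. Qed.
Lemma fpair_one L : fpair L (fone K) = L [::].
Proof. by rewrite /fone fpair_cons fpair_nil addr0 scale1r. Qed.
Lemma fpair_mono L w : fpair L (fmono K w) = L w.
Proof. by rewrite /fmono fpair_cons fpair_nil addr0 scale1r. Qed.
Lemma eq_fpair L L' p : (forall w, L w = L' w) -> fpair L p = fpair L' p.
Proof. by move=> e; apply: eq_bigr => t _; rewrite e. Qed.
Lemma fpair_exchange (M : seq nat -> seq nat -> V) p q :
  fpair (fun v => fpair (fun u => M u v) p) q = fpair (fun u => fpair (fun v => M u v) q) p.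
Proof.
rewrite /fpair; under eq_bigr do rewrite scaler_sumr.
rewrite exchange_big; apply: eq_bigr => t _; rewrite scaler_sumr.
by apply: eq_bigr => s _; rewrite !scalerA mulrC.
Qed.
Lemma fpair_subst L s p :
  fpair L (fsubst s p) = fpair (fun w => fpair L (Defs.fprod [seq s i | i <- w])) p.
Proof.
elim: p => [|t p IH]; first by rewrite !fpair_nil.
by rewrite /fsubst /= -[_ ++ _]/(fadd _ _) fpair_add fpair_scale fpair_cons IH.
Qed.
End Pairing.

Lemma feqv_mul p p' q q' : feqv p p' -> feqv q q' -> feqv (fmul p q) (fmul p' q').
Proof.
move=> e e'; apply: feqvP => L; rewrite !fpair_mul (fpair_eqv _ e).
by apply: eq_fpair => u; rewrite (fpair_eqv _ e').
Qed.

Lemma feqv_add p p' q q' : feqv p p' -> feqv q q' -> feqv (fadd p q) (fadd p' q').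
Proof. by move=> e e'; apply: feqvP => L; rewrite !fpair_add (fpair_eqv _ e) (fpair_eqv _ e'). Qed.

Lemma feqv_scale c p p' : feqv p p' -> feqv (fscale c p) (fscale c p').
Proof. by move=> e; apply: feqvP => L; rewrite !fpair_scale (fpair_eqv _ e). Qed.

Lemma feqv_exp p p' m : feqv p p' -> feqv (fexp p m) (fexp p' m).
Proof. by move=> e; elim: m => [|m IH] //; apply: feqv_mul. Qed.

Lemma feqv_mulA p q r : feqv (fmul (fmul p q) r) (fmul p (fmul q r)).
Proof.
apply: feqvP => L; rewrite !fpair_mul; apply: eq_fpair => u; rewrite fpair_mul.
by apply: eq_fpair => v; apply: eq_fpair => w; rewrite catA.
Qed.

Lemma feqv_1mul p : feqv (fmul (fone K) p) p.
Proof. by apply: feqvP => L; rewrite fpair_mul fpair_one. Qed.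

Lemma fprod_cat ps qs : feqv (Defs.fprod (ps ++ qs)) (fmul (Defs.fprod ps) (Defs.fprod qs)).
Proof.
elim: ps => [|p ps IH] /=; first exact/feqv_sym/feqv_1mul.
by apply: feqv_trans (feqv_sym (feqv_mulA _ _ _)); apply: feqv_mul.
Qed.

Lemma fsubst_eqv s p q : feqv p q -> feqv (fsubst s p) (fsubst s q).
Proof. by move=> e; apply: feqvP => L; rewrite !fpair_subst; apply: fpair_eqv. Qed.

Lemma fsubst_mul s p q : feqv (fsubst s (fmul p q)) (fmul (fsubst s p) (fsubst s q)).
Proof.
apply: feqvP => L; rewrite fpair_subst !fpair_mul fpair_subst; apply: eq_fpair => u.
have e v : fpair L (Defs.fprod [seq s i | i <- u ++ v])
   = fpair (fun u' => fpair (fun v' => L (u' ++ v')) (Defs.fprod [seq s i | i <- v])) (Defs.fprod [seq s i | i <- u]).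
  by rewrite map_cat (fpair_eqv _ (fprod_cat _ _)) fpair_mul.
rewrite (eq_fpair _ e) fpair_exchange; apply: eq_fpair => u'.
by rewrite fpair_subst.
Qed.

Lemma fsubst_add s p q : feqv (fsubst s (fadd p q)) (fadd (fsubst s p) (fsubst s q)).
Proof. by apply: feqvP => L; rewrite fpair_subst !fpair_add !fpair_subst. Qed.

Lemma fsubst_scale s c p : feqv (fsubst s (fscale c p)) (fscale c (fsubst s p)).
Proof. by apply: feqvP => L; rewrite fpair_subst !fpair_scale !fpair_subst. Qed.

Lemma fsubst_exp s p m : feqv (fsubst s (fexp p m)) (fexp (fsubst s p) m).
Proof.
elim: m => [|m IH] /=; last by apply: feqv_trans (fsubst_mul _ _ _) _; apply: feqv_mul.
by apply: feqvP => L; rewrite fpair_subst !fpair_one.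
Qed.

Definition mono a w : 'M[K]_3 := \prod_(i <- w) a i.

Lemma fevalE a p : feval a p = fpair (mono a) p. Proof. by []. Qed.

Lemma feval_eqv a p q : feqv p q -> feval a p = feval a q.
Proof. by move=> e; rewrite !fevalE (fpair_eqv _ e). Qed.

Lemma feval_add a p q : feval a (fadd p q) = feval a p + feval a q.
Proof. by rewrite !fevalE fpair_add. Qed.
Lemma feval_sub a p q : feval a (fsub p q) = feval a p - feval a q.
Proof. by rewrite !fevalE fpair_sub. Qed.
Lemma feval_scale a c p : feval a (fscale c p) = c *: feval a p.
Proof. by rewrite !fevalE fpair_scale. Qed.
Lemma feval_mul a p q : feval a (fmul p q) = feval a p * feval a q.
Proof.
rewrite fevalE fpair_mul /fpair /feval mulr_suml; apply: eq_bigr => t _.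
rewrite mulr_sumr scaler_sumr; apply: eq_bigr => s _.
by rewrite /mono big_cat /= -scalerAl -scalerAr.
Qed.
Lemma feval_one a : feval a (fone K) = 1.
Proof. by rewrite fevalE fpair_one /mono big_nil. Qed.
Lemma feval_var a i : feval a (fvar K i) = a i.
Proof. by rewrite fevalE fpair_var /mono big_seq1. Qed.
Lemma feval_exp a p m : feval a (fexp p m) = feval a p ^+ m.
Proof. by elim: m => [|m IH] /=; rewrite ?feval_one // feval_mul IH exprS. Qed.
Lemma feval_comm a p q : feval a (fcomm p q) = feval a p * feval a q - feval a q * feval a p.
Proof. by rewrite feval_sub !feval_mul. Qed.
Lemma feval_prod a ps : feval a (Defs.fprod ps) = \prod_(p <- ps) feval a p.
Proof. by elim: ps => [|p ps IH] /=; rewrite ?big_nil ?feval_one // big_cons feval_mul IH. Qed.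
Lemma feval_sum a ps : feval a (fsum ps) = \sum_(p <- ps) feval a p.
Proof. by rewrite !fevalE fpair_sum. Qed.
Lemma feval_subst a s p : feval a (fsubst s p) = feval (fun i => feval a (s i)) p.
Proof.
rewrite !fevalE fpair_subst; apply: eq_fpair => w.
by rewrite -fevalE feval_prod /mono big_map.
Qed.
Lemma eq_feval a b p : (forall i, a i = b i) -> feval a p = feval b p.
Proof. by move=> e; rewrite !fevalE; apply: eq_fpair => w; apply: eq_bigr. Qed.

Lemma feval_conj (r : 'M[K]_3) a p : r * r = 1 ->
  feval (fun i => r * a i * r) p = r * feval a p * r.
Proof.
move=> rr; rewrite /feval mulr_sumr mulr_suml; apply: eq_bigr => t _.
rewrite -scalerAr -scalerAl; congr (_ *: _).
elim: (t.2) => [|i w IH]; first by rewrite !big_nil mulr1 rr.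
by rewrite !big_cons IH -!mulrA (mulrA r r) rr mul1r.
Qed.

Lemma feval_line a b p : exists P : {poly K},
  forall t, feval (fun i => a i + t *: b i) p 0 0 = P.[t].
Proof.
suff [P hP] : exists P : 'M[{poly K}]_3,
    forall t, feval (fun i => a i + t *: b i) p = map_mx (fun f : {poly K} => f.[t]) P.
  by exists (P 0 0) => t; rewrite hP mxE.
elim: p => [|[c w] p [P IH]].
  by exists 0 => t; rewrite /feval big_nil; apply/matrixP => i j; rewrite !mxE horner0.
suff [Q hQ] : exists Q : 'M[{poly K}]_3,
    forall t, mono (fun i => a i + t *: b i) w = map_mx (fun f : {poly K} => f.[t]) Q.
  exists (c%:P *: Q + P) => t; rewrite fevalE fpair_cons -fevalE IH hQ.
  by apply/matrixP => i j; rewrite !mxE hornerD hornerM hornerC.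
elim: w => [|k w [Q hQ]].
  exists 1 => t; rewrite /mono big_nil; apply/matrixP => i j; rewrite !mxE.
  by case: eqP => _; rewrite ?mulr1n ?mulr0n ?hornerC ?horner0 ?hornerE.
exists ((map_mx polyC (a k) + 'X *: map_mx polyC (b k)) *m Q) => t.
rewrite /mono big_cons -/(mono _ w) hQ; apply/matrixP => i j; rewrite !mxE horner_sum.
by apply: eq_bigr => l _; rewrite !mxE !hornerE.
Qed.

End FreePoly.

(** * Rotations and highest weight functions on 3x3 matrices *)

Section Matrix3.
Variable K : fieldType.

Definition mk9 (a b c d e f g h k : K) : 'M[K]_3 :=
  \matrix_(i, j) nth 0 (nth [::] [:: [:: a; b; c]; [:: d; e; f]; [:: g; h; k]] i) j.

Lemma forall_ord3 (P : 'I_3 -> Prop) : P 0 -> P 1 -> P 2%:R -> forall i, P i.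
Proof.
move=> h0 h1 h2 [[|[|[|//]]] lt].
- by rewrite (_ : Ordinal lt = 0) //; apply: val_inj.
- by rewrite (_ : Ordinal lt = 1) //; apply: val_inj.
- by rewrite (_ : Ordinal lt = 2%:R) //; apply: val_inj.
Qed.

Lemma sum_ord3 (V : nmodType) (F : 'I_3 -> V) : \sum_i F i = F 0 + F 1 + F 2%:R.
Proof.
rewrite !big_ord_recr big_ord0 /= add0r.
by congr (F _ + F _ + F _); apply: val_inj.
Qed.

Lemma mk9P (X : 'M[K]_3) : X = mk9 (X 0 0) (X 0 1) (X 0 2%:R) (X 1 0) (X 1 1) (X 1 2%:R)
  (X 2%:R 0) (X 2%:R 1) (X 2%:R 2%:R).
Proof. by apply/matrixP; do 2!apply: forall_ord3; rewrite mxE. Qed.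

Lemma mk9M a b c d e f g h k a' b' c' d' e' f' g' h' k' :
  mk9 a b c d e f g h k *m mk9 a' b' c' d' e' f' g' h' k' =
  mk9 (a * a' + b * d' + c * g') (a * b' + b * e' + c * h') (a * c' + b * f' + c * k')
      (d * a' + e * d' + f * g') (d * b' + e * e' + f * h') (d * c' + e * f' + f * k')
      (g * a' + h * d' + k * g') (g * b' + h * e' + k * h') (g * c' + h * f' + k * k').
Proof.
apply/matrixP; do 2!apply: forall_ord3; rewrite mxE sum_ord3 !mxE //=.
Qed.

Lemma mk9D a b c d e f g h k a' b' c' d' e' f' g' h' k' :
  mk9 a b c d e f g h k + mk9 a' b' c' d' e' f' g' h' k' =
  mk9 (a + a') (b + b') (c + c') (d + d') (e + e') (f + f') (g + g') (h + h') (k + k').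
Proof. by apply/matrixP; do 2!apply: forall_ord3; rewrite !mxE. Qed.

Lemma mk9Z t a b c d e f g h k :
  t *: mk9 a b c d e f g h k =
  mk9 (t * a) (t * b) (t * c) (t * d) (t * e) (t * f) (t * g) (t * h) (t * k).
Proof. by apply/matrixP; do 2!apply: forall_ord3; rewrite !mxE. Qed.

Lemma mk9N a b c d e f g h k :
  - mk9 a b c d e f g h k = mk9 (- a) (- b) (- c) (- d) (- e) (- f) (- g) (- h) (- k).
Proof. by apply/matrixP; do 2!apply: forall_ord3; rewrite !mxE. Qed.

Lemma mk9_1 : 1%:M = mk9 1 0 0 0 1 0 0 0 1.
Proof. by apply/matrixP; do 2!apply: forall_ord3; rewrite !mxE. Qed.

Lemma mk9_scalar s : s%:M = mk9 s 0 0 0 s 0 0 0 s.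
Proof. by apply/matrixP; do 2!apply: forall_ord3; rewrite !mxE. Qed.

Lemma mk9_inj a b c d e f g h k a' b' c' d' e' f' g' h' k' :
  [/\ a = a', b = b' & c = c'] -> [/\ d = d', e = e' & f = f'] ->
  [/\ g = g', h = h' & k = k'] ->
  mk9 a b c d e f g h k = mk9 a' b' c' d' e' f' g' h' k'.
Proof. by case=> -> -> -> [-> -> ->] [-> -> ->]. Qed.

(** The matrix of the cross product with [(a, b, c)], identifying [so_3] with [K^3]. *)
Definition sk3 (a b c : K) := mk9 0 (- c) b c 0 (- a) (- b) a 0.

Lemma skew_sk3 a b c : skew3 (sk3 a b c).
Proof.
by apply/matrixP; do 2!apply: forall_ord3; rewrite !mxE /= ?oppr0 ?opprK.
Qed.

Hypothesis charK : [pchar K] =i pred0.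

Lemma skew3P A : skew3 A -> A = sk3 (A 2%:R 1) (A 0 2%:R) (A 1 0).
Proof.
move=> h; have e i j : A i j = - A j i by have := congr1 (fun M : 'M_3 => M j i) h; rewrite !mxE.
have d i : A i i = 0.
  have /eqP := e i i; rewrite -subr_eq0 opprK -mulr2n -mulr_natr mulf_eq0.
  by rewrite (negPf (natr_neq0 charK (isT : (0 < 2)%N))) orbF => /eqP.
rewrite [LHS]mk9P !d; apply: mk9_inj; split=> //; exact: e.
Qed.

(* Rotation by [pi] around the axis [(p, q, r)]. *)
Definition rotmx (p q r : K) : 'M[K]_3 :=
  let N := p ^+ 2 + q ^+ 2 + r ^+ 2 in
  mk9 ((p ^+ 2 - q ^+ 2 - r ^+ 2) / N) (2%:R * p * q / N) (2%:R * p * r / N)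
      (2%:R * p * q / N) ((q ^+ 2 - p ^+ 2 - r ^+ 2) / N) (2%:R * q * r / N)
      (2%:R * p * r / N) (2%:R * q * r / N) ((r ^+ 2 - p ^+ 2 - q ^+ 2) / N).

Lemma rotmxK p q r : p ^+ 2 + q ^+ 2 + r ^+ 2 != 0 -> rotmx p q r * rotmx p q r = 1.
Proof.
move=> nz; rewrite -[_ * _]/(_ *m _) -[RHS]/(1%:M) mk9_1 mk9M.
by apply: mk9_inj; split; field.
Qed.

(** Letter [j] is sent to the vector in column [j - 1] of [X]. Letters outside 1, 2, 3 fall back to
    column 0, through [inord] and the predecessor. *)
Definition evX (X : 'M[K]_3) (j : nat) : 'M[K]_3 :=
  let k : 'I_3 := inord j.-1 in sk3 (X 0 k) (X 1 k) (X 2%:R k).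

(** A rotation carries the cross product with a vector to that with the rotated vector; a half-turn
    is its own inverse, hence the same matrix on both sides. *)
Lemma rot_evX p q r X j : p ^+ 2 + q ^+ 2 + r ^+ 2 != 0 ->
  evX (rotmx p q r *m X) j = rotmx p q r * evX X j * rotmx p q r.
Proof.
move=> nz; rewrite /evX; set k := inord _; rewrite !(mxE, sum_ord3) /=.
move: (X 0 k) (X 1 k) (X 2%:R k) => a b c.
rewrite -[X in _ = X]/(_ *m _ *m _) /sk3 !mk9M.
by apply: mk9_inj; split; field.
Qed.

Lemma evX_line X Y t j : evX (X + t *: Y) j = evX X j + t *: evX Y j.
Proof.
by rewrite /evX /sk3 !mxE mk9Z mk9D; apply: mk9_inj; split; ring.
Qed.

Lemma skew_evX X j : skew3 (evX X j). Proof. exact: skew_sk3. Qed.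

End Matrix3.

(** * Functions determined by their value at the identity matrix *)

Section Density.
Variable K : fieldType.
Hypothesis charK : [pchar K] =i pred0.

Lemma poly_nonroot (P : {poly K}) : P != 0 -> exists t, P.[t] != 0.
Proof.
move=> nz; pose rs := [seq i%:R | i <- iota 0 (size P)] : seq K.
have [/hasP[x _ hx]|/hasPn h] := boolP (has (fun x => P.[x] != 0) rs); first by exists x.
suff: (size rs < size P)%N by rewrite size_map size_iota ltnn.
apply: max_poly_roots => //; first by apply/allP => x /h; rewrite negbK.
by rewrite map_inj_uniq ?iota_uniq // => i j; apply: natr_inj_char0.
Qed.

Lemma poly_zero (P : {poly K}) : (forall t, P.[t] = 0) -> P = 0.
Proof.
by move=> h; apply/eqP; apply: contraT => /poly_nonroot[t]; rewrite h eqxx.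
Qed.

Lemma poly_vanish (Q P : {poly K}) : Q != 0 ->
  (forall t, Q.[t] != 0 -> P.[t] = 0) -> P = 0.
Proof.
move=> nz h; have /eqP : P * Q = 0.
  apply: poly_zero => t; rewrite hornerM.
  by have [->|/h ->] := eqVneq Q.[t] 0; rewrite ?mulr0 ?mul0r.
by rewrite mulf_eq0 (negPf nz) orbF => /eqP.
Qed.

Let two0 : 2%:R != 0 :> K. Proof. exact: natr_neq0. Qed.

(* The points [x] with [x ^ 2 + m] a square are parametrised by
   [x = (m / r - r) / 2], where [x ^ 2 + m = ((m / r + r) / 2) ^ 2]. *)
Lemma poly_vanish_sq (m : K) (P : {poly K}) (s : seq K) :
  (forall r, r \notin s -> r != 0 -> r ^+ 2 + m != 0 -> P.[(m / r - r) / 2%:R] = 0) ->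
  P = 0.
Proof.
elim: {P}(size P) {-2}P (leqnn (size P)) s => [|k IH] P sz s h.
  by apply/eqP; rewrite -size_poly_leq0.
pose Q := 'X * ('X^2 + m%:P) * \prod_(x <- s) ('X - x%:P).
have Q0 : Q != 0.
  have m1 : 'X^2 + m%:P \is monic.
    by rewrite monicE lead_coefDl ?lead_coefXn // size_polyXn ltnS size_polyC; case: eqP.
  by rewrite !mulf_neq0 ?polyX_eq0 ?monic_neq0 // monic_prod_XsubC.
have [r0] := poly_nonroot Q0.
rewrite /Q !hornerE !mulf_eq0 !negb_or -/(root _ _) root_prod_XsubC => /andP[/andP[r0n0 r0m] r0s].
(* The parameters [r0] and [- m / r0] give the same point, so both are excluded once its root is
   divided out. *)
have {}IH := IH _ _ [:: r0, - m / r0 & s].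
pose x r := (m / r - r) / 2%:R.
have /factor_theorem[P' eP] : root P (x r0) by apply/eqP; apply: h.
suff P'0 : P' = 0 by rewrite eP P'0 mul0r.
apply: IH.
  have [->|P'n0] := eqVneq P' 0; first by rewrite size_poly0.
  by move: sz; rewrite eP size_mul ?polyXsubC_eq0 // size_XsubC addn2 /= ltnS.
move=> r; rewrite !inE !negb_or => /and3P[ne1 ne2 ns] rn0 rm.
have /eqP := h r ns rn0 rm; rewrite eP hornerM mulf_eq0 => /orP[/eqP //|].
rewrite !hornerE subr_eq0 => /eqP e; case/eqP: ne1.
have : (r - r0) * (r * r0 + m) = 0.
  have -> : (r - r0) * (r * r0 + m) = 2%:R * r * r0 * (x r0 - x r) by rewrite /x; field; rewrite rn0 r0n0 two0.
  by rewrite /x e subrr mulr0.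
move/eqP; rewrite mulf_eq0 => /orP[/eqP/subr0_eq //|/eqP e2].
case/eqP: ne2; apply: (mulIf r0n0); rewrite divfK //.
by apply/eqP; rewrite -addr_eq0 e2.
Qed.

Variables (F : 'M[K]_3 -> K) (l1 l2 l3 : nat).
Hypothesis F_line : forall X Y, exists P : {poly K}, forall t, F (X + t *: Y) = P.[t].
Hypothesis F_rot : forall p q r X, p ^+ 2 + q ^+ 2 + r ^+ 2 != 0 -> F (rotmx p q r *m X) = F X.
Hypothesis F_uni : forall g X, unipotent_upper g -> F (X *m g) = F X.
Hypothesis F_tor : forall a b c X,
  F (X *m mk9 a 0 0 0 b 0 0 0 c) = a ^+ l1 * b ^+ l2 * c ^+ l3 * F X.

Lemma unipotent_mk9 x y z : unipotent_upper (mk9 1 x y 0 1 z 0 0 (1 : K)).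
Proof.
move=> i j; split; last by move=> ->; elim/forall_ord3: j; rewrite mxE.
by elim/forall_ord3: i; elim/forall_ord3: j; rewrite mxE.
Qed.

(** [diag(-1,-1,1)] and [diag(1,-1,-1)] are half-turns as well as torus elements: they fix [F 1%:M]
    by rotation invariance and multiply it by a sign given by the weight. *)
Lemma highest_weight_parity : F 1%:M != 0 -> ~~ odd (l1 + l2) /\ ~~ odd (l2 + l3).
Proof.
have odd0 m : F 1%:M != 0 -> F 1%:M = (-1) ^+ m * F 1%:M -> ~~ odd m.
  move=> nz /eqP; rewrite -subr_eq0 -{1}[F _]mul1r -mulrBl mulf_eq0 (negPf nz) orbF.
  rewrite subr_eq0 -signr_odd; case: (odd m) => //; rewrite expr1 -subr_eq0 opprK.
  by rewrite -mulr2n (negPf two0).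
move=> nz; split; apply: odd0 => //.
  have := F_tor (-1) (-1) 1 1%:M.
  rewrite mul1mx expr1n mulr1 -exprD => <-.
  rewrite -(@F_rot 0 0 1 1%:M); last by rewrite expr0n /= !add0r expr1n oner_eq0.
  by rewrite mulmx1 /rotmx !(expr0n, expr1n, add0r, divr1) /=; congr F; apply: mk9_inj; split; ring.
have := F_tor 1 (-1) (-1) 1%:M.
rewrite mul1mx expr1n mul1r -exprD => <-.
rewrite -(@F_rot 1 0 0 1%:M); last by rewrite expr0n /= !addr0 expr1n oner_eq0.
by rewrite mulmx1 /rotmx !(expr0n, expr1n, addr0, divr1) /=; congr F; apply: mk9_inj; split; ring.
Qed.

Hypothesis F1 : F 1%:M = 0.

(** An invertible upper triangular matrix is a torus element times a unipotent one. Adding [t] to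
    the diagonal makes any upper triangular matrix invertible for all but finitely many [t]. *)
Lemma F_upper a b c d e f : F (mk9 a b c 0 d e 0 0 f) = 0.
Proof.
have gen x y z u v w : x != 0 -> u != 0 -> w != 0 -> F (mk9 x y z 0 u v 0 0 w) = 0.
  move=> x0 u0 w0.
  have -> : mk9 x y z 0 u v 0 0 w
      = 1%:M *m mk9 x 0 0 0 u 0 0 0 w *m mk9 1 (y / x) (z / x) 0 1 (v / u) 0 0 1.
    by rewrite mul1mx mk9M; apply: mk9_inj; split; field; rewrite ?x0 ?u0 ?w0.
  by rewrite F_uni; [rewrite F_tor F1 mulr0 | exact: unipotent_mk9].
have [P hP] := F_line (mk9 a b c 0 d e 0 0 f) (mk9 1 0 0 0 1 0 0 0 1).
suff P0 : P = 0 by have := hP 0; rewrite scale0r addr0 P0 horner0.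
apply: (@poly_vanish (('X + a%:P) * ('X + d%:P) * ('X + f%:P))).
  have nz x : 'X + x%:P != 0 :> {poly K} by rewrite -[x]opprK polyCN polyXsubC_eq0.
  by rewrite !mulf_neq0.
move=> t; rewrite !hornerE !mulf_eq0 !negb_or => /andP[/andP[ta td] tf].
rewrite -hP mk9Z mk9D !mulr0 !mulr1 !addr0.
by apply: gen; rewrite addrC.
Qed.

Lemma vanish_line X Y (Q : {poly K}) :
  Q != 0 -> (forall t, Q.[t] != 0 -> F (X + t *: Y) = 0) -> forall t, F (X + t *: Y) = 0.
Proof.
have [P hP] := F_line X Y; move=> Q0 h t.
by rewrite hP (_ : P = 0) ?horner0 //; apply: (poly_vanish Q0) => u /h; rewrite hP.
Qed.

Lemma vanish_sq X Y m :
  (forall r, r != 0 -> r ^+ 2 + m != 0 -> F (X + ((m / r - r) / 2%:R) *: Y) = 0) ->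
  forall t, F (X + t *: Y) = 0.
Proof.
have [P hP] := F_line X Y; move=> h t.
rewrite hP (_ : P = 0) ?horner0 //; apply: (@poly_vanish_sq m _ [::]) => r _ r0 rm.
by rewrite -hP h.
Qed.

Lemma F_first_axis a b c d e f g : F (mk9 a b c 0 d e 0 f g) = 0.
Proof.
have nz u v w x y z t : y != 0 -> F (mk9 u v w 0 x z 0 y t) = 0.
  move=> y0; have := @vanish_sq (mk9 u v w 0 0 z 0 y t) (mk9 0 0 0 0 1 0 0 0 0) (y ^+ 2).
  move=> h; have -> : mk9 u v w 0 x z 0 y t = mk9 u v w 0 0 z 0 y t + x *: mk9 0 0 0 0 1 0 0 0 0.
    by rewrite mk9Z mk9D; apply: mk9_inj; split; ring.
  apply: h => r r0 rm; rewrite mk9Z mk9D.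
  set X := mk9 _ _ _ _ _ _ _ _ _.
  (* With [x = (y^2/r - r)/2] the vector [(x, y)] has squared length [s^2], where
     [s = (y^2/r + r)/2]. Hence [(y^2/r, y) = (x + s, y)] bisects the angle with the second axis:
     the half-turn about it sends the lower part of the second column to that axis and merely
     reverses the first axis. *)
  have nN : 0 ^+ 2 + (y ^+ 2 / r) ^+ 2 + y ^+ 2 != 0.
    have -> : 0 ^+ 2 + (y ^+ 2 / r) ^+ 2 + y ^+ 2 = y ^+ 2 * (r ^+ 2 + y ^+ 2) / r ^+ 2 by field.
    by rewrite !mulf_neq0 ?invr_neq0 ?expf_neq0.
  rewrite -(F_rot X nN) /X mk9M.
  set k1 := (X in mk9 _ _ _ X _ _ _ _ _); set k2 := (X in mk9 _ _ _ _ _ _ X _ _).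
  set k3 := (X in mk9 _ _ _ _ _ _ _ X _).
  have -> : k1 = 0 by rewrite /k1; ring.
  have -> : k2 = 0 by rewrite /k2; ring.
  have -> : k3 = 0 by rewrite /k3; move: ((_ + y ^+ 2)^-1) => iN; field; rewrite r0 two0.
  exact: F_upper.
have -> : mk9 a b c 0 d e 0 f g = mk9 a b c 0 d e 0 0 g + f *: mk9 0 0 0 0 0 0 0 1 0.
  by rewrite mk9Z mk9D; apply: mk9_inj; split; ring.
apply: (@vanish_line _ _ 'X); first by rewrite polyX_eq0.
move=> t; rewrite hornerX => t0; rewrite mk9Z mk9D !mulr0 !mulr1 !addr0 add0r.
exact: nz.
Qed.

(** The first column [(a, d, g)] is turned to the first axis by the same bisecting half-turn, now in
    space, with [d^2 + g^2] in the role of [y^2]. *)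
Lemma highest_weight_vanish X : F X = 0.
Proof.
have nz a b c d e f g h k : d ^+ 2 + g ^+ 2 != 0 -> F (mk9 a b c d e f g h k) = 0.
  move=> m0; have := @vanish_sq (mk9 0 b c d e f g h k) (mk9 1 0 0 0 0 0 0 0 0) (d ^+ 2 + g ^+ 2).
  move=> hh; have -> : mk9 a b c d e f g h k = mk9 0 b c d e f g h k + a *: mk9 1 0 0 0 0 0 0 0 0.
    by rewrite mk9Z mk9D; apply: mk9_inj; split; ring.
  apply: hh => r r0 rm; rewrite mk9Z mk9D.
  set Y := mk9 _ _ _ _ _ _ _ _ _.
  have nN : ((d ^+ 2 + g ^+ 2) / r) ^+ 2 + d ^+ 2 + g ^+ 2 != 0.
    have -> : ((d ^+ 2 + g ^+ 2) / r) ^+ 2 + d ^+ 2 + g ^+ 2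
        = (d ^+ 2 + g ^+ 2) * (r ^+ 2 + (d ^+ 2 + g ^+ 2)) / r ^+ 2 by field.
    by rewrite !mulf_neq0 ?invr_neq0 ?expf_neq0.
  rewrite -(F_rot Y nN) /Y mk9M.
  set k1 := (X in mk9 _ _ _ X _ _ _ _ _); set k2 := (X in mk9 _ _ _ _ _ _ X _ _).
  have -> : k1 = 0 by rewrite /k1; move: ((_ + g ^+ 2)^-1) => iN; field; rewrite r0 two0.
  have -> : k2 = 0 by rewrite /k2; move: ((_ + g ^+ 2)^-1) => iN; field; rewrite r0 two0.
  exact: F_first_axis.
rewrite [X]mk9P; move: (X 0 0) (X 0 1) (X 0 2%:R) (X 1 0) (X 1 1) (X 1 2%:R)
  (X 2%:R 0) (X 2%:R 1) (X 2%:R 2%:R) => a b c d e f g h k.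
have -> : mk9 a b c d e f g h k = mk9 a b c 0 e f g h k + d *: mk9 0 0 0 1 0 0 0 0 0.
  by rewrite mk9Z mk9D; apply: mk9_inj; split; ring.
(* The sum [d^2 + g^2] can vanish for nonzero [d]; such matrices are reached along the line on which
   only [d] varies. *)
apply: (@vanish_line _ _ ('X^2 + (g ^+ 2)%:P)).
  by rewrite -size_poly_eq0 size_polyDl size_polyXn // ltnS size_polyC; case: eqP.
move=> t; rewrite !hornerE => t0; rewrite mk9Z mk9D !mulr0 !mulr1 !addr0 add0r.
exact: nz.
Qed.

End Density.

(** * Multilinear polynomials *)

Section Multilinear.
Variables (K : fieldType) (n : nat).
Hypothesis charK : [pchar K] =i pred0.
Implicit Types (s t x p q : {perm 'I_n}) (v h : 'rV[K]_(Nn n)) (y : 'I_n -> 'M[K]_3).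
Notation rho := (Rreg K).

Definition Phi y v : 'M[K]_3 := \sum_s v 0 (rk s) *: \prod_i y (s i).

Lemma Phi_is_linear y a v w : Phi y (a *: v + w) = a *: Phi y v + Phi y w.
Proof.
rewrite /Phi scaler_sumr -big_split; apply: eq_bigr => s _.
by rewrite !mxE scalerDl scalerA.
Qed.

HB.instance Definition _ y := GRing.isLinear.Build K 'rV[K]_(Nn n) 'M[K]_3 _ (Phi y)
  (Phi_is_linear y).

Lemma eq_Phi y y' v : (forall i, y i = y' i) -> Phi y v = Phi y' v.
Proof. by move=> e; apply: eq_bigr => s _; congr (_ *: _); apply: eq_bigr. Qed.

Lemma Phi_rho y v t : Phi y (v *m rho t) = Phi (y \o t) v.
Proof.
rewrite /Phi (reindex_inj (mulIg t)) /=; apply: eq_bigr => s _.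
rewrite mul_rho mulgK; congr (_ *: _); apply: eq_bigr => i _.
by rewrite permM.
Qed.

Lemma feval_poly_of_vec a v : feval a (poly_of_vec v) = Phi (fun i => a i.+1) v.
Proof.
rewrite /feval /poly_of_vec big_map big_enum /=.
rewrite /Phi -(sum_perm_of (fun s => v 0 (rk s) *: \prod_i a (s i).+1)).
apply: eq_bigr => i _; rewrite rank_perm_of /pword big_map; congr (_ *: _).
by rewrite [index_enum _]unlock enumT.
Qed.

Definition ext y (j : nat) : 'M[K]_3 := oapp y 0 (insub j.-1 : option 'I_n).

Lemma ext_ord y (i : 'I_n) : ext y i.+1 = y i.
Proof. by rewrite /ext /= valK. Qed.

Lemma feval_ext y v : feval (ext y) (poly_of_vec v) = Phi y v.
Proof. by rewrite feval_poly_of_vec; apply: eq_Phi => i; apply: ext_ord. Qed.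

Lemma skew0 : skew3 (0 : 'M[K]_3).
Proof. by rewrite /skew3 trmx0 oppr0. Qed.

Lemma skew_ext y : (forall i, skew3 (y i)) -> forall j, skew3 (ext y j).
Proof. by move=> h j; rewrite /ext; case: insub => [i|] //=; apply: skew0. Qed.

Definition wcent v := forall y, (forall i, skew3 (y i)) -> is_scalar_mx (Phi y v).
Definition wid v := forall y, (forall i, skew3 (y i)) -> Phi y v = 0.

Lemma wcentP v : weak_central (poly_of_vec v) <-> wcent v.
Proof.
split=> h y sy; first by rewrite -feval_ext; apply/h/skew_ext.
by rewrite feval_poly_of_vec; apply: h.
Qed.

Lemma widP v : weak_identity (poly_of_vec v) <-> wid v.
Proof.
split=> h y sy; first by rewrite -feval_ext; apply/h/skew_ext.
by rewrite feval_poly_of_vec; apply: h.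
Qed.

Lemma wcent_rho v t : wcent v -> wcent (v *m rho t).
Proof. by move=> h y sy; rewrite Phi_rho; apply: h => i; apply: sy. Qed.

Lemma wid_rho v t : wid v -> wid (v *m rho t).
Proof. by move=> h y sy; rewrite Phi_rho; apply: h => i; apply: sy. Qed.

Lemma is_scalar_mxD (A B : 'M[K]_3) : is_scalar_mx A -> is_scalar_mx B -> is_scalar_mx (A + B).
Proof.
move=> /is_scalar_mxP[a ->] /is_scalar_mxP[b ->].
by apply/is_scalar_mxP; exists (a + b); rewrite raddfD.
Qed.

Lemma is_scalar_mxZ c (A : 'M[K]_3) : is_scalar_mx A -> is_scalar_mx (c *: A).
Proof.
by move=> /is_scalar_mxP[a ->]; apply/is_scalar_mxP; exists (c * a); rewrite scale_scalar_mx.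
Qed.

Lemma is_scalar_mx0 : is_scalar_mx (0 : 'M[K]_3).
Proof. by apply/is_scalar_mxP; exists 0; rewrite raddf0. Qed.

Lemma wcent_lin a v w : wcent v -> wcent w -> wcent (a *: v + w).
Proof. by move=> hv hw y sy; rewrite Phi_is_linear; apply: is_scalar_mxD; [apply: is_scalar_mxZ|]; auto. Qed.

Lemma wid_lin a v w : wid v -> wid w -> wid (a *: v + w).
Proof. by move=> hv hw y sy; rewrite Phi_is_linear hv // hw // scaler0 addr0. Qed.

Lemma wcent0 : wcent 0. Proof. by move=> y sy; rewrite linear0 is_scalar_mx0. Qed.
Lemma wid0 : wid 0. Proof. by move=> y sy; rewrite linear0. Qed.

Lemma wcent_env v U : env U -> wcent v -> wcent (v *m U).
Proof.
move=> [c ->] h; rewrite mulmx_sumr; apply: big_ind; first exact: wcent0.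
  by move=> a b ha hb; rewrite -[a]scale1r; apply: wcent_lin.
move=> t _; rewrite -scalemxAr -[_ *: _]addr0; apply: wcent_lin; [exact: wcent_rho | exact: wcent0].
Qed.

Lemma Phi_distr (J : finType) (c : 'I_n -> J -> K) (E : J -> 'M[K]_3) v :
  Phi (fun i => \sum_j c i j *: E j) v
  = \sum_(f : {ffun 'I_n -> J}) (\prod_i c i (f i)) *: Phi (fun i => E (f i)) v.
Proof.
rewrite /Phi; under [RHS]eq_bigr do rewrite scaler_sumr.
rewrite exchange_big /=; apply: eq_bigr => s _.
rewrite bigA_distr_bigA /= scaler_sumr.
rewrite (reindex (fun f : {ffun 'I_n -> J} => [ffun i => f (s i)])) /=; last first.
  exists (fun f : {ffun 'I_n -> J} => [ffun i => f (s^-1 i)%g]) => f _; apply/ffunP => i.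
    by rewrite !ffunE permKV.
  by rewrite !ffunE permK.
apply: eq_bigr => f _; under eq_bigr do rewrite ffunE.
rewrite scaler_prod !scalerA mulrC; congr (_ * _ *: _).
by rewrite [RHS](reindex_inj (@perm_inj _ s)).
Qed.

(* Inclusion-exclusion over the subsets [S] of variables. *)
Lemma polarization (T : finType) (f : 'I_n -> T) y v :
  Phi y (v *m rsym K false f) = \sum_(S : {set 'I_n}) (-1) ^+ #|~: S| *:
    Phi (fun i => \sum_j ((j \in S) && (f j == f i))%:R *: y j) v.
Proof.
under [RHS]eq_bigr do rewrite Phi_distr scaler_sumr.
rewrite exchange_big /=.
have inner (g : {ffun 'I_n -> 'I_n}) :
    \sum_(S : {set 'I_n}) (-1) ^+ #|~: S| *: (\prod_i ((g i \in S) && (f (g i) == f i))%:R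
       *: Phi (fun i => y (g i)) v)
    = (injectiveb g && [forall i, f (g i) == f i])%:R *: Phi (fun i => y (g i)) v.
  under eq_bigr do rewrite scalerA; rewrite -scaler_suml; congr (_ *: _).
  transitivity (\sum_(S : {set 'I_n}) (\prod_i (f (g i) == f i)%:R) *
      \prod_j (if j \in S then 1 else - (j \notin codom g)%:R) : K).
    apply: eq_bigr => S _.
    rewrite (eq_bigr (fun i => (f (g i) == f i)%:R * (g i \in S)%:R)) => [|i _]; last first.
      by rewrite mulrC -natrM mulnb.
    rewrite big_split /= mulrCA; congr (_ * _).
    have [/forallP h|/forallPn[i hi]] := boolP [forall i, g i \in S].
      rewrite big1 => [|i _]; last by rewrite h.
      rewrite mulr1 [RHS](bigID (mem S)) /= [X in _ = X * _]big1 ?mul1r => [|j ->] //.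
      rewrite (eq_bigr (fun=> -1)) => [|j nj].
        by rewrite prodr_const; congr (_ ^+ _); apply: eq_card => j; rewrite !inE.
      rewrite (negPf nj) (_ : j \notin codom g) //.
      by apply: contra nj => /codomP[i ->].
    rewrite (bigD1 i) //= (negPf hi) mul0r mulr0; symmetry.
    by rewrite (bigD1 (g i)) //= (negPf hi) codom_f oppr0 mul0r.
  have e := bigA_distr (1 : K) (@GRing.add K) (fun _ : 'I_n => 1) (fun j => - (j \notin codom g)%:R).
  rewrite -mulr_sumr -[X in _ * X]e -mulnb natrM mulrC; congr (_ * _).
    have [/injectiveP gi|] := boolP (injectiveb g).
      by rewrite big1 // => j _; rewrite (inj_card_onto gi) ?leqnn //= subr0.
    rewrite /injectiveb /dinjectiveb => /card_uniqP nu.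
    have [j nj] : exists j, j \notin codom g.
      apply/existsP; rewrite -[X in is_true X]negbK negb_exists; apply/negP => /forallP all_in.
      case: nu; rewrite size_map -cardE; apply: eq_card => j.
      by have := all_in j; rewrite negbK inE => ->.
    by rewrite (bigD1 j) //= nj subrr mul0r.
  have [/forallP h|/forallPn[i hi]] := boolP [forall i, f (g i) == f i].
    by rewrite big1 // => i _; rewrite h.
  by rewrite (bigD1 i) //= (negPf hi) mul0r.
rewrite (eq_bigr _ (fun g _ => inner g)) rsymE.
transitivity (\sum_(g : {ffun 'I_n -> 'I_n} | injectiveb g && [forall i, f (g i) == f i])
   Phi (fun i => y (g i)) v); last first.
  by rewrite big_mkcond; apply: eq_bigr => g _; case: ifP => _; rewrite ?scale1r ?scale0r.
rewrite (reindex_onto (fun p : {perm 'I_n} => val p) (insubd (1%g : {perm 'I_n}))) /=; last first.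
  by move=> g /andP[gi _]; rewrite insubdK.
rewrite mulmx_sumr linear_sum; apply: eq_big => [p|p _].
  rewrite (valP p) valKd eqxx andbT /stab; apply: eq_forallb => i.
  by rewrite -pvalE.
rewrite sg_false scale1r -[LHS]/(Phi y _) Phi_rho; apply: eq_Phi => i /=.
by rewrite -pvalE.
Qed.

(* Applied with [Q] the scalar matrices and with [Q] the zero matrix. *)
Lemma polarization_ind (T : finType) (f : 'I_n -> T) v (Q : 'M[K]_3 -> Prop) :
  Q 0 -> (forall A B, Q A -> Q B -> Q (A + B)) -> (forall c A, Q A -> Q (c *: A)) ->
  (forall z : T -> 'M[K]_3, (forall c, skew3 (z c)) -> Q (Phi (fun i => z (f i)) v)) ->
  forall y, (forall i, skew3 (y i)) -> Q (Phi y (v *m rsym K false f)).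
Proof.
move=> Q0 QD QZ h y sy; rewrite polarization; apply: big_ind => // S _; apply: QZ.
apply: (h (fun c => \sum_j ((j \in S) && (f j == c))%:R *: y j)) => c.
apply: (big_ind (fun M : 'M[K]_3 => skew3 M)); first exact: skew0.
  by move=> A B eA eB; rewrite /skew3 linearD /= eA eB opprD.
by move=> j _; rewrite /skew3 linearZ /= sy scalerN.
Qed.

Lemma Phi_alternating (T : eqType) (J : Type) (f : 'I_n -> T) h (E : J -> 'M[K]_3) (g : 'I_n -> J) i j :
  (forall p, stab f p -> h *m rho p = sg K true p *: h) ->
  i != j -> f i = f j -> g i = g j -> Phi (fun i => E (g i)) h = 0.
Proof.
move=> inv ne ef eg.
have e : Phi (fun i => E (g i)) h = - Phi (fun i => E (g i)) h.
  rewrite -[RHS]scaleN1r -linearZ /= -[-1]/((-1) ^+ true) -(sg_tperm K true ne).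
  rewrite -inv ?stab_tperm // Phi_rho; apply: eq_Phi => k /=.
  by case: tpermP => // ->; rewrite eg.
move/eqP: e; rewrite -subr_eq0 opprK -mulr2n -scaler_nat scaler_eq0.
by rewrite (negPf (natr_neq0 charK (isT : (0 < 2)%N))) => /eqP.
Qed.

Definition evc (X : 'M[K]_3) (k : 'I_3) : 'M[K]_3 := sk3 (X 0 k) (X 1 k) (X 2%:R k).

Lemma evc_sum (X : 'M[K]_3) (c : 'I_3 -> K) :
  sk3 (\sum_r X 0 r * c r) (\sum_r X 1 r * c r) (\sum_r X 2%:R r * c r) = \sum_r c r *: evc X r.
Proof.
by rewrite !sum_ord3 /evc /sk3 !mk9Z !mk9D; apply: mk9_inj; split; ring.
Qed.

Lemma skew_evc X k : skew3 (evc X k). Proof. exact: skew_sk3. Qed.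

Definition axis (A : 'M[K]_3) (r : 'I_3) : K := nth 0 [:: A 2%:R 1; A 0 2%:R; A 1 0] r.

Lemma skew_basis A : skew3 A -> A = \sum_r axis A r *: evc 1%:M r.
Proof.
move=> /(skew3P charK) eA; rewrite /axis.
rewrite -evc_sum eA; congr sk3; rewrite sum_ord3 !mxE /= ?(mul0r, mul1r, addr0, add0r) //.
all: by rewrite !mxE.
Qed.

(** After expansion in a basis of [so_3], some basis vector occurs twice among any four alternating
    arguments. *)
Lemma large_class_vanish (T : finType) (f : 'I_n -> T) h c :
  (forall p, stab f p -> h *m rho p = sg K true p *: h) -> (3 < fsz f c)%N -> wid h.
Proof.
move=> inv big y sy.
rewrite (eq_Phi _ (fun i => skew_basis (sy i))) Phi_distr big1 // => g _.
have [i [j [ci cj ne eg]]] : exists i j, [/\ f i = c, f j = c, i != j & g i = g j].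
  have [inj|] := boolP (dinjectiveb g [pred i | f i == c]).
    have := max_card (mem [seq g i | i in [pred i | f i == c]]).
    by move/dinjectiveP: inj => inj; rewrite card_in_image // card_ord leqNgt big.
  case/dinjectivePn => i; rewrite inE => /eqP ci [j]; rewrite !inE => /andP[ne /eqP cj] e.
  by exists i, j; rewrite eq_sym.
by rewrite (@Phi_alternating _ _ f _ _ g i j) ?scaler0 ?ci ?cj.
Qed.

(** * The highest weight function of a tableau *)

Section HighestWeight.
Variables (l1 l2 l3 : nat).
Hypothesis sh : shape3 n l1 l2 l3.
Notation A := (Asym K n l1 l2).
Notation B := (Bsym K n l1 l2).
Variable v : 'rV[K]_(Nn n).
Hypothesis vc : wcent v.

(* The scalar value, on the columns of [X], of the polynomial obtained from [v B] by
   identifying the variables of each row of the tableau. *)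
Definition hwf (X : 'M[K]_3) : K := Phi (fun i => evc X (rowf l1 l2 i)) (v *m B) 0 0.

Lemma vB_alt p : stab (colf l1 l2) p -> v *m B *m rho p = sg K true p *: (v *m B).
Proof. by move=> sp; rewrite -mulmxA rsym_rho // scalemxAr. Qed.

(** Expanding the columns of [X *m g], a surviving term assigns to each box [i] a column [f i] no
    greater than its row. Take a box in the least row where [f i] is smaller than the row. The box
    above it in row [f i] has the same value by minimality, so antisymmetry in their common column
    kills the term; only the diagonal term is left. *)
Lemma hwf_upper X (g : 'M[K]_3) : (forall i j : 'I_3, (j < i)%N -> g i j = 0) ->
  hwf (X *m g) = (\prod_(i : 'I_n) g (rowf l1 l2 i) (rowf l1 l2 i)) * hwf X.
Proof.
move=> up; rewrite /hwf.
rewrite (@eq_Phi _ (fun i => \sum_r g r (rowf l1 l2 i) *: evc X r)); last first.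
  by move=> i; rewrite -evc_sum /evc !mxE.
rewrite Phi_distr (bigD1 [ffun i => rowf l1 l2 i]) //= [X in fun_of_matrix (_ + X)]big1 ?addr0 => [|f nf].
  rewrite mxE; congr (_ * _); first by apply: eq_bigr => i _; rewrite ffunE.
  by congr (fun_of_matrix _ 0 0); apply: eq_Phi => i; rewrite ffunE.
have [/existsP[i lt]|/existsPn le] := boolP [exists i, (rowf l1 l2 i < f i)%N].
  by rewrite (bigD1 i) //= up // mul0r scale0r.
have [i ni] : exists i, f i != rowf l1 l2 i.
  apply/existsP; rewrite -negb_forall; apply: contra nf => /forallP h.
  by apply/eqP/ffunP => i; rewrite ffunE; apply/eqP.
have [{ni}i ni imin] := @arg_minnP _ i (fun i => f i != rowf l1 l2 i) (fun i => rowf l1 l2 i) ni.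
have lt : (f i < rowf l1 l2 i)%N.
  by rewrite ltn_neqAle ni leqNgt; apply: le.
have lc : (ycol l1 l2 i < nth 0 [:: l1; l2; l3] (f i))%N.
  have /= := ycol_lt sh (ltn_ord i); move: lt (ltn_ord (rowf l1 l2 i)) => /=.
  have [_ le1 le2] := and3P sh.
  move: (yrow _ _ _) => r; case: (f i) => -[|[|[|m]]] ? /=; case: r => [|[|[|r]]] //=; lia.
have [cn cr cc] := cellP sh (ltn_ord (f i)) lc.
pose j := Ordinal cn.
have fj : f j = f i.
  have : ~~ (f j != rowf l1 l2 j).
    by apply/negP => /imin; rewrite /= cr leqNgt lt.
  by rewrite negbK => /eqP ->; apply: val_inj.
have nij : i != j.
  by apply: contraTneq lt => e; rewrite -[X in (_ < X)%N]/(yrow l1 l2 i) {2}e cr ltnn.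
rewrite (@Phi_alternating _ _ (colf l1 l2) _ (evc X) f i j) ?scaler0 //; first exact: vB_alt.
by apply: val_inj; rewrite /= cc.
Qed.

Lemma prod_rowf (d : 'I_3 -> K) :
  \prod_(i : 'I_n) d (rowf l1 l2 i) = d 0 ^+ l1 * d 1 ^+ l2 * d 2%:R ^+ l3.
Proof.
rewrite (partition_big (rowf l1 l2) xpredT) //=.
rewrite (eq_bigr (fun r => d r ^+ fsz (@rowf n l1 l2) r)) => [|r _].
  rewrite !big_ord_recr big_ord0 /= mul1r !(fsz_rowf sh) /=.
  by congr (_ ^+ _ * _ ^+ _ * _ ^+ _); congr d; apply: val_inj.
rewrite (eq_bigr (fun=> d r)) => [|i /eqP -> //].
by rewrite prodr_const; congr (_ ^+ _); apply: eq_card => i; rewrite !inE.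
Qed.

Lemma vB_central : wcent (v *m B).
Proof. by apply: wcent_env => //; apply: rsym_env. Qed.

Lemma hwf_line (X Y : 'M[K]_3) : exists P : {poly K}, forall t : K, hwf (X + t *: Y) = P.[t].
Proof.
have [P hP] := feval_line (ext (fun i => evc X (rowf l1 l2 i)))
   (ext (fun i => evc Y (rowf l1 l2 i))) (poly_of_vec (v *m B)).
exists P => t; rewrite -hP /hwf -feval_ext; congr (fun_of_matrix _ 0 0).
apply: eq_feval => j; rewrite /ext; case: insub => [i|] /=; last by rewrite scaler0 addr0.
by rewrite /evc /sk3 !mxE mk9Z mk9D; apply: mk9_inj; split; ring.
Qed.

Lemma hwf_rot (p q r : K) X : p ^+ 2 + q ^+ 2 + r ^+ 2 != 0 -> hwf (rotmx p q r *m X) = hwf X.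
Proof.
move=> nz; rewrite /hwf -feval_ext.
rewrite (@eq_feval _ _ (fun j => rotmx p q r * ext (fun i => evc X (rowf l1 l2 i)) j * rotmx p q r)).
  have -> : feval (fun j => rotmx p q r * ext (fun i => evc X (rowf l1 l2 i)) j * rotmx p q r)
      (poly_of_vec (v *m B)) = rotmx p q r * Phi (fun i => evc X (rowf l1 l2 i)) (v *m B) * rotmx p q r.
    by rewrite -feval_ext -feval_conj // rotmxK.
  have /is_scalar_mxP[s ->] : is_scalar_mx (Phi (fun i => evc X (rowf l1 l2 i)) (v *m B)).
    by apply: vB_central => i; apply: skew_evc.
  by rewrite -scalemx1 -scalerAr -scalerAl mulr1 rotmxK.
move=> j; rewrite /ext; case: insub => [i|] /=; last by rewrite mulr0 mul0r.
rewrite -(inord_val (rowf l1 l2 i)); exact: (@rot_evX _ p q r X (rowf l1 l2 i).+1 nz).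
Qed.

Lemma hwf_uni (g X : 'M[K]_3) : unipotent_upper g -> hwf (X *m g) = hwf X.
Proof.
move=> ug; rewrite hwf_upper => [|i j lt]; last by apply: (proj1 (ug i j)).
by rewrite big1 ?mul1r // => i _; apply: (proj2 (ug _ _)).
Qed.

Lemma hwf_tor a b c X :
  hwf (X *m mk9 a 0 0 0 b 0 0 0 c) = a ^+ l1 * b ^+ l2 * c ^+ l3 * hwf X.
Proof.
rewrite hwf_upper.
  by rewrite (prod_rowf (fun r => (mk9 a 0 0 0 b 0 0 0 c) r r)) !mxE.
by move=> i j; elim/forall_ord3: i; elim/forall_ord3: j; rewrite mxE.
Qed.

(** The function vanishes on all matrices by density, and polarisation recovers [v B A] from the
    values of [v B] at arguments constant along rows. *)
Lemma hwf_wid : hwf 1%:M = 0 -> wid (v *m B *m A).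
Proof.
move=> h1; have h0 := highest_weight_vanish charK hwf_line hwf_rot hwf_uni hwf_tor h1.
move=> y sy; apply: (@polarization_ind _ _ _ (fun M => M = 0)) => //.
- by move=> a b -> ->; rewrite addr0.
- by move=> c a ->; rewrite scaler0.
move=> z sz; pose X : 'M[K]_3 := \matrix_(i, k) nth 0 [:: z k 2%:R 1; z k 0 2%:R; z k 1 0] i.
rewrite (@eq_Phi _ (fun i => evc X (rowf l1 l2 i))).
  have /is_scalar_mxP[s es] : is_scalar_mx (Phi (fun i => evc X (rowf l1 l2 i)) (v *m B)).
    by apply: vB_central => i; apply: skew_evc.
  have := h0 X; rewrite /hwf es mxE eqxx mulr1n => ->; exact: raddf0.
by move=> i; rewrite [LHS](skew3P charK) // /evc !mxE.
Qed.

(** For one row the value at the identity is an entry of a positive power of a skew matrix whose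
    first row is zero. Positivity of [n] excludes the constant 1, which is central and belongs to
    the empty shape. *)
Lemma hwf_good : (0 < n)%N -> hwf 1%:M != 0 -> good_lambda n l1 l2 l3.
Proof.
move=> n0 nz; have [p1 p2] := highest_weight_parity charK hwf_rot hwf_tor nz.
have [/eqP en le1 le2] := and3P sh.
rewrite /good_lambda en eqxx le1 le2 /= !oddB // -!oddD p1 p2 /= andbT lt0n.
apply: contraNneq nz => l20; apply/eqP; rewrite /hwf /Phi summxE big1 // => s _.
rewrite mxE; have e0 : \prod_i evc 1%:M (rowf l1 l2 (s i)) = (evc 1%:M 0 : 'M[K]_3) ^+ n.
  rewrite (eq_bigr (fun=> evc 1%:M 0)) ?prodr_const ?card_ord // => i _.
  by congr evc; apply: val_inj; rewrite /= /yrow ifT //; have := ltn_ord (s i); lia.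
have e1 m : (0 < m)%N -> (evc 1%:M 0 ^+ m : 'M[K]_3) 0 0 = 0.
  case: m => // m _; rewrite exprS -[_ * _ ^+ _]/(_ *m _) mxE sum_ord3 !mxE /=.
  by rewrite !(oppr0, mul0r, addr0).
by rewrite e0 e1 // mulr0.
Qed.

End HighestWeight.


End Multilinear.

(** * The explicit highest weight vectors: invariance *)

Section Explicit.
Variable K : fieldType.
Hypothesis charK : [pchar K] =i pred0.

Lemma sgn_sum_S3 (V : lmodType K) (G : 'I_3 -> 'I_3 -> 'I_3 -> V) :
  \sum_(s <- enum {perm 'I_3}) sgnK K s *: G (s 0) (s 1) (s 2%:R) =
  G 0 1 2%:R - G 1 0 2%:R - G 2%:R 1 0 - G 0 2%:R 1 + G 1 2%:R 0 + G 2%:R 0 1.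
Proof.
pose a := tperm (0 : 'I_3) 1; pose b := tperm (0 : 'I_3) 2%:R; pose c := tperm (1 : 'I_3) 2%:R.
pose l := [:: 1; a; b; c; a * b; b * a]%g.
have ul : uniq l.
  apply: (@map_uniq _ _ (fun s : {perm 'I_3} => (s 0, s 1))).
  by rewrite /l /= !(permM, perm1, permE) /=.
have pl : perm_eq (enum {perm 'I_3}) l.
  rewrite perm_sym; apply: uniq_perm => //; first exact: enum_uniq.
  have [|_ //] := uniq_min_size ul (fun s _ => mem_enum {perm 'I_3} s).
  by rewrite -cardE card_Sn.
rewrite (perm_big _ pl) /l !big_cons big_nil /= addr0 /sgnK.
rewrite !odd_permM odd_perm1 !odd_tperm /= !expr1 !expr0 !scale1r !scaleN1r.
by rewrite !(permM, perm1, permE) /= !addrA.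
Qed.

(** Covers [s3] ([k = 0]) and the second summand of [w2] ([k = 2 * m1]) at once. *)
Definition alt3 (k : nat) : fpoly K :=
  fsum [seq fscale (sgnK K s) (Defs.fprod [:: xo K (s 0); xo K (s 1); fexp (x1 K) k; xo K (s 2%:R)])
       | s <- enum {perm 'I_3}].

Lemma s3_alt3 : feqv (s3 K) (alt3 0).
Proof.
apply: feqvP => L; rewrite !fpair_sum !big_map; apply: eq_bigr => s _.
rewrite !fpair_scale; congr (_ *: _); apply: fpair_eqv.
by do 2!apply: feqv_mul => //; apply/feqv_sym/feqv_1mul.
Qed.

Lemma fpair_x1 (V : lmodType K) (L : seq nat -> V) k : fpair L (fexp (x1 K) k) = L (nseq k 1%N).
Proof.
elim: k L => [|k IH] L /=; first by rewrite fpair_one.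
by rewrite fpair_mul fpair_var IH.
Qed.

Lemma fpair_alt3 (V : lmodType K) (L : seq nat -> V) k (w := nseq k 1%N) :
  fpair L (alt3 k) =
    L ([:: 1; 2] ++ w ++ [:: 3]) - L ([:: 2; 1] ++ w ++ [:: 3])
  - L ([:: 3; 2] ++ w ++ [:: 1]) - L ([:: 1; 3] ++ w ++ [:: 2])
  + L ([:: 2; 3] ++ w ++ [:: 1]) + L ([:: 3; 1] ++ w ++ [:: 2]).
Proof.
rewrite fpair_sum big_map.
under eq_bigr do rewrite fpair_scale /= /xo !(fpair_mul, fpair_var, fpair_x1, fpair_one) /=.
by rewrite (sgn_sum_S3 (fun i j l => L [:: i.+1, j.+1 & w ++ [:: l.+1]])).
Qed.

Section Action.
Variable g : 'M[K]_3.
Hypothesis ug : unipotent_upper g.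

Lemma act_var1 (V : lmodType K) (L : seq nat -> V) : fpair L (gl3_var g 1) = L [:: 1%N].
Proof.
have g00 : g (inord 0) (inord 0) = 1 by apply: (proj2 (ug _ _)).
have g10 : g (inord 1) (inord 0) = 0 by apply: (proj1 (ug _ _)); rewrite !inordK.
have g20 : g (inord 2) (inord 0) = 0 by apply: (proj1 (ug _ _)); rewrite !inordK.
by rewrite /gl3_var /= !fpair_cons fpair_nil /= g00 g10 g20 scale1r !scale0r !addr0.
Qed.

Lemma act_var2 (V : lmodType K) (L : seq nat -> V) :
  fpair L (gl3_var g 2) = g (inord 0) (inord 1) *: L [:: 1%N] + L [:: 2%N].
Proof.
have g11 : g (inord 1) (inord 1) = 1 by apply: (proj2 (ug _ _)).
have g21 : g (inord 2) (inord 1) = 0 by apply: (proj1 (ug _ _)); rewrite !inordK.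
by rewrite /gl3_var /= !fpair_cons fpair_nil /= g11 g21 scale1r !scale0r !addr0.
Qed.

Lemma act_var3 (V : lmodType K) (L : seq nat -> V) :
  fpair L (gl3_var g 3) = g (inord 0) (inord 2) *: L [:: 1%N]
                         + (g (inord 1) (inord 2) *: L [:: 2%N] + L [:: 3%N]).
Proof.
have g22 : g (inord 2) (inord 2) = 1 by apply: (proj2 (ug _ _)).
by rewrite /gl3_var /= !fpair_cons fpair_nil /= g22 scale1r !addr0.
Qed.

(** The action transposed to functions on words: words are transformed letter by letter, and
    invariance becomes a [ring] identity. *)
Definition actw (V : lmodType K) (L : seq nat -> V) w := fpair L (Defs.fprod [seq gl3_var g i | i <- w]).

Lemma actw_nil (V : lmodType K) (L : seq nat -> V) : actw L [::] = L [::].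
Proof. exact: fpair_one. Qed.

Lemma actw_cons (V : lmodType K) (L : seq nat -> V) i w :
  actw L (i :: w) = fpair (fun u => actw (fun v => L (u ++ v)) w) (gl3_var g i).
Proof. by rewrite /actw /= fpair_mul. Qed.

Lemma actw_nseq (V : lmodType K) (L : seq nat -> V) k w :
  actw L (nseq k 1%N ++ w) = actw (fun v => L (nseq k 1%N ++ v)) w.
Proof.
elim: k L => [|k IH] L //=.
by rewrite actw_cons act_var1 IH.
Qed.

Lemma actw_nseq0 (V : lmodType K) (L : seq nat -> V) k : actw L (nseq k 1%N) = L (nseq k 1%N).
Proof. by rewrite -[nseq k _ in LHS]cats0 actw_nseq actw_nil cats0. Qed.

Definition act_fixed p := feqv (gl3_act g p) p.

Lemma fpair_act (V : lmodType K) (L : seq nat -> V) p : fpair L (gl3_act g p) = fpair (actw L) p.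
Proof. exact: fpair_subst. Qed.

Lemma act_fixed_mul p q : act_fixed p -> act_fixed q -> act_fixed (fmul p q).
Proof. by move=> hp hq; apply: feqv_trans (fsubst_mul _ _ _) _; apply: feqv_mul. Qed.

Lemma act_fixed_add p q : act_fixed p -> act_fixed q -> act_fixed (fadd p q).
Proof. by move=> hp hq; apply: feqv_trans (fsubst_add _ _ _) _; apply: feqv_add. Qed.

Lemma act_fixed_cons p ps : act_fixed p -> act_fixed (fsum ps) -> act_fixed (fsum (p :: ps)).
Proof. exact: act_fixed_add. Qed.

Lemma act_fixed_nil : act_fixed (fsum [::]).
Proof. by apply: feqvP => L; rewrite fpair_act !fpair_nil. Qed.

Lemma act_fixed_scale c p : act_fixed p -> act_fixed (fscale c p).
Proof. by move=> hp; apply: feqv_trans (fsubst_scale _ _ _) _; apply: feqv_scale. Qed.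

Lemma act_fixed_exp p m : act_fixed p -> act_fixed (fexp p m).
Proof. by move=> hp; apply: feqv_trans (fsubst_exp _ _ _) _; apply: feqv_exp. Qed.

Lemma act_fixed_eqv p q : feqv p q -> act_fixed q -> act_fixed p.
Proof.
move=> e hq; apply: feqv_trans (fsubst_eqv _ e) _; apply: feqv_trans hq _.
exact: feqv_sym.
Qed.

Lemma act_fixed_x1 : act_fixed (x1 K).
Proof. by apply: feqvP => L; rewrite fpair_act !fpair_var actw_cons act_var1 actw_nil. Qed.

Lemma nseq_cat1 k : nseq k 1%N ++ [:: 1%N] = 1%N :: nseq k 1%N.
Proof. by elim: k => //= k ->. Qed.

Let actE := (actw_cons, actw_nil, actw_nseq, act_var1, act_var2, act_var3).

Lemma act_fixed_alt3 k : act_fixed (alt3 k).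
Proof.
apply: feqvP => L; rewrite fpair_act !fpair_alt3 /= !actE /= nseq_cat1.
rewrite /GRing.scale /=.
by ring.
Qed.

Lemma act_fixed_c12 : act_fixed (c12 K).
Proof.
apply: feqvP => L; rewrite fpair_act !fpair_sub !fpair_mul !fpair_var /= !actE /=.
rewrite /GRing.scale /=; ring.
Qed.

Lemma act_fixed_vv : act_fixed (vv K).
Proof.
apply: act_fixed_add; first by apply/act_fixed_exp/act_fixed_c12.
do 2!apply: act_fixed_scale.
apply: feqvP => L; rewrite fpair_act !fpair_sum !big_cons !big_nil !fpair_scale /=.
rewrite !(fpair_mul, fpair_var, fpair_one) /= !actE /=.
rewrite /GRing.scale /=; ring.
Qed.

(** The three summands are invariant separately; in the middle one the second factor is the
    commutator of a power of [x1] with [x2]. *)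
Lemma act_fixed_w1 m : act_fixed (w1 K m).
Proof.
apply: act_fixed_cons; [|apply: act_fixed_cons; [|apply: act_fixed_cons; [|exact: act_fixed_nil]]].
- by apply: act_fixed_mul; apply: act_fixed_exp; [exact: act_fixed_c12 | exact: act_fixed_x1].
- apply/act_fixed_scale/act_fixed_mul; first exact: act_fixed_c12.
  move: (2 * m).+1 => k; apply: feqvP => L.
  rewrite fpair_act !fpair_sub !(fpair_mul, fpair_x1, fpair_var) /= !actE !actw_nseq0 /= nseq_cat1.
  rewrite /GRing.scale /=; ring.
apply: act_fixed_mul; last by apply/act_fixed_exp/act_fixed_x1.
apply: feqvP => L; rewrite fpair_act !fpair_sum !big_cons !big_nil !fpair_scale /=.
rewrite !(fpair_mul, fpair_var, fpair_one) /= !actE /=.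
rewrite /GRing.scale /=; ring.
Qed.

Lemma act_fixed_w2 m : act_fixed (w2 K m).
Proof.
apply: act_fixed_add; last exact/act_fixed_scale/act_fixed_alt3.
apply: act_fixed_mul; last by apply/act_fixed_exp/act_fixed_x1.
apply: act_fixed_eqv s3_alt3 _; exact: act_fixed_alt3.
Qed.

Lemma act_fixed_s3 : act_fixed (s3 K).
Proof. apply: act_fixed_eqv s3_alt3 _; exact: act_fixed_alt3. Qed.

Lemma act_fixed_hwv m1 m2 l3 : act_fixed (hwv K m1 m2 l3).
Proof.
rewrite /hwv; case: ifP => _; [|case: ifP => _]; apply: act_fixed_mul;
  try apply: act_fixed_exp; try apply: act_fixed_mul; try apply: act_fixed_exp;
  by [apply: act_fixed_s3 | apply: act_fixed_vv | apply: act_fixed_w1 | apply: act_fixed_w2].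
Qed.

End Action.
End Explicit.

(** * The explicit highest weight vectors: values *)

Section Values.
Variable K : fieldType.
Hypothesis charK : [pchar K] =i pred0.
Variables (u1 u2 u3 v1 v2 v3 z1 z2 z3 : K).
Variable a : nat -> 'M[K]_3.
Hypotheses (a1 : a 1%N = sk3 u1 u2 u3) (a2 : a 2%N = sk3 v1 v2 v3) (a3 : a 3%N = sk3 z1 z2 z3).

(** [D] is the determinant of the three vectors, [q] the squared length of the first, and [W] the
    squared length of the cross product of the first two. *)
Notation D := (u1 * (v2 * z3 - v3 * z2) - u2 * (v1 * z3 - v3 * z1) + u3 * (v1 * z2 - v2 * z1)).
Notation q := (u1 ^+ 2 + u2 ^+ 2 + u3 ^+ 2).
Notation W := ((u2 * v3 - u3 * v2) ^+ 2 + (u3 * v1 - u1 * v3) ^+ 2 + (u1 * v2 - u2 * v1) ^+ 2).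
Notation X := (sk3 u1 u2 u3).
Notation Y := (sk3 v1 v2 v3).

Lemma mulmx3E (A B : 'M[K]_3) : A * B = A *m B. Proof. by []. Qed.

Lemma mono_cons i w : mono a (i :: w) = a i * mono a w.
Proof. by rewrite /mono big_cons. Qed.

Lemma mono_nil : mono a [::] = 1.
Proof. by rewrite /mono big_nil. Qed.

Lemma mono_cat w w' : mono a (w ++ w') = mono a w * mono a w'.
Proof. by rewrite /mono big_cat. Qed.

Lemma mono_nseq i k : mono a (nseq k i) = a i ^+ k.
Proof. by elim: k => [|k IH]; rewrite ?mono_nil //= mono_cons IH exprS. Qed.

Lemma feval_alt3 k : feval a (alt3 K k) =
   a 1%N * a 2%N * a 1%N ^+ k * a 3%N - a 2%N * a 1%N * a 1%N ^+ k * a 3%N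
 - a 3%N * a 2%N * a 1%N ^+ k * a 1%N - a 1%N * a 3%N * a 1%N ^+ k * a 2%N
 + a 2%N * a 3%N * a 1%N ^+ k * a 1%N + a 3%N * a 1%N * a 1%N ^+ k * a 2%N.
Proof.
by rewrite fevalE fpair_alt3 !mono_cat !mono_cons !mono_nil !mono_nseq !mulr1 !mulrA.
Qed.

Lemma feval_s3 : feval a (s3 K) = (- 2%:R * D)%:M.
Proof.
rewrite (feval_eqv _ (s3_alt3 K)) feval_alt3 !expr0 !mulr1 a1 a2 a3 !mulmx3E /sk3.
by rewrite !(mk9M, mk9N, mk9D) mk9_scalar; apply: mk9_inj; split; ring.
Qed.

Lemma sk3_comm (x1 x2 x3 y1 y2 y3 : K) :
  sk3 x1 x2 x3 * sk3 y1 y2 y3 - sk3 y1 y2 y3 * sk3 x1 x2 x3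
  = sk3 (x2 * y3 - x3 * y2) (x3 * y1 - x1 * y3) (x1 * y2 - x2 * y1).
Proof.
rewrite !mulmx3E /sk3 !(mk9M, mk9N, mk9D).
by apply: mk9_inj; split; ring.
Qed.

Lemma sk3_sq (x1 x2 x3 : K) :
  sk3 x1 x2 x3 ^+ 2 = mk9 (- (x2 ^+ 2 + x3 ^+ 2)) (x1 * x2) (x1 * x3)
     (x1 * x2) (- (x1 ^+ 2 + x3 ^+ 2)) (x2 * x3) (x1 * x3) (x2 * x3) (- (x1 ^+ 2 + x2 ^+ 2)).
Proof.
by rewrite expr2 mulmx3E /sk3 mk9M; apply: mk9_inj; split; ring.
Qed.

(** Cayley-Hamilton for a skew matrix of order 3. Positive powers of [x1] thus reduce to multiples
    of [X] and [X ^+ 2]. *)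
Lemma sk3_cube : X ^+ 3 = - q *: X.
Proof.
rewrite exprS sk3_sq mulmx3E /sk3 mk9M mk9Z.
by apply: mk9_inj; split; ring.
Qed.

Lemma sk3_odd k : X ^+ (2 * k).+1 = (- q) ^+ k *: X.
Proof.
elim: k => [|k IH]; first by rewrite muln0 expr0 scale1r.
rewrite mulnS -addnS exprD IH -scalerAr [in RHS]exprSr -scalerA; congr (_ *: _).
by rewrite -exprSr sk3_cube.
Qed.

Lemma sk3_even k : X ^+ (2 * k.+1) = (- q) ^+ k *: X ^+ 2.
Proof. by rewrite mulnS add2n exprS sk3_odd -scalerAr -expr2. Qed.

Lemma feval_c12 : feval a (c12 K) = sk3 (u2 * v3 - u3 * v2) (u3 * v1 - u1 * v3) (u1 * v2 - u2 * v1).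
Proof. by rewrite feval_comm !feval_var a1 a2 sk3_comm. Qed.

Lemma sk3_outer (x1 x2 x3 y1 y2 y3 : K) : sk3 x1 x2 x3 * sk3 y1 y2 y3
  = mk9 (- (x2 * y2 + x3 * y3)) (x2 * y1) (x3 * y1) (x1 * y2) (- (x1 * y1 + x3 * y3)) (x3 * y2)
        (x1 * y3) (x2 * y3) (- (x1 * y1 + x2 * y2)).
Proof. by rewrite mulmx3E /sk3 mk9M; apply: mk9_inj; split; ring. Qed.

Lemma feval_vv : feval a (vv K) = (- (2%:R / 3%:R) * W)%:M.
Proof.
have three0 : 3%:R != 0 :> K by apply: natr_neq0.
rewrite /vv feval_sub feval_exp feval_c12 feval_scale feval_sum !big_cons big_nil.
rewrite !(feval_scale, feval_prod) !big_cons !big_nil !feval_var a1 a2 !mulr1.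
rewrite !mulrA -!(mulrA (_ * _)) !sk3_outer sk3_sq !mulmx3E !mk9M !scaleN1r addr0.
rewrite !(mk9N, mk9D, mk9Z) mk9_scalar.
by apply: mk9_inj; split; field.
Qed.


(** What remains of [w1] when its powers of [X] are reduced and the common factor [(- q) ^+ k] is
    removed; the second [C] comes from the commutator of [X] and [Y]. *)
Lemma w1_core (C := sk3 (u2 * v3 - u3 * v2) (u3 * v1 - u1 * v3) (u1 * v2 - u2 * v1)) :
  C ^+ 2 * X ^+ 2 - C * (- q *: C) +
  (X * (X * (X * (Y * Y))) - X * (Y * (X * (Y * X))) - Y * (X * (X * (X * Y)))
    + Y * (Y * (X * (X * X)))) * X = (- (q * W))%:M.
Proof.
rewrite !sk3_outer !sk3_sq !mulmx3E /sk3 !(mk9M, mk9N, mk9D, mk9Z) mk9_scalar.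
by apply: mk9_inj; split; ring.
Qed.

Lemma feval_w1 k : feval a (w1 K k.+1) = ((- q) ^+ k * - (q * W))%:M.
Proof.
have C2 : feval a (fexp (c12 K) 2) = sk3 (u2 * v3 - u3 * v2) (u3 * v1 - u1 * v3) (u1 * v2 - u2 * v1) ^+ 2.
  by rewrite feval_exp feval_c12.
have Xk j : feval a (fexp (x1 K) j) = X ^+ j by rewrite feval_exp feval_var a1.
have eX : feval a (x1 K) = X by rewrite feval_var.
have eY : feval a (x2 K) = Y by rewrite feval_var.
rewrite /w1 feval_sum !big_cons big_nil addr0 feval_mul C2 Xk.
rewrite feval_scale feval_mul feval_c12 feval_sub (feval_mul _ _ (x2 K)) (feval_mul _ (x2 K)) Xk eY.
rewrite feval_mul Xk feval_sum !big_cons big_nil addr0 !(feval_scale, feval_prod) !big_cons !big_nil eX eY.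
rewrite !mulr1 !scaleN1r sk3_even sk3_odd.
rewrite (_ : (2 * k.+1).-1 = (2 * k).+1) ?sk3_odd; last by lia.
rewrite -scale_scalar_mx -w1_core !scalerDr [LHS]addrA; congr (_ + _).
  rewrite -scalerAr; congr (_ + _).
  rewrite scalerN -scalerAr; congr (- _).
  by rewrite -scalerAl -!scalerAr -scalerBr sk3_comm [in LHS]exprSr !scalerAr scalerA.
by rewrite -scalerAr !addrA.
Qed.

(** The case of exponent 2, to which larger even exponents reduce up to a power of [- q]. *)
Lemma w2_core :
  (- 2%:R * D) *: X ^+ 2 + 2%:R *: feval a (alt3 K 2) = (4%:R * D * q)%:M.
Proof.
rewrite feval_alt3 a1 a2 a3 !sk3_sq !sk3_outer -!mulrA.
rewrite /sk3 !mulmx3E !(mk9M, mk9N, mk9D, mk9Z) mk9_scalar.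
by apply: mk9_inj; split; ring.
Qed.

Lemma feval_w2 k : feval a (w2 K k.+1) = ((- q) ^+ k * (4%:R * D * q))%:M.
Proof.
have Xk j : feval a (fexp (x1 K) j) = X ^+ j by rewrite feval_exp feval_var a1.
have alt : feval a (alt3 K (2 * k.+1)) = (- q) ^+ k *: feval a (alt3 K 2).
  rewrite !feval_alt3 a1 sk3_even -!scalerAr -!scalerAl -!scalerN -!scalerDr.
  by [].
rewrite feval_add feval_mul feval_s3 Xk feval_scale -/(alt3 K (2 * k.+1)) alt sk3_even.
rewrite -[in RHS]scale_scalar_mx -w2_core scalerDr; congr (_ + _); last by rewrite !scalerA mulrC.
by rewrite -scalerAr mulmx3E mul_scalar_mx.
Qed.

Definition hwv_value (m1 m2 l3 : nat) : K :=
  if (0 < m1)%N && (0 < m2)%N then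
    (- 2%:R * D) ^+ l3 * ((- (2%:R / 3%:R) * W) ^+ m2.-1 * ((- q) ^+ m1.-1 * - (q * W)))
  else if (0 < m1)%N then (- 2%:R * D) ^+ l3.-1 * ((- q) ^+ m1.-1 * (4%:R * D * q))
  else (- 2%:R * D) ^+ l3 * (- (2%:R / 3%:R) * W) ^+ m2.

Lemma scalar_mxX (c : K) k : (c%:M : 'M[K]_3) ^+ k = (c ^+ k)%:M.
Proof. by rewrite -rmorphXn. Qed.

Lemma feval_hwv m1 m2 l3 : feval a (hwv K m1 m2 l3) = (hwv_value m1 m2 l3)%:M.
Proof.
have sX k : feval a (fexp (s3 K) k) = ((- 2%:R * D) ^+ k)%:M.
  by rewrite feval_exp feval_s3 scalar_mxX.
have vX k : feval a (fexp (vv K) k) = ((- (2%:R / 3%:R) * W) ^+ k)%:M.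
  by rewrite feval_exp feval_vv scalar_mxX.
have mulM (c d : K) : (c%:M : 'M[K]_3) * d%:M = (c * d)%:M.
  by rewrite mulmx3E -scalar_mxM.
rewrite /hwv /hwv_value; case: m1 => [|m1] /=.
  by rewrite feval_mul sX vX mulM.
case: m2 => [|m2] /=; first by rewrite feval_mul sX feval_w2 mulM.
by rewrite feval_mul sX feval_mul vX feval_w1 !mulM.
Qed.

End Values.

Section HwvCentral.
Variable K : fieldType.
Hypothesis charK : [pchar K] =i pred0.

Lemma hwv_central m1 m2 l3 : weak_central (hwv K m1 m2 l3).
Proof.
move=> a sa; rewrite (feval_hwv charK (skew3P charK (sa 1%N)) (skew3P charK (sa 2))
   (skew3P charK (sa 3))).
exact: scalar_mx_is_scalar.
Qed.

(** At the standard basis [D], [q] and [W] all equal 1, which leaves, up to sign, a product of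
    powers of 2, 2/3 and 4. *)
Lemma hwv_at_frame m1 m2 l3 : feval (evX (1%:M : 'M[K]_3)) (hwv K m1 m2 l3) 0 0 != 0.
Proof.
have e (j : nat) (k : 'I_3) : inord j.-1 = k ->
    evX (1%:M : 'M[K]_3) j = sk3 (0 == k)%:R (1 == k)%:R (2%:R == k)%:R.
  by rewrite /evX => ->; rewrite !mxE.
have e1 := e 1%N 0 (inord_val (0 : 'I_3)).
have e2 := e 2%N 1 (inord_val (1 : 'I_3)).
have e3 := e 3%N 2%:R (inord_val (2%:R : 'I_3)).
rewrite (feval_hwv charK e1 e2 e3) mxE eqxx mulr1n /hwv_value /=.
have n2 : 2%:R != 0 :> K by apply: natr_neq0.
have n3 : 3%:R != 0 :> K by apply: natr_neq0.
have n4 : 4%:R != 0 :> K by apply: natr_neq0.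
rewrite !(mulr0, mul0r, mulr1, mul1r, subr0, sub0r, addr0, add0r, expr0n, expr1n, oppr0) /=.
by do 2?[case: ifP => _]; rewrite ?(mulf_neq0, expf_neq0, oppr_eq0, oner_eq0, invr_neq0).
Qed.

End HwvCentral.

(** * Weights and linearisation *)

Section Homogeneous.
Variable K : fieldType.
Implicit Types p q : fpoly K.

(** A condition on the listed terms, before any cancellation, so that concrete polynomials are
    checked by computation. *)
Definition hom (l1 l2 l3 : nat) p := all (fun t => [&& all (fun i => i \in [:: 1; 2; 3]%N) t.2,
  count_mem 1%N t.2 == l1, count_mem 2%N t.2 == l2 & count_mem 3%N t.2 == l3]) p.

Lemma hom_add l1 l2 l3 p q : hom l1 l2 l3 p -> hom l1 l2 l3 q -> hom l1 l2 l3 (fadd p q).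
Proof. by move=> hp hq; rewrite /hom all_cat; apply/andP. Qed.

Lemma hom_scale l1 l2 l3 c p : hom l1 l2 l3 p -> hom l1 l2 l3 (fscale c p).
Proof. by rewrite /hom all_map. Qed.

Lemma hom_mul l1 l2 l3 m1 m2 m3 p q :
  hom l1 l2 l3 p -> hom m1 m2 m3 q -> hom (l1 + m1) (l2 + m2) (l3 + m3) (fmul p q).
Proof.
move=> /allP hp /allP hq; apply/allP => t /allpairsP[[t1 t2] /= [/hp h1 /hq h2 ->]] /=.
rewrite all_cat !count_cat; case/and4P: h1 => -> /eqP-> /eqP-> /eqP->.
by case/and4P: h2 => -> /eqP-> /eqP-> /eqP->; rewrite !eqxx.
Qed.

Lemma hom_one : hom 0 0 0 (fone K). Proof. by []. Qed.

Lemma hom_exp l1 l2 l3 p m : hom l1 l2 l3 p -> hom (m * l1) (m * l2) (m * l3) (fexp p m).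
Proof.
by move=> hp; elim: m => [|m IH]; [exact: hom_one | rewrite !mulSn; apply: hom_mul].
Qed.

Lemma hom_sum l1 l2 l3 (ps : seq (fpoly K)) :
  (forall p, p \in ps -> hom l1 l2 l3 p) -> hom l1 l2 l3 (fsum ps).
Proof.
elim: ps => // p ps IH h; apply: hom_add; first by apply: h; rewrite inE eqxx.
by apply: IH => q qs; apply: h; rewrite inE qs orbT.
Qed.

Lemma hom_x1 m : hom m 0 0 (fexp (x1 K) m).
Proof. by have := @hom_exp 1 0 0 (x1 K) m isT; rewrite muln1 muln0. Qed.

Lemma hom_eq l1 l2 l3 m1 m2 m3 p : hom m1 m2 m3 p -> l1 = m1 -> l2 = m2 -> l3 = m3 -> hom l1 l2 l3 p.
Proof. by move=> h -> -> ->. Qed.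

Lemma hom_alt3 m : hom m.+1 1 1 (alt3 K m).
Proof.
apply: hom_sum => p /mapP[s _ ->]; apply: hom_scale => /=.
have inj i j : i != j -> s i != s j by rewrite (inj_eq perm_inj).
have n01 := inj 0 1 isT; have n02 := inj 0 2%:R isT; have n12 := inj 1 2%:R isT.
pose d (k : nat) (i : 'I_3) := (i.+1 == k : nat).
have hx i : hom (d 1%N i) (d 2 i) (d 3 i) (xo K i).
  by rewrite /hom /= /d !addn0 !eqxx; elim/forall_ord3: i.
have := hom_mul (hx (s 0)) (hom_mul (hx (s 1)) (hom_mul (hom_x1 m) (hom_mul (hx (s 2%:R)) hom_one))).
move=> h; apply: (hom_eq h); rewrite /d; move: n01 n02 n12 {h};
  elim/forall_ord3: (s 0); elim/forall_ord3: (s 1); elim/forall_ord3: (s 2%:R) => //= _ _ _; lia.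
Qed.

Lemma hom_s3 : hom 1 1 1 (s3 K).
Proof.
apply: hom_sum => p /mapP[s _ ->]; apply: hom_scale => /=.
have inj i j : i != j -> s i != s j by rewrite (inj_eq perm_inj).
have n01 := inj 0 1 isT; have n02 := inj 0 2%:R isT; have n12 := inj 1 2%:R isT.
rewrite /hom /=; move: n01 n02 n12.
by elim/forall_ord3: (s 0); elim/forall_ord3: (s 1); elim/forall_ord3: (s 2%:R).
Qed.

Lemma hom_vv : hom 2 2 0 (vv K). Proof. by []. Qed.

Lemma hom_w1 m : (0 < m)%N -> hom (2 * m + 2) 2 0 (w1 K m).
Proof.
move=> m0; apply: hom_add; last apply: hom_add; last apply: hom_add => //.
- by apply: (hom_eq (hom_mul (_ : hom 2 2 0 (fexp (c12 K) 2)) (hom_x1 _))) => //; lia.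
- apply: hom_scale.
  have hx2 : hom 0 1 0 (x2 K) by [].
  have hc : hom 1 1 0 (c12 K) by [].
  apply: (hom_eq (hom_mul hc (_ : hom (2 * m).+1 1 0 _))) => //; last by lia.
  apply: hom_add; last apply: hom_scale.
    by apply: (hom_eq (hom_mul (hom_x1 _) hx2)) => //; lia.
  by apply: (hom_eq (hom_mul hx2 (hom_x1 _))) => //; lia.
apply: (hom_eq (hom_mul (_ : hom 3 2 0 _) (hom_x1 _))) => //; lia.
Qed.

Lemma hom_w2 m : hom (2 * m + 1) 1 1 (w2 K m).
Proof.
apply: hom_add; last by apply: hom_scale; apply: (hom_eq (hom_alt3 _)) => //; lia.
by apply: (hom_eq (hom_mul hom_s3 (hom_x1 _))) => //; lia.
Qed.

Lemma hom_hwv m1 m2 l3 : (0 < m2 + l3)%N ->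
  hom (2 * (m1 + m2) + l3) (2 * m2 + l3) l3 (hwv K m1 m2 l3).
Proof.
move=> h; rewrite /hwv; case: ifP => [/andP[h1 h2]|].
  apply: (hom_eq (hom_mul (hom_exp l3 hom_s3) (hom_mul (hom_exp m2.-1 hom_vv) (hom_w1 h1)))); nia.
case: ifP => [h1 /negbT|/negbT h1 _].
  rewrite /= -leqNgt leqn0 => /eqP m20.
  by apply: (hom_eq (hom_mul (hom_exp l3.-1 hom_s3) (hom_w2 m1))); nia.
by apply: (hom_eq (hom_mul (hom_exp l3 hom_s3) (hom_exp m2 hom_vv))); nia.
Qed.

Lemma fcoef_mem p w : fcoef p w != 0 -> w \in [seq t.2 | t <- p].
Proof.
apply: contraNT => nw; rewrite /fcoef big_seq_cond big1 // => t /andP[tp /eqP e].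
by case/negP: nw; rewrite -e; apply: map_f.
Qed.

Lemma feval_supp (a b : nat -> 'M[K]_3) p c :
  (forall w, fcoef p w != 0 -> mono a w = c *: mono b w) -> feval a p = c *: feval b p.
Proof.
move=> h; pose W := undup [seq t.2 | t <- p].
have sub : {subset [seq t.2 | t <- p] <= W} by move=> w; rewrite mem_undup.
rewrite !fevalE !(@fpair_coef _ _ _ _ W) ?undup_uniq // scaler_sumr.
apply: eq_bigr => w _; have [->|/h ->] := eqVneq (fcoef p w) 0; first by rewrite !scale0r scaler0.
by rewrite !scalerA mulrC.
Qed.

Lemma fcoef_neq0 (a : nat -> 'M[K]_3) p : feval a p != 0 -> exists w, fcoef p w != 0.
Proof.
move=> nz; have [/hasP[t _ ht]|/hasPn h] := boolP (has (fun t => fcoef p t.2 != 0) p).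
  by exists t.2.
case/eqP: nz; rewrite (@feval_supp a a p 0) ?scale0r // => w nw.
have /mapP[t tp e] := fcoef_mem nw.
by have := h t tp; rewrite -e nw.
Qed.

End Homogeneous.

(** * Highest weight vectors as functions on matrices, and their uniqueness *)

Section HighestWeightPolynomial.
Variable K : fieldType.
Hypothesis charK : [pchar K] =i pred0.
Variables l1 l2 l3 : nat.

Lemma hwv_highest m1 m2 l3' : (0 < m2 + l3')%N ->
  hw_vector (2 * (m1 + m2) + l3') (2 * m2 + l3') l3' (hwv K m1 m2 l3').
Proof.
move=> h; split.
- apply: (@fcoef_neq0 _ (evX 1%:M)); apply: contra_neq (hwv_at_frame charK m1 m2 l3') => ->.
  by rewrite mxE.
- move=> w /fcoef_mem/mapP[t tp ->].
  by have /allP/(_ t tp)/and4P[? /eqP ? /eqP ? /eqP ?] := hom_hwv K m1 h.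
by move=> g ug w; apply: act_fixed_hwv.
Qed.

Definition fval (p : fpoly K) (X : 'M[K]_3) : K := feval (evX X) p 0 0.

Lemma fval_line p X Y : exists P : {poly K}, forall t, fval p (X + t *: Y) = P.[t].
Proof.
have [P hP] := feval_line (evX X) (evX Y) p; exists P => t.
by rewrite -hP /fval; congr (fun_of_matrix _ 0 0); apply: eq_feval => j; apply: evX_line.
Qed.

Lemma fval_central p X : weak_central p -> feval (evX X) p = (fval p X)%:M.
Proof.
move=> h; have /is_scalar_mxP[s es] := h (evX X) (fun j => skew_evX X j).
by rewrite /fval es mxE eqxx.
Qed.

Lemma fval_rot p (x y z : K) X : weak_central p -> x ^+ 2 + y ^+ 2 + z ^+ 2 != 0 ->
  fval p (rotmx x y z *m X) = fval p X.
Proof.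
move=> h nz; rewrite /fval (eq_feval _ (fun j => rot_evX X j nz)) feval_conj ?rotmxK //.
by rewrite fval_central // -scalemx1 -scalerAr -scalerAl mulr1 rotmxK // scalemx1.
Qed.

Section Weights.
Variable p : fpoly K.
Hypothesis hp : hw_vector l1 l2 l3 p.

Lemma hw_letters w : fcoef p w != 0 -> forall j, j \in w -> j \in [:: 1; 2; 3]%N.
Proof. by case: hp => _ h _ /h[/allP]. Qed.

(** Right multiplication of [X] by [g] forms exactly the combinations of columns that [gl3_act g]
    substitutes for the variables. *)
Lemma fval_uni g X : unipotent_upper g -> feval (evX (X *m g)) p = feval (evX X) p.
Proof.
move=> ug; have fix_p : feqv (gl3_act g p) p by case: hp => _ _; apply.
rewrite -[RHS](feval_eqv _ fix_p) feval_subst -[RHS]scale1r; apply: feval_supp => w nw.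
rewrite scale1r; apply: eq_big_seq => j jw.
have := hw_letters nw jw; rewrite !inE => hj.
rewrite /gl3_var; have -> : (0 < j <= 3)%N by lia.
have -> : [seq (g (inord i) (inord j.-1), [:: i.+1]) | i <- iota 0 3]
   = [:: (g 0 (inord j.-1), [:: 1%N]); (g 1 (inord j.-1), [:: 2%N]); (g 2%:R (inord j.-1), [:: 3%N])].
  by rewrite /=; congr [:: (g _ _, _); (g _ _, _); (g _ _, _)]; apply: val_inj; rewrite /= inordK.
rewrite fevalE !fpair_cons fpair_nil /mono !big_seq1 addr0 /=.
have e (k : 'I_3) : inord k = k by apply: inord_val.
rewrite /evX /= (e 0) (e 1) (e 2%:R) !mxE !sum_ord3 /sk3 !mk9Z !mk9D.
by apply: mk9_inj; split; ring.
Qed.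

Lemma fval_tor a b c X :
  fval p (X *m mk9 a 0 0 0 b 0 0 0 c) = a ^+ l1 * b ^+ l2 * c ^+ l3 * fval p X.
Proof.
have -> : fval p (X *m mk9 a 0 0 0 b 0 0 0 c)
    = ((a ^+ l1 * b ^+ l2 * c ^+ l3) *: feval (evX X) p) 0 0; last by rewrite mxE.
congr (fun_of_matrix _ 0 0); apply: feval_supp => w nw.
have lt := hw_letters nw; case: (hp) => _ /(_ w nw)[_ <- <- <-] _.
pose d (j : nat) : K := nth 0 [:: a; a; b; c] j.
have ed j : j \in w -> evX (X *m mk9 a 0 0 0 b 0 0 0 c) j = d j *: evX X j.
  move/lt; rewrite !inE /d => /or3P[] /eqP -> /=; rewrite /evX /=.
  - rewrite (inord_val (0 : 'I_3)) !mxE !sum_ord3 !mxE /= /sk3 mk9Z.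
    by apply: mk9_inj; split; ring.
  - rewrite (inord_val (1 : 'I_3)) !mxE !sum_ord3 !mxE /= /sk3 mk9Z.
    by apply: mk9_inj; split; ring.
  rewrite (inord_val (2%:R : 'I_3)) !mxE !sum_ord3 !mxE /= /sk3 mk9Z.
  by apply: mk9_inj; split; ring.
rewrite /mono (eq_big_seq _ ed) scaler_prod; congr (_ *: _).
elim: (w) lt => [|j w' IH] lt /=; first by rewrite big_nil !expr0 !mulr1.
rewrite big_cons IH => [|k kw]; last by apply: lt; rewrite inE kw orbT.
have := lt j; rewrite inE eqxx => /(_ isT); rewrite /d !inE => /or3P[] /eqP -> /=;
  by rewrite !(add0n, add1n) exprS; ring.
Qed.

End Weights.

Lemma skew_columns (a : nat -> 'M[K]_3) : (forall i, skew3 (a i)) ->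
  exists X, forall j, j \in [:: 1; 2; 3]%N -> a j = evX X j.
Proof.
move=> sa; exists (\matrix_(i, k < 3) nth 0 [:: a k.+1 2%:R 1; a k.+1 0 2%:R; a k.+1 1 0] i).
move=> j; rewrite !inE => hj; rewrite [LHS](skew3P charK) // /evX !mxE /=.
by rewrite inordK; last lia; rewrite prednK //; lia.
Qed.

(** The combination of [f] and [w] that vanishes at the identity matrix inherits rotation invariance
    and weight, hence vanishes everywhere by [highest_weight_vanish]. *)
Lemma highest_weight_unique (f w : fpoly K) :
  weak_central f -> hw_vector l1 l2 l3 f -> weak_central w -> hw_vector l1 l2 l3 w ->
  fval w 1%:M != 0 -> exists c : K, weak_identity (fsub f (fscale c w)).
Proof.
move=> cf hf cw hw nz; pose c := fval f 1%:M / fval w 1%:M; exists c.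
pose G X := fval f X - c * fval w X.
have G0 X : G X = 0.
  apply: (@highest_weight_vanish _ charK G l1 l2 l3).
  - move=> Y Z; have [P hP] := fval_line f Y Z; have [Q hQ] := fval_line w Y Z.
    by exists (P - c *: Q) => t; rewrite /G hP hQ !hornerE.
  - by move=> x y z Y nN; rewrite /G !fval_rot.
  - by move=> g Y ug; rewrite /G /fval !fval_uni.
  - by move=> x y z Y; rewrite /G !fval_tor //; ring.
  by rewrite /G /c divfK // subrr.
move=> a sa; have [X eX] := skew_columns sa.
have e p : hw_vector l1 l2 l3 p -> feval a p = feval (evX X) p.
  move=> hp; rewrite -[RHS]scale1r; apply: feval_supp => u nu; rewrite scale1r.
  by apply: eq_big_seq => j /(hw_letters hp nu); apply: eX.
rewrite feval_sub feval_scale !e // !fval_central // scale_scalar_mx -raddfB /=.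
by have := G0 X; rewrite /G => ->; rewrite raddf0.
Qed.

End HighestWeightPolynomial.

(** * Linearisation of a highest weight vector *)

Section Linearisation.
Variables (K : fieldType) (n : nat).
Hypothesis charK : [pchar K] =i pred0.
Variables l1 l2 l3 : nat.
Hypothesis sh : shape3 n l1 l2 l3.
Variable f : fpoly K.
Hypotheses (hf : hw_vector l1 l2 l3 f) (cf : weak_central f).
Notation rho := (Rreg K).
Notation row := (@rowf n l1 l2).
Implicit Types (s p : {perm 'I_n}).

Definition rword s : seq nat := [seq (row (s i)).+1 | i <- enum 'I_n].

(** The full linearisation: a monomial gets the coefficient of the word in which each variable is
    replaced by the letter of its row. Identifying variables along rows returns [f] times the order
    of the row stabiliser ([Phi_lin]). *)
Definition lin : 'rV[K]_(Nn n) := \row_i fcoef f (rword (Defs.perm_of i)).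

Lemma linE s : lin 0 (rk s) = fcoef f (rword s).
Proof. by rewrite mxE perm_of_rank. Qed.

Lemma lin_inv p : stab row p -> lin *m rho p = lin.
Proof.
move=> sp; apply/rowP => i; rewrite -[i]rank_perm_of mul_rho !linE; congr fcoef.
apply: eq_map => j; rewrite permM; congr (nat_of_ord _).+1.
exact: (stabP _ _ (stabV sp)).
Qed.

(** The permutations producing a given word of the right weight form a coset of the row
    stabiliser. *)
Lemma card_rword w : fcoef f w != 0 -> #|[pred s | rword s == w]| = #|stab row|.
Proof.
move=> nw; case: (hf) => _ /(_ w nw)[/allP lt e1 e2 e3] _.
have [/eqP en _ _] := and3P sh.
have sz : size w = n.
  rewrite -en -e1 -e2 -e3; elim: (w) lt => //= j w' IH lt.
  rewrite IH => [|k kw]; last by apply: lt; rewrite inE kw orbT.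
  by have := lt j; rewrite inE eqxx => /(_ isT); rewrite !inE => /or3P[] /eqP -> /=; lia.
pose c (i : 'I_n) : 'I_3 := inord (nth 0%N w i).-1.
have wE : w = [seq (c i).+1 | i <- enum 'I_n].
  apply: (@eq_from_nth _ 0%N); first by rewrite size_map size_enum_ord.
  move=> i; rewrite sz => li; rewrite (nth_map (Ordinal li)) ?size_enum_ord //.
  have /= -> := nth_ord_enum (Ordinal li) (Ordinal li); rewrite /c /=.
  have := lt _ (mem_nth 0%N (_ : i < size w)%N); rewrite sz => /(_ li).
  by rewrite !inE => /or3P[] /eqP ->; rewrite /= inordK.
have [|s0 hs0] := @match_sizes n 3 row c.
  have cnt (k : 'I_3) : fsz c k = count_mem k.+1 w.
    rewrite wE count_map /fsz cardE [in LHS]/enum_mem -enumT size_filter.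
    by apply: eq_count => i /=; rewrite inE eqSS.
  by move=> k; rewrite (fsz_rowf sh) cnt; elim/forall_ord3: k; rewrite /= ?e1 ?e2 ?e3.
have ws s : (rword s == w) = [forall i, row (s i) == c i].
  apply/eqP/forallP => [e i|h]; last by rewrite wE; apply: eq_map => i; rewrite (eqP (h i)).
  by move: e; rewrite wE => /eq_in_map/(_ i (mem_enum _ i))[] e'; apply/eqP/val_inj.
rewrite -!sum1_card (reindex_inj (mulgI s0)) /=; apply: eq_bigl => s; rewrite !inE ws.
apply/forallP/stabP => [h i|h i]; last by rewrite permM h hs0.
by have := h (s0^-1 i)%g; rewrite permM permKV -hs0 permKV => /eqP.
Qed.

Lemma Phi_lin (z : 'I_3 -> 'M[K]_3) :
  Phi (fun i => z (row i)) lin = #|stab row|%:R *: feval (fun j => z (inord j.-1)) f.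
Proof.
pose L := mono (fun j => z (inord j.-1)).
have eL s : \prod_i z (row (s i)) = L (rword s).
  rewrite /L /mono /rword big_map [index_enum _]unlock enumT.
  by apply: eq_bigr => i _; rewrite -[in LHS](inord_val (row (s i))).
pose W := undup ([seq t.2 | t <- f] ++ [seq rword s | s <- enum {perm 'I_n}]).
have Wr s : rword s \in W by rewrite mem_undup mem_cat map_f ?orbT // mem_enum.
rewrite fevalE (@fpair_coef _ _ _ _ W) ?undup_uniq //; last first.
  by move=> w; rewrite mem_undup mem_cat => ->.
rewrite scaler_sumr /Phi.
transitivity (\sum_s \sum_(w <- W) if rword s == w then fcoef f w *: L w else 0).
  apply: eq_bigr => s _; rewrite linE eL (bigD1_seq (rword s)) ?undup_uniq //= eqxx big1 ?addr0 //.
  by move=> w; rewrite eq_sym => /negPf ->.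
rewrite exchange_big; apply: eq_bigr => w _ /=.
rewrite -big_mkcond /= sumr_const.
have [->|nw] := eqVneq (fcoef f w) 0; first by rewrite !scale0r mul0rn scaler0.
by rewrite card_rword // scaler_nat.
Qed.

Lemma lin_Asym : lin *m Asym K n l1 l2 = #|stab row|%:R *: lin.
Proof. by apply: rsym_fix => p /lin_inv ->; rewrite scale1r. Qed.

Let stab_neq0 : #|stab row|%:R != 0 :> K.
Proof. by apply: natr_neq0 => //; apply: card_stab_gt0. Qed.

Lemma lin_central : wcent lin.
Proof.
suff h : wcent (lin *m Asym K n l1 l2).
  have -> : lin = #|stab row|%:R^-1 *: (lin *m Asym K n l1 l2) + 0.
    by rewrite addr0 lin_Asym scalerA mulVf // scale1r.
  by apply: wcent_lin => //; apply: wcent0.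
move=> y sy; apply: (@polarization_ind _ _ _ _ _ (fun M => is_scalar_mx M)) => //.
- exact: is_scalar_mx0.
- exact: is_scalar_mxD.
- exact: is_scalar_mxZ.
by move=> z sz; rewrite Phi_lin; apply/is_scalar_mxZ/cf => i; apply: sz.
Qed.

Lemma Phi_line (u y : 'I_n -> 'M[K]_3) v (t : K) :
  Phi (fun i => t *: y i + u i) v
  = \sum_(S : {set 'I_n}) t ^+ #|S| *: Phi (fun i => if i \in S then y i else u i) v.
Proof.
rewrite /Phi; under [RHS]eq_bigr do rewrite scaler_sumr.
rewrite exchange_big /=; apply: eq_bigr => s _.
have -> : \prod_i (t *: y (s i) + u (s i)) =
   \sum_(J : {set 'I_n}) \prod_i (if i \in J then t *: y (s i) else u (s i)).
  have := bigA_distr (1 : 'M[K]_3) (@GRing.add 'M[K]_3) (fun i => t *: y (s i)) (fun i => u (s i)).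
  by move=> /= ->; apply: eq_bigl => J; rewrite inE.
rewrite scaler_sumr (reindex (fun J : {set 'I_n} => s @^-1: J)) /=; last first.
  exists (fun J : {set 'I_n} => s @: J) => J _.
    by apply/setP => i; rewrite -(permKV s i) (mem_imset _ _ perm_inj) inE.
  by apply/setP => i; rewrite inE (mem_imset _ _ perm_inj).
apply: eq_bigr => J _; rewrite scalerA mulrC -scalerA; congr (_ *: _).
have -> : t ^+ #|J| = \prod_i (if i \in s @^-1: J then t else 1).
  rewrite -big_mkcond /= prodr_const; congr (_ ^+ _).
  by rewrite -(card_imset (s @^-1: J) (@perm_inj _ s)); apply: eq_card => i;
    rewrite -(permKV s i) (mem_imset _ _ perm_inj) inE.
rewrite -scaler_prod; apply: eq_bigr => i _; rewrite inE.
by case: ifP; rewrite ?scale1r.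
Qed.

(* Substituting [x_d + t x_c] for [x_d] does not change the polynomial; the coefficient of
   [t] in its linearisation is a sum of equal terms. *)
Lemma lin_garnir (c d : 'I_3) (k : 'I_n) : (c < d)%N -> row k = d ->
  wid (lin *m rsym K false (recolor row k c)).
Proof.
move=> cd kd y sy; apply: (@polarization_ind _ _ _ _ _ (fun M => M = 0)) => //.
- by move=> A B -> ->; rewrite addr0.
- by move=> a A ->; rewrite scaler0.
move=> {y sy} z sz.
have ndc : d != c by apply: contraTneq cd => ->; rewrite ltnn.
pose y (i : 'I_n) := if row i == d then z c else 0.
pose zt t (r : 'I_3) := if r == d then t *: z c + z d else z r.
have ezt t i : t *: y i + z (row i) = zt t (row i).
  by rewrite /y /zt; case: eqP => [->|_]; rewrite ?scaler0 ?add0r.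
(* The substitution adds [t] times column [c] to column [d], which is right multiplication by a
   unipotent upper triangular matrix because [c < d]. *)
have const t : feval (fun j => zt t (inord j.-1)) f = feval (fun j => z (inord j.-1)) f.
  have [X colz] : exists X : 'M[K]_3, forall r, z r = sk3 (X 0 r) (X 1 r) (X 2%:R r).
    exists (\matrix_(i, r < 3) nth 0 [:: z r 2%:R 1; z r 0 2%:R; z r 1 0] i) => r.
    by rewrite !mxE; apply: skew3P.
  have eX j : z (inord j.-1) = evX X j by apply: colz.
  pose g : 'M[K]_3 := 1%:M + t *: delta_mx c d.
  have ug : unipotent_upper g.
    move=> i j; split=> [ji|->]; rewrite !mxE.
      have -> : (i == j) = false by apply: contraTF ji => /eqP ->; rewrite ltnn.
      case: andP => [[/eqP ei /eqP ej]|]; last by rewrite mulr0 addr0.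
      by move: ji cd; rewrite ei ej; lia.
    rewrite eqxx; case: andP => [[/eqP e1 /eqP e2]|]; last by rewrite mulr0 addr0.
    by case/eqP: ndc; rewrite -e1.
  rewrite (eq_feval _ eX) -(fval_uni hf X ug); apply: eq_feval => j.
  have col i : (X *m g) i (inord j.-1)
      = X i (inord j.-1) + t * (X i c * (inord j.-1 == d)%:R).
    rewrite mulmxDr mulmx1 -scalemxAr !mxE; congr (_ + _ * _).
    rewrite (bigD1 c) //= mxE eqxx /= big1 ?addr0 // => r nr.
    by rewrite mxE (negPf nr) mulr0.
  rewrite /zt /evX !col; case: eqP => [->|_].
    by rewrite !colz !mulr1 /sk3 mk9Z mk9D; apply: mk9_inj; split; ring.
  by rewrite !mulr0 !addr0 eX.
pose cS (S : {set 'I_n}) : K := Phi (fun i => if i \in S then y i else z (row i)) lin 0 0.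
pose P : {poly K} := \sum_(S : {set 'I_n}) cS S *: 'X^#|S|.
have hP t : P.[t] = Phi (fun i => z (row i)) lin 0 0.
  rewrite [RHS](_ : _ = Phi (fun i => t *: y i + z (row i)) lin 0 0).
    rewrite Phi_line summxE horner_sum; apply: eq_bigr => S _.
    by rewrite hornerZ hornerXn mxE mulrC.
  by rewrite (eq_Phi _ (ezt t)) !Phi_lin const.
have P1 : P`_1 = 0.
  have -> : P = (Phi (fun i => z (row i)) lin 0 0)%:P.
    by apply/eqP; rewrite -subr_eq0; apply/eqP/(poly_zero charK) => t; rewrite !hornerE hP subrr.
  by rewrite coefC.
(* By row symmetry every point of row [d] contributes the same amount as [k]. *)
have single i : cS [set i] = (if row i == d then Phi (fun j => z (recolor row k c j)) lin 0 0 else 0).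
  case: ifPn => [/eqP id|nd]; last first.
    rewrite /cS (_ : Phi _ _ = 0) ?mxE //; rewrite /Phi big1 // => s _.
    rewrite (_ : \prod_j _ = 0) ?scaler0 //.
    have -> : \prod_j (if s j \in [set i] then y (s j) else z (row (s j)))
       = \prod_j ((s j != i)%:R *: (if s j \in [set i] then y (s j) else z (row (s j)))).
      apply: eq_bigr => j _; rewrite inE; case: eqP => [->|_]; last by rewrite scale1r.
      by rewrite /y (negPf nd) scaler0.
    rewrite scaler_prod (bigD1 (s^-1 i)%g) //= permKV eqxx mul0r scale0r //.
  rewrite /cS -[in RHS](lin_inv (stab_tperm (_ : row i = row k))); last by rewrite id kd.
  rewrite Phi_rho; congr (fun_of_matrix _ 0 0); apply: eq_Phi => j /=.
  rewrite inE /recolor; case: tpermP => [->|->|ni nk].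
  - by rewrite !eqxx /y id eqxx.
  - by case: eqVneq => _; rewrite /= ?/y ?id kd ?eqxx.
  by rewrite (introF eqP ni) (introF eqP nk).
have : P`_1 = (fsz row d)%:R * Phi (fun j => z (recolor row k c j)) lin 0 0.
  rewrite /P coef_sum.
  rewrite (bigID (fun S : {set 'I_n} => #|S| == 1)%N) /= [X in _ + X]big1 ?addr0 => [|S nS].
    rewrite (eq_bigr (fun S => cS S)) => [|S /eqP hS]; last first.
      by rewrite coefZ coefXn hS eqxx mulr1.
    rewrite (reindex_onto (fun i : 'I_n => [set i]) (fun S : {set 'I_n} => odflt k [pick i in S])) /=.
      rewrite (eq_bigl xpredT) => [|i]; last first.
        rewrite cards1 eqxx /=; case: pickP => [j|/(_ i)]; rewrite !inE ?eqxx //=.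
      rewrite (eq_bigr _ (fun i _ => single i)) -big_mkcond /= sumr_const mulr_natl.
      by congr (_ *+ _); apply: eq_card => i; rewrite !inE.
    move=> S /cards1P[i ->]; case: pickP => [j|/(_ i)]; rewrite !inE ?eqxx //=.
    by move=> /eqP ->.
  by rewrite coefZ coefXn eq_sym (negPf nS) mulr0.
rewrite P1 => /esym/eqP; rewrite mulf_eq0 => /orP[|/eqP e0].
  have fd : (0 < fsz row d)%N by apply/card_gt0P; exists k; rewrite inE kd.
  by rewrite (negPf (natr_neq0 charK fd)).
have /is_scalar_mxP[a ea] : is_scalar_mx (Phi (fun j => z (recolor row k c j)) lin).
  by apply: lin_central => i; apply: sz.
by move: e0; rewrite ea mxE eqxx mulr1n => ->; rewrite raddf0.
Qed.

End Linearisation.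

(** * Subspaces, traces and complete reducibility *)

Section Subspace.
Variables (K : fieldType) (m : nat) (P : 'rV[K]_m -> Prop).
Hypotheses (P0 : P 0) (Plin : forall a v w, P v -> P w -> P (a *: v + w)).

(** Vectors are adjoined as long as one is missing, at most [m] times; [P] is an arbitrary
    proposition, so the case split is classical. *)
Lemma subspace_mx : exists U : 'M[K]_m, forall v, (v <= U)%MS <-> P v.
Proof.
suff ext k (U : 'M[K]_m) : (forall v : 'rV_m, (v <= U)%MS -> P v) -> (m - \rank U <= k)%N ->
    exists U : 'M[K]_m, forall v, (v <= U)%MS <-> P v.
  by apply: (ext m 0) => [v|]; [rewrite submx0 => /eqP -> | rewrite leq_subr].
elim: k U => [|k IH] U hU rk.
  exists U => v; split=> [/hU //|_]; apply: submx_full; rewrite /row_full eqn_leq rank_leq_col.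
  by rewrite -subn_eq0 -leqn0.
have [[v [Pv nv]]|no] := classic (exists v, P v /\ ~ (v <= U)%MS); last first.
  exists U => v; split=> [/hU //|Pv]; apply: NNPP => nv; apply: no; by exists v.
apply: (IH (U + v)%MS) => [w /sub_addsmxP[[a b] /= ->]|].
  rewrite addrC [b]mx11_scalar mul_scalar_mx; apply: Plin => //.
  by apply: hU; apply: submxMl.
have : (\rank U < \rank (U + v)%MS)%N.
  suff: (U < U + v)%MS by rewrite ltmxErank => /andP[].
  rewrite /ltmx addsmxSl /=; by apply/negP; rewrite addsmx_sub => /andP[_ /nv].
by have := rank_leq_col (U + v)%MS; lia.
Qed.

Lemma spanmxP v : (v <= spanmx P)%MS <-> P v.
Proof. by rewrite /spanmx; apply: (epsilon_spec (inhabits 0) _ subspace_mx). Qed.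

End Subspace.

Section TraceRestr.
Variables (K : fieldType) (m : nat).
Implicit Types (U V A : 'M[K]_m).

(** Any basis of the row space may replace [row_base U], since the two coordinate matrices are
    conjugate. *)
Lemma tr_restr_basis r (X : 'M[K]_(r, m)) (D : 'M[K]_r) U A :
  row_free X -> (X :=: U)%MS -> X *m A = D *m X -> tr_restr U A = \tr D.
Proof.
move=> fX eX eD; rewrite /tr_restr.
have [P eP] : exists P, row_base U = P *m X by apply/submxP; rewrite eq_row_base eX.
have [Q eQ] : exists Q, X = Q *m row_base U by apply/submxP; rewrite eX eq_row_base.
have QP : Q *m P = 1%:M by apply: (row_free_inj fX); rewrite -mulmxA -eP -eQ mul1mx.
have -> : row_base U *m A = P *m D *m Q *m row_base U.
  by rewrite {1}eP -mulmxA eD -!mulmxA -eQ.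
rewrite -mulmxA mulmxVp ?row_base_free // mulmx1 mxtrace_mulC mulmxA QP.
by rewrite mul1mx.
Qed.

Lemma stable_coef U A : (U *m A <= U)%MS ->
  exists D, row_base U *m A = D *m row_base U.
Proof.
move=> st; exists (row_base U *m A *m pinvmx (row_base U)); rewrite mulmxKpV //.
rewrite eq_row_base; apply: submx_trans st; apply: submxMr.
by rewrite eq_row_base.
Qed.

Lemma tr_restr_coef U A D : row_base U *m A = D *m row_base U -> tr_restr U A = \tr D.
Proof. by apply: tr_restr_basis; [exact: row_base_free | exact: eq_row_base]. Qed.

Lemma tr_restr_eq U V A : (U *m A <= U)%MS -> (U :=: V)%MS -> tr_restr U A = tr_restr V A.
Proof.
move=> st e; have [D eD] := stable_coef st; rewrite (tr_restr_coef eD).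
apply/esym/(tr_restr_basis _ _ eD); first exact: row_base_free.
exact: eqmx_trans (eq_row_base U) e.
Qed.

Lemma tr_restr_add U V A : (U *m A <= U)%MS -> (V *m A <= V)%MS -> (U :&: V = 0)%MS ->
  tr_restr (U + V)%MS A = tr_restr U A + tr_restr V A.
Proof.
move=> sU sV UV; have [D eD] := stable_coef sU; have [E eE] := stable_coef sV.
rewrite (tr_restr_coef eD) (tr_restr_coef eE) -(mxtrace_block D 0 0 E).
have eX : (col_mx (row_base U) (row_base V) :=: U + V)%MS.
  apply: eqmx_trans (eqmx_sym (addsmxE _ _)) _.
  by apply: adds_eqmx; apply: eq_row_base.
apply: (tr_restr_basis _ eX).
  by rewrite /row_free eX mxrank_disjoint_sum.
by rewrite mul_col_mx eD eE mul_block_col !mul0mx addr0 add0r.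
Qed.

(** An injective equivariant map carries a basis to a basis with the same coordinate matrix. *)
Lemma tr_restr_inj U A L : (U *m A <= U)%MS -> L *m A = A *m L ->
  (forall v : 'rV_m, (v <= U)%MS -> v *m L = 0 -> v = 0) ->
  tr_restr (U *m L) A = tr_restr U A.
Proof.
move=> sU com inj; have [D eD] := stable_coef sU; rewrite (tr_restr_coef eD).
apply: (@tr_restr_basis _ (row_base U *m L)).
- rewrite -kermx_eq0; apply/rowV0P => v; rewrite sub_kermx mulmxA => /eqP h.
  apply: (row_free_inj (row_base_free U)); rewrite mul0mx; apply: inj => //.
  by rewrite -(eq_row_base U) submxMl.
- by apply: eqmxMr; apply: eq_row_base.
by rewrite -mulmxA com mulmxA eD mulmxA.
Qed.
End TraceRestr.

Section TraceSum.
Variables (K : fieldType) (m : nat) (I : eqType) (U : I -> 'M[K]_m) (A : 'M[K]_m).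
Hypothesis stU : forall i, (U i *m A <= U i)%MS.

Definition sumrows (r : seq I) : 'M[K]_m := foldr (fun i V => (U i + V)%MS) 0 r.

Lemma sumrowsP r (v : 'rV_m) : uniq r -> (v <= sumrows r)%MS ->
  exists2 c : I -> 'rV_m, (forall i, c i <= U i)%MS & v = \sum_(i <- r) c i.
Proof.
elim: r v => [|i r IH] v /=.
  by rewrite submx0 => _ /eqP ->; exists (fun=> 0); [move=> i; apply: sub0mx | rewrite big_nil].
case/andP => ni ur /sub_addsmxP[[a b] /= ev].
have [c hc eb] := IH _ ur (submxMl b (sumrows r)).
exists (fun j => if j == i then a *m U i else c j) => [j|].
  by case: eqP => [->|_]; [apply: submxMl | apply: hc].
rewrite big_cons eqxx ev eb; congr (_ + _); apply: eq_big_seq => j jr.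
by case: eqP => // ej; rewrite -ej jr in ni.
Qed.

Lemma sumrows_stable r : (sumrows r *m A <= sumrows r)%MS.
Proof.
elim: r => [|i r IH] /=; first by rewrite mul0mx sub0mx.
by rewrite addsmxMr addsmx_sub !(submx_trans (stU i)) ?addsmxSl // (submx_trans IH) ?addsmxSr.
Qed.

Lemma sub_sumrows i r : i \in r -> (U i <= sumrows r)%MS.
Proof.
elim: r => //= j r IH; rewrite inE => /predU1P[->|/IH h]; first exact: addsmxSl.
exact: submx_trans h (addsmxSr _ _).
Qed.

Lemma tr_restr_sum r : uniq r ->
  (forall c : I -> 'rV_m, (forall i, (c i <= U i)%MS) -> \sum_(i <- r) c i = 0 ->
     forall i, i \in r -> c i = 0) ->
  tr_restr (sumrows r) A = \sum_(i <- r) tr_restr (U i) A.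
Proof.
elim: r => [|i r IH] /=.
  move=> _ _; rewrite big_nil; have e : row_base (0 : 'M[K]_m) *m A = 0 *m row_base (0 : 'M[K]_m).
    have r0 : row_base (0 : 'M[K]_m) = 0 by apply/eqP; rewrite -submx0 eq_row_base sub0mx.
    by rewrite mul0mx r0 mul0mx.
  by rewrite (tr_restr_coef e) mxtrace0.
case/andP => ni ur ind; rewrite big_cons tr_restr_add // ?sumrows_stable //.
  rewrite IH // => c hc e j jr.
  have := ind (fun k => if k == i then 0 else c k) _ _ j.
  have nj : j != i by apply: contraTneq jr => ->.
  rewrite (negPf nj); apply; last by rewrite inE jr orbT.
    by move=> k; case: eqP => // _; apply: sub0mx.
  rewrite big_cons eqxx add0r -[RHS]e; apply: eq_big_seq => k kr.
  by case: eqP => // ek; rewrite -ek kr in ni.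
apply/eqP/rowV0P => v; rewrite sub_capmx => /andP[vi /(sumrowsP ur)[c hc ev]].
have := ind (fun k => if k == i then - v else c k) _ _ i; rewrite eqxx inE eqxx => h.
apply: oppr_inj; rewrite oppr0; apply: h => //.
  by move=> k; case: eqP => [->|_]; [rewrite -scaleN1r scalemx_sub | apply: hc].
rewrite big_cons eqxx {1}ev -sumrN -big_split big_seq big1 //= => k kr.
by case: eqP => [ek|_]; [rewrite -ek kr in ni | rewrite addNr].
Qed.

End TraceSum.

(** * Invariant complements, and Specht modules as right ideals *)

Section MaschkeSn.
Variables (K : fieldType) (n : nat).
Hypothesis charK : [pchar K] =i pred0.
Notation rho := (Rreg K).

Lemma Rreg_mx_repr : mx_repr [set: {perm 'I_n}] (fun t => rho t : 'M[K]_(Nn n)).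
Proof. by split=> [|s t _ _]; [exact: rho1 | rewrite rhoM]. Qed.

Definition regrep := MxRepresentation Rreg_mx_repr.

Definition stable (U : 'M[K]_(Nn n)) := forall t, (U *m rho t <= U)%MS.

Lemma stable_module U : stable U -> mxmodule regrep U.
Proof. by move=> st; apply/mxmoduleP => t _; apply: st. Qed.

Lemma module_stable U : mxmodule regrep U -> stable U.
Proof. by move=> /mxmoduleP h t; apply: h; rewrite inE. Qed.

(** A complement of [U] in the whole regular module is intersected with [V]; the modular law shows
    that the intersection still complements [U] in [V]. *)
Lemma maschke (U V : 'M[K]_(Nn n)) : stable U -> stable V -> (U <= V)%MS ->
  exists W, [/\ stable W, (W <= V)%MS, (U :&: W = 0)%MS & (V <= U + W)%MS].
Proof.
move=> sU sV UV.
have ch : (pgroup [pchar K]^' [set: {perm 'I_n}])%g.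
  by apply/pgroupP => p pr _; rewrite inE /= charK.
have [W0 mW0 eW0 dW0] := mx_Maschke_pchar regrep ch (stable_module sU) (submx1 U).
exists (V :&: W0)%MS; split.
- move=> t; rewrite sub_capmx (submx_trans (submxMr _ (capmxSl _ _)) (sV t)).
  by rewrite (submx_trans (submxMr _ (capmxSr _ _)) (module_stable mW0 t)).
- exact: capmxSl.
- apply/eqP; rewrite -submx0; move/mxdirect_addsP: dW0 => <-.
  by rewrite sub_capmx capmxSl (submx_trans (capmxSr _ _)) ?capmxSr.
by rewrite (capmxC V) (matrix_modl _ UV) sub_capmx submx_refl andbT eW0 submx1.
Qed.

Lemma env_stable U V : stable U -> env V -> (U *m V <= U)%MS.
Proof.
move=> st [c ->]; rewrite mulmx_sumr; apply: summx_sub => t _.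
by rewrite -scalemxAr; apply: scalemx_sub.
Qed.

Lemma env_stable_row U V (f : 'rV[K]_(Nn n)) : stable U -> env V -> (f <= U)%MS -> (f *m V <= U)%MS.
Proof. by move=> st eV fU; apply: submx_trans (submxMr V fU) _; apply: env_stable. Qed.

Lemma PactE t : Pact K t = rho t :> 'M[K]_(Nn n).
Proof.
apply/matrixP => i j; rewrite !mxE.
have e : feqv (perm_act t (fmono K (pword (Defs.perm_of i)))) (fmono K (pword (Defs.perm_of i * t)%g)).
  apply: feqvP => L; rewrite fpair_subst !fpair_mono.
  have -> : [seq fvar K (permvar t k) | k <- pword (Defs.perm_of i)]
     = [seq fvar K k | k <- pword (Defs.perm_of i * t)%g].
    rewrite /pword -!map_comp; apply: eq_map => k /=; congr fvar.
    by rewrite valK permM.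
  by elim: (pword _) L => [|k w IH] L /=; rewrite ?fpair_one // fpair_mul fpair_var IH.
rewrite e /fcoef /fmono big_cons big_nil /= addr0.
have inj : injective (@pword n).
  move=> s s' /eq_in_map h; apply/permP => k; apply: val_inj.
  by have [] := h k (mem_enum _ k).
by rewrite (inj_eq inj) eq_sym; case: eqP.
Qed.

(** Left multiplication by [f]. It commutes with the right action and maps the right ideal of [B A]
    onto the submodule generated by [f B A]. *)
Definition leftmul (f : 'rV[K]_(Nn n)) : 'M[K]_(Nn n) := \matrix_i (f *m rho (Defs.perm_of i)).

Lemma ds_leftmul f t : ds K t *m leftmul f = f *m rho t.
Proof. by rewrite -rowE rowK perm_of_rank. Qed.

Lemma env_leftmul f U : env U -> ds K 1%g *m U *m leftmul f = f *m U.
Proof.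
move=> [c ->]; rewrite !mulmx_sumr mulmx_suml; apply: eq_bigr => t _.
by rewrite -!scalemxAr -scalemxAl ds_rho mul1g ds_leftmul.
Qed.

Lemma leftmulC f t : leftmul f *m rho t = rho t *m leftmul f.
Proof.
apply: eq_ds_mul => s; rewrite !mulmxA ds_leftmul ds_rho ds_leftmul -mulmxA.
by rewrite rhoM.
Qed.

Lemma spechtmx_row l1 l2 t :
  row (rk t) (spechtmx K n l1 l2) = ds K 1%g *m (Bsym K n l1 l2 *m Asym K n l1 l2 *m rho t).
Proof.
rewrite rowK perm_of_rank /Bsym /Asym !rsymE !mulmxA mulmx_sumr !mulmx_suml.
apply/rowP => j; rewrite mxE summxE.
apply: eq_big => [p|p sp].
  by rewrite inE; apply: eq_forallb => i; rewrite -val_eqE.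
rewrite mulmx_sumr !mulmx_suml summxE; apply: eq_big => [q|q sq].
  by rewrite inE; apply: eq_forallb => i; rewrite -val_eqE.
rewrite -!scalemxAr -!scalemxAl !ds_rho mul1g !mxE eqxx /= sg_false mul1r mulrC.
by rewrite -[in LHS](rank_perm_of j) perm_of_rank -{2}(rank_perm_of j)
  (inj_eq (can_inj (@perm_of_rank n))) eq_sym.
Qed.

Lemma spechtmxP l1 l2 (u : 'rV[K]_(Nn n)) : (u <= spechtmx K n l1 l2)%MS ->
  exists2 U, env U & u = ds K 1%g *m (Bsym K n l1 l2 *m Asym K n l1 l2 *m U).
Proof.
move=> /submxP[w ->]; exists (\sum_t w 0 (rk t) *: rho t); first by exists (fun t => w 0 (rk t)).
rewrite !mulmx_sumr [w]ds_span mulmx_suml; apply: eq_bigr => t _.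
by rewrite -ds_span -!scalemxAr -scalemxAl; congr (_ *: _); rewrite -spechtmx_row -rowE.
Qed.

Lemma sub_spechtmx l1 l2 t :
  (ds K 1%g *m (Bsym K n l1 l2 *m Asym K n l1 l2 *m rho t) <= spechtmx K n l1 l2)%MS.
Proof. by rewrite -spechtmx_row row_sub. Qed.

Lemma spechtmx_stable l1 l2 : stable (spechtmx K n l1 l2).
Proof.
move=> t; apply/row_subP => i; rewrite row_mul -[i]rank_perm_of spechtmx_row.
by rewrite -(mulmxA (ds K 1%g)) -(mulmxA _ (rho _) (rho t)) rhoM; apply: sub_spechtmx.
Qed.

End MaschkeSn.

(** * The decomposition of the central cocharacter *)

Section Cocharacter.
Variables (K : fieldType) (n : nat).
Hypothesis charK : [pchar K] =i pred0.
Notation rho := (Rreg K).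
Implicit Types (v f : 'rV[K]_(Nn n)).

Lemma PcP v : (v <= Pc K n)%MS <-> wcent v.
Proof.
rewrite /Pc spanmxP; first exact: wcentP.
  by apply/wcentP; apply: wcent0.
by move=> a u w /wcentP hu /wcentP hw; apply/wcentP/wcent_lin.
Qed.

Lemma PIP v : (v <= PI K n)%MS <-> wid v.
Proof.
rewrite /PI spanmxP; first exact: widP.
  by apply/widP; apply: wid0.
by move=> a u w /widP hu /widP hw; apply/widP/wid_lin.
Qed.

Lemma wid_env v U : env U -> wid v -> wid (v *m U).
Proof.
move=> [c ->] h; rewrite mulmx_sumr; apply: big_ind; first exact: wid0.
  by move=> a b ha hb; rewrite -[a]scale1r; apply: wid_lin.
move=> t _; rewrite -scalemxAr -[_ *: _]addr0; apply: wid_lin; [exact: wid_rho | exact: wid0].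
Qed.

Lemma wid_central v : wid v -> wcent v.
Proof. by move=> h y sy; rewrite h // is_scalar_mx0. Qed.

Lemma capP v : (v <= Pc K n :&: PI K n)%MS <-> wid v.
Proof.
rewrite sub_capmx; split=> [/andP[_ /PIP //]|h].
by apply/andP; split; [apply/PcP/wid_central | apply/PIP].
Qed.

Lemma stable_rows (U : 'M[K]_(Nn n)) : (forall v t, (v <= U)%MS -> (v *m rho t <= U)%MS) -> stable U.
Proof. by move=> h t; apply/row_subP => i; rewrite row_mul; apply: h; apply: row_sub. Qed.

Lemma Pc_stable : stable (Pc K n).
Proof. by apply: stable_rows => v t /PcP h; apply/PcP/wcent_rho. Qed.

Lemma cap_stable : stable (Pc K n :&: PI K n)%MS.
Proof. by apply: stable_rows => v t /capP h; apply/capP/wid_rho. Qed.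

(* [W] is a complement of the weak identities in the space of weak central polynomials. *)
Variable W : 'M[K]_(Nn n).
Hypotheses (stW : stable W) (W_central : forall v, (v <= W)%MS -> wcent v)
  (W_faithful : forall v, (v <= W)%MS -> wid v -> v = 0).

Lemma W_env f U : env U -> (f <= W)%MS -> (f *m U <= W)%MS.
Proof. by move=> eU fW; apply: env_stable_row. Qed.

Lemma W_large f (T : finType) (g : 'I_n -> T) x c :
  (f <= W)%MS -> (3 < fsz g c)%N -> f *m rho x *m rsym K true g = 0.
Proof.
move=> fW big; apply: W_faithful.
  by rewrite -mulmxA; apply: W_env => //; apply: envM; [apply: env_rho | apply: rsym_env].
apply: (large_class_vanish charK _ big) => p sp.
by rewrite -mulmxA rsym_rho // scalemxAr.
Qed.

Section Shape.
Variables l1 l2 l3 : nat.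
Hypothesis sh : shape3 n l1 l2 l3.
Notation A := (Asym K n l1 l2).
Notation B := (Bsym K n l1 l2).

Lemma W_BA f : (f <= W)%MS -> (f *m B *m A <= W)%MS.
Proof. by move=> fW; do 2?[apply: W_env; first exact: rsym_env]. Qed.

Lemma hwf_neq0 f : (f <= W)%MS -> f *m B *m A != 0 -> hwf l1 l2 f 1%:M != 0.
Proof.
move=> fW; apply: contra_neq => h; apply: W_faithful; first exact: W_BA.
by apply: (hwf_wid charK sh _ h); apply: W_central.
Qed.

(** The multiple of [f'] is chosen so that the highest weight function of the difference vanishes at
    the identity matrix; the difference then gives a weak identity in [W], which is zero. *)
Lemma mult_one f f' : (f <= W)%MS -> (f' <= W)%MS -> f' *m B *m A != 0 ->
  exists c, f *m B *m A = c *: (f' *m B *m A).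
Proof.
move=> fW fW' nz; have nz' := hwf_neq0 fW' nz.
pose c := hwf l1 l2 f 1%:M / hwf l1 l2 f' 1%:M; exists c.
have hW : (f - c *: f' <= W)%MS by rewrite addmx_sub // -scaleNr scalemx_sub.
suff h0 : (f - c *: f') *m B *m A = 0.
  by apply/eqP; rewrite -subr_eq0 -h0 !mulmxBl -!scalemxAl.
apply: W_faithful; first exact: W_BA.
apply: (hwf_wid charK sh); first exact: W_central.
have lin X : hwf l1 l2 (f - c *: f') X = hwf l1 l2 f X - c * hwf l1 l2 f' X.
  by rewrite /hwf mulmxBl -scalemxAl linearB linearZ /= !mxE.
by rewrite lin /c divfK // subrr.
Qed.

Lemma mult_good f : (0 < n)%N -> (f <= W)%MS -> f *m B *m A != 0 -> good_lambda n l1 l2 l3.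
Proof.
move=> n0 fW nz; apply: (hwf_good charK sh (W_central fW) n0).
exact: hwf_neq0.
Qed.

Lemma garnir_in_W f : (f <= W)%MS -> f != 0 ->
  (forall p, stab (rowf l1 l2) p -> f *m rho p = f) ->
  (forall (c d : 'I_3) k, (c < d)%N -> rowf l1 l2 k = d ->
     f *m rsym K false (recolor (rowf l1 l2) k c) = 0) ->
  f *m B *m A != 0.
Proof.
move=> fW nz inv gar; apply: (garnir_specht_neq0 charK sh) => //.
  by move=> g x c; apply: W_large.
move=> c d cd k kd; apply: garnir_recolor => //.
- by rewrite kd; apply: contraTneq cd => ->; rewrite ltnn.
- by move=> p /inv ->; rewrite scale1r.
exact: gar cd kd.
Qed.

End Shape.

(** Three colours suffice because [so_3] has dimension 3: a nonzero vector of [M] has a nonzero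
    value at some assignment of basis vectors, so the symmetriser of that colouring does not kill
    it. A colouring with maximal [sumsq] then provides the Garnir relations. *)
Lemma W_complete (M : 'M[K]_(Nn n)) : stable M -> (M <= W)%MS -> M != 0 ->
  exists l1 l2 l3 f, [/\ shape3 n l1 l2 l3, (f <= M)%MS & f *m Bsym K n l1 l2 *m Asym K n l1 l2 != 0].
Proof.
move=> stM MW M0.
pose P (g : {ffun 'I_n -> 'I_3}) := M *m rsym K false g != 0.
have [g0 Pg0] : exists g, P g.
  have [v vM v0] := rowV0Pn M0.
  have [y [sy ny]] : exists y, (forall i, skew3 (y i)) /\ Phi y v <> 0.
    apply: NNPP => h; case/eqP: v0; apply: W_faithful; first exact: submx_trans vM MW.
    by move=> y sy; apply: NNPP => ny; apply: h; exists y.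
  have [g ng] : exists g : {ffun 'I_n -> 'I_3}, Phi (fun i => evc 1%:M (g i)) v != 0.
    apply: NNPP => h; apply: ny.
    rewrite (eq_Phi _ (fun i => skew_basis charK (sy i))) Phi_distr big1 // => g _.
    by have [->|ng] := eqVneq (Phi (fun i => evc 1%:M (g i)) v) 0; [rewrite scaler0 | case: h; exists g].
  exists g; apply: contra_neq ng => Mg.
  have vg : v *m rsym K false g = 0 by case/submxP: vM => u ->; rewrite -mulmxA Mg mulmx0.
  have : Phi (fun i => evc 1%:M (g i)) (v *m rsym K false g) = 0 by rewrite vg linear0.
  rewrite rsymE mulmx_sumr linear_sum /= (eq_bigr (fun=> Phi (fun i => evc 1%:M (g i)) v)).
    rewrite sumr_const => /eqP; rewrite -scaler_nat scaler_eq0.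
    by rewrite (negPf (natr_neq0 charK (card_stab_gt0 g))) => /eqP.
  move=> p /stabP sp; rewrite sg_false scale1r Phi_rho; apply: eq_Phi => i /=.
  by rewrite sp.
have [g Pg gmax] := arg_maxnP (fun g : {ffun 'I_n -> 'I_3} => sumsq g) Pg0.
(* Sorting the class sizes makes them the rows of a tableau, and a permutation carries [g] to its
   row colouring. *)
pose l := sort geq [seq fsz g c | c <- enum 'I_3].
have sl : size l = 3 by rewrite size_sort size_map size_enum_ord.
have pl : perm_eq l [seq fsz g c | c <- enum 'I_3] by rewrite perm_sort.
have ordl : sorted geq l by apply: sort_sorted => a b; apply: leq_total.
have suml : sumn l = n.
  by rewrite (perm_sumn pl) sumnE big_map big_enum sum_fsz.
case el : l sl pl ordl suml => [|l1 [|l2 [|l3 [|]]]] //= _ pl /and3P[le1 le2 _] suml.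
have sh : shape3 n l1 l2 l3 by rewrite /shape3 -suml addn0 addnA eqxx le1 le2.
have [|s [r hs]] := @match_shape n 3 g (rowf l1 l2).
  rewrite perm_sym; apply: perm_trans pl; rewrite (eq_map (fsz_rowf sh)).
  rewrite (_ : [seq _ | r <- enum 'I_3] = [:: l1; l2; l3]) //.
  rewrite (map_comp (nth 0%N [:: l1; l2; l3]) val) val_enum_ord //.
have eg : rsym K false (rowf l1 l2 : 'I_n -> 'I_3) = rho s *m rsym K false g *m rho s^-1%g.
  by rewrite -rsym_conj; apply: rsym_eq => i j /=; rewrite !hs (inj_eq perm_inj).
have conj0 (h h' : 'I_n -> 'I_3) u : rsym K false h' = rho u *m rsym K false h *m rho u^-1%g ->
    M *m rsym K false h' = 0 -> M *m rsym K false h = 0.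
  move=> e h0; have /submxP[D eD] := stM u^-1%g.
  have e2 : M *m rho u *m rsym K false h = 0.
    have := congr1 (mulmx^~ (rho u)) h0.
    by rewrite /= e mul0mx !mulmxA -(mulmxA _ (rho u^-1)) rhoM mulVg rho1 mulmx1.
  rewrite -[M in LHS]mulmx1 -(rhoK K u^-1%g) invgK mulmxA eD -!mulmxA.
  by rewrite (mulmxA M) e2 mulmx0.
have MA : M *m Asym K n l1 l2 != 0.
  by apply: contra_neq Pg => h; apply: (conj0 g (rowf l1 l2) s eg h).
have [f fMA f0] := rowV0Pn MA.
have fM : (f <= M)%MS.
  by apply: submx_trans fMA _; apply: env_stable => //; apply: rsym_env.
have fW := submx_trans fM MW.
have fsum : sumsq (rowf l1 l2 : 'I_n -> 'I_3) = sumsq g.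
  have -> : sumsq g = sumsq (g \o s).
    apply: eq_bigr => c _; congr (_ ^ 2)%N; rewrite /fsz -!sum1_card.
    by rewrite (reindex_inj (@perm_inj _ s)) /=; apply: eq_bigl => i; rewrite !inE.
  rewrite /sumsq [RHS](reindex_inj (@perm_inj _ r)); apply: eq_bigr => c _.
  by congr (_ ^ 2)%N; apply: eq_card => i; rewrite !inE /= hs (inj_eq perm_inj).
exists l1, l2, l3, f; split=> //; apply: (garnir_in_W sh) => //.
  move=> p sp; case/submxP: fMA => u ->.
  by rewrite -!mulmxA rsym_rho // sg_false scale1r.
move=> c d k cd kd; apply/eqP; apply: contraT => nz.
pose h := recolor (rowf l1 l2 : 'I_n -> 'I_3) k c.
have Ph : P [ffun i => h i].
  rewrite /P (_ : rsym K false [ffun i => h i] = rsym K false h); last first.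
    by apply: rsym_eq => i j; rewrite !ffunE.
  apply: contra_neq nz => e; case/submxP: fM => u ->.
  by rewrite -mulmxA e mulmx0.
have := gmax _ Ph; rewrite /= -fsum.
have -> : sumsq [ffun i => h i] = sumsq h.
  by apply: eq_bigr => e _; congr (_ ^ 2)%N; apply: eq_card => i; rewrite !inE ffunE.
rewrite /h leqNgt => /negP[]; apply: sumsq_recolor; rewrite kd.
  by apply: contraTneq cd => ->; rewrite ltnn.
rewrite !(fsz_rowf sh); case: c d cd {kd nz h Ph} => [[|[|[|//]]] ?] [[|[|[|//]]] ?] //= _; lia.
Qed.

End Cocharacter.

(** * Projection to a complement and the sum of Specht modules *)

Section Assembly.
Variables (K : fieldType) (n : nat).
Hypothesis charK : [pchar K] =i pred0.
Notation rho := (Rreg K).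
Implicit Types (v f : 'rV[K]_(Nn n)).

Lemma good_shape l1 l2 l3 : good_lambda n l1 l2 l3 -> shape3 n l1 l2 l3.
Proof. by case/and5P => e le1 le2 _ _; rewrite /shape3 e le1 le2. Qed.

Lemma good_weight l1 l2 l3 (m1 := (l1 - l2)./2) (m2 := (l2 - l3)./2) :
  good_lambda n l1 l2 l3 ->
  [/\ 2 * (m1 + m2) + l3 = l1, 2 * m2 + l3 = l2 & 0 < m2 + l3]%N.
Proof.
case/and5P => e le1 le2 l20 /andP[o1 o2].
have e1 := odd_double_half (l1 - l2); have e2 := odd_double_half (l2 - l3).
by rewrite (negPf o1) in e1; rewrite (negPf o2) in e2; rewrite /m1 /m2; split; lia.
Qed.

(** The cocharacter is a difference of traces on nested spaces, hence the trace on an invariant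
    complement; no quotient module has to be formed. *)
Lemma complement_exists :
  exists W : 'M[K]_(Nn n), [/\ stable W, forall v, (v <= W)%MS -> wcent v,
    forall v, (v <= W)%MS -> wid v -> v = 0,
    forall v, wcent v -> exists2 w : 'rV_(Nn n), (w <= W)%MS & wid (v - w) &
    forall t, central_cochar K t = tr_restr W (rho t)].
Proof.
have [W [stW WP IW PIW]] := maschke charK (@cap_stable K n) (@Pc_stable K n) (capmxSl _ _).
exists W; split=> //.
- by move=> v vW; apply/PcP; apply: submx_trans vW WP.
- move=> v vW /capP vI; apply/eqP; rewrite -submx0 -IW.
  by rewrite sub_capmx vI vW.
- move=> v /PcP vP; have /sub_addsmxP[[a b] /= ev] := submx_trans vP PIW.
  exists (b *m W); first exact: submxMl.
  by apply/capP; rewrite ev addrK submxMl.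
move=> t; rewrite /central_cochar !PactE.
have e : (Pc K n :&: PI K n + W :=: Pc K n)%MS.
  by apply/eqmxP; rewrite PIW andbT addsmx_sub capmxSl WP.
rewrite -(tr_restr_eq _ e); last first.
  by rewrite addsmxMr addsmx_sub (submx_trans (@cap_stable K n t)) ?addsmxSl ?(submx_trans (stW t)) ?addsmxSr.
by rewrite tr_restr_add // ?cap_stable // [X in X - _]addrC addrK.
Qed.

Variable W : 'M[K]_(Nn n).
Hypotheses (stW : stable W) (W_central : forall v, (v <= W)%MS -> wcent v)
  (W_faithful : forall v, (v <= W)%MS -> wid v -> v = 0)
  (W_proj : forall v, wcent v -> exists2 w : 'rV_(Nn n), (w <= W)%MS & wid (v - w)).

(** The linearised explicit vector satisfies the Garnir relations only modulo weak identities; its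
    component in [W] satisfies them exactly. *)
Lemma good_exists l1 l2 l3 : good_lambda n l1 l2 l3 ->
  exists2 f : 'rV[K]_(Nn n), (f <= W)%MS & f *m Bsym K n l1 l2 *m Asym K n l1 l2 != 0.
Proof.
move=> good; have sh := good_shape good.
have [e1 e2 pos] := good_weight good.
set m1 := (_ - _)./2 in e1 e2 pos; set m2 := (_ - _)./2 in e1 e2 pos.
have hw : hw_vector l1 l2 l3 (hwv K m1 m2 l3).
  by have := hwv_highest charK m1 pos; rewrite e1 e2.
have cw := hwv_central charK m1 m2 l3.
pose g := lin n l1 l2 (hwv K m1 m2 l3).
have [f fW wf] := W_proj (lin_central charK sh hw cw); exists f => //.
have kill U : env U -> wid (g *m U) -> f *m U = 0.
  move=> eU wg; apply: W_faithful; first exact: W_env.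
  have -> : f *m U = -1 *: ((g - f) *m U) + g *m U.
    by rewrite mulmxBl scaleN1r opprB addrNK.
  by apply: wid_lin => //; apply: wid_env.
apply: (garnir_in_W charK stW W_faithful sh) => //.
- apply/eqP => f0; rewrite f0 subr0 in wf.
  have := wf (fun i => evc 1%:M (rowf l1 l2 i)) (fun i => skew_evc _ _).
  rewrite (Phi_lin sh hw (evc 1%:M)) => /eqP; rewrite scaler_eq0.
  rewrite (negPf (natr_neq0 charK (card_stab_gt0 _))) /= => /eqP e.
  by have /eqP[] := hwv_at_frame charK m1 m2 l3; rewrite e mxE.
- move=> p sp; apply/eqP; rewrite -subr_eq0 -{2}[f]mulmx1 -mulmxBr; apply/eqP/kill.
    by rewrite -(rho1 K n) -scaleN1r; apply: envD; [|apply: envZ]; apply: env_rho.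
  by rewrite mulmxBr mulmx1 lin_inv // subrr; apply: wid0.
move=> c d k cd kd; apply: kill; first exact: rsym_env.
exact: (lin_garnir charK sh hw cw cd kd).
Qed.

Definition triple := ('I_n.+1 * 'I_n.+1 * 'I_n.+1)%type.
Definition good3 (q : triple) := good_lambda n q.1.1 q.1.2 q.2.

(** [N q] is the copy of a Specht module generated by a chosen [F q]. The copies fill [W], because a
    complement would contain another copy of a good shape, against multiplicity one; they are
    independent because different shapes are orthogonal. *)
Lemma trace_decomposition t : (0 < n)%N ->
  tr_restr W (rho t) = \sum_(q : triple | good3 q) irr_char K q.1.1 q.1.2 t.
Proof.
move=> n0.
have /fin_all_exists[F hF] : forall q : triple, exists f : 'rV[K]_(Nn n), good3 q ->
    (f <= W)%MS /\ f *m Bsym K n q.1.1 q.1.2 *m Asym K n q.1.1 q.1.2 != 0.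
  move=> q; case: (boolP (good3 q)) => [/good_exists[f fW fn]|_]; last by exists 0.
  by exists f.
pose S (q : triple) := spechtmx K n q.1.1 q.1.2.
pose N (q : triple) := S q *m leftmul (F q).
pose r := [seq q <- enum {: triple} | good3 q].
have ur : uniq r by rewrite filter_uniq ?enum_uniq.
have rP q : (q \in r) = good3 q by rewrite mem_filter mem_enum andbT.
have NP q v : (v <= N q)%MS -> exists2 U, env U &
    v = F q *m Bsym K n q.1.1 q.1.2 *m Asym K n q.1.1 q.1.2 *m U.
  move=> /submxP[D ->]; have [U eU e] := spechtmxP (submxMl D (S q)).
  exists U => //; rewrite mulmxA e env_leftmul ?mulmxA //.
  by apply: envM => //; apply: envM; apply: rsym_env.
have NI q U : env U -> (F q *m Bsym K n q.1.1 q.1.2 *m Asym K n q.1.1 q.1.2 *m U <= N q)%MS.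
  move=> [c ->]; rewrite mulmx_sumr; apply: summx_sub => s _.
  rewrite -scalemxAr; apply: scalemx_sub.
  have := submxMr (leftmul (F q)) (@sub_spechtmx K n q.1.1 q.1.2 s).
  rewrite env_leftmul ?mulmxA //.
  by apply: envM; [apply: envM; apply: rsym_env | apply: env_rho].
have stN q s : (N q *m rho s <= N q)%MS.
  by rewrite /N -mulmxA leftmulC mulmxA; apply/submxMr/spechtmx_stable.
have indep q U : good3 q -> env U ->
    (forall x, F q *m Bsym K n q.1.1 q.1.2 *m Asym K n q.1.1 q.1.2 *m U *m rho x
        *m Bsym K n q.1.1 q.1.2 *m Asym K n q.1.1 q.1.2 = 0) ->
    Bsym K n q.1.1 q.1.2 *m Asym K n q.1.1 q.1.2 *m U = 0.
  by move=> gq eU; apply: (specht_faithful charK (good_shape gq)) => //; case: (hF q gq).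
have tr_N q : good3 q -> tr_restr (N q) (rho t) = irr_char K q.1.1 q.1.2 t.
  move=> gq; apply: tr_restr_inj; [exact: spechtmx_stable | exact: leftmulC |].
  move=> v /spechtmxP[U eU ->]; rewrite env_leftmul; last first.
    by apply: envM => //; apply: envM; apply: rsym_env.
  rewrite !mulmxA => h; rewrite -!mulmxA (mulmxA (Bsym _ _ _ _)) indep ?mulmx0 // => x.
  by rewrite h !mul0mx.
have sumW : (sumrows N r :=: W)%MS.
  have NW : (sumrows N r <= W)%MS.
    apply/rV_subP => v /(sumrowsP ur)[c hc ->].
    rewrite big_seq; apply: summx_sub => q; rewrite rP => gq.
    have [U eU ->] := NP _ _ (hc q); apply: W_env => //.
    by apply: W_BA => //; case: (hF q gq).
  apply/eqmxP; rewrite NW /=.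
  have stS : stable (sumrows N r) by move=> s; apply: sumrows_stable => q; apply: stN.
  have [M [stM MW SM WSM]] := maschke charK stS stW NW.
  suff M0 : M = 0 by rewrite M0 addsmx0 in WSM.
  apply/eqP; apply: contraT => /(W_complete charK stW W_faithful stM MW).
  case=> l1 [l2 [l3 [f [sh fM fn]]]]; have fW := submx_trans fM MW.
  have good := mult_good charK stW W_central W_faithful sh n0 fW fn.
  have [/eqP en _ _] := and3P sh.
  have lt1 : (l1 < n.+1)%N by lia.
  have lt2 : (l2 < n.+1)%N by lia.
  have lt3 : (l3 < n.+1)%N by lia.
  pose q : triple := (Ordinal lt1, Ordinal lt2, Ordinal lt3).
  have gq : good3 q by [].
  have [FW Fn] := hF q gq.
  have [c ec] := mult_one charK stW W_central W_faithful sh fW FW Fn.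
  (* The generator found in [M] is a multiple of the one in [N q], so it lies in the zero
     intersection. *)
  case/eqP: fn; apply/eqP; rewrite -submx0 -SM sub_capmx; apply/andP; split.
    rewrite ec; apply: scalemx_sub; apply: submx_trans (sub_sumrows N (_ : q \in r)); last by rewrite rP.
    by have := NI q 1%:M; rewrite mulmx1; apply; rewrite -(rho1 K n); apply: env_rho.
  by do 2?[apply: env_stable_row => //; first exact: rsym_env].
have stS s : (sumrows N r *m rho s <= sumrows N r)%MS by apply: sumrows_stable => q; apply: stN.
rewrite -(tr_restr_eq (stS t) sumW) tr_restr_sum //; last first.
  move=> c hc sum0 q; rewrite rP => gq.
  have [U eU eq] := NP _ _ (hc q).
  suff : Bsym K n q.1.1 q.1.2 *m Asym K n q.1.1 q.1.2 *m U = 0.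
    by move=> h; rewrite eq -!mulmxA (mulmxA (Bsym _ _ _ _)) h mulmx0.
  apply: indep => // x; rewrite -eq.
  (* Multiplication by [x B A] for the shape [q] kills every other summand. *)
  have := congr1 (fun z => z *m rho x *m Bsym K n q.1.1 q.1.2 *m Asym K n q.1.1 q.1.2) sum0.
  rewrite !mul0mx !mulmx_suml (bigD1_seq q) ?rP //= big_seq_cond big1 ?addr0 // => k.
  rewrite rP => /andP[gk nk]; have [V eV ->] := NP _ _ (hc k).
  rewrite -!(mulmxA (F k)) -(mulmxA _ V (rho x)).
  rewrite (specht_orthogonal charK (good_shape gk) (good_shape gq)) ?mulmx0 //.
    apply: contra nk => /eqP[e1 e2].
    have [/eqP a1 _ _] := and3P (good_shape gk); have [/eqP a2 _ _] := and3P (good_shape gq).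
    apply/eqP; case: k q e1 e2 a1 a2 {gk gq hc eq U eU V eV} => [[k1 k2] k3] [[q1 q2] q3] /=.
    by move=> e1 e2 a1 a2; congr (_, _, _); apply: val_inj => /=; lia.
  by apply: envM => //; apply: env_rho.
rewrite big_filter big_enum_cond /=; apply: eq_bigr => q; exact: tr_N.
Qed.

End Assembly.

Theorem theorem4p6 (K : fieldType) (charK : [pchar K] =i pred0) :
  (forall (n : nat) (t : {perm 'I_n}), (0 < n)%N ->
     central_cochar K t =
     \sum_(l1 < n.+1) \sum_(l2 < n.+1) \sum_(l3 < n.+1 | good_lambda n l1 l2 l3)
        irr_char K l1 l2 t)
  /\
  (forall l1 l2 l3 : nat, good_lambda (l1 + l2 + l3) l1 l2 l3 ->
     let m1 := ((l1 - l2)./2)%N in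
     let m2 := ((l2 - l3)./2)%N in
     let w := hwv K m1 m2 l3 in
     [/\ weak_central w,
         ~ weak_identity w,
         hw_vector l1 l2 l3 w
       & forall f : fpoly K, weak_central f -> hw_vector l1 l2 l3 f ->
           exists c : K, weak_identity (fsub f (fscale c w))]).
Proof.
split=> [n t n0|l1 l2 l3 good m1 m2 w].
  have [W [stW Wc Wf Wp ->]] := @complement_exists K n charK.
  rewrite (trace_decomposition charK stW Wc Wf Wp t n0).
  by rewrite pair_big /= pair_big_dep.
have [e1 e2 pos] := good_weight good.
have hw : hw_vector l1 l2 l3 w by have := hwv_highest charK m1 pos; rewrite e1 e2.
have cw := hwv_central charK m1 m2 l3 : weak_central w.
have nz : fval w 1%:M != 0 := hwv_at_frame charK m1 m2 l3.
split=> // [wi|f cf hf]; last exact: (highest_weight_unique charK cf hf cw hw nz).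
by case/eqP: nz; rewrite /fval wi ?mxE // => j; apply: skew_evX.
Qed.
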